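(* Let $0\le \beta\le 1$. Consider the kinetic wave equation $\partial_t f=\mathcal{C}[f]$ and its gain-only counterpart $\partial_t f=\mathcal{G}[f]$, where the operators $\mathcal{C}$ and $\mathcal{G}$ (which depend on $\beta$), the spaces $\langle k_1\rangle^{-M}L^\infty_{k_1}$ and the notion of strong solution are as defined in the context. (1) (Well-posedness.) Assume $0\le\beta\le \frac14$. Then for every $M>6$ the equation $\partial_t f=\mathcal{C}[f]$ is locally well-posed in $\langle k_1\rangle^{-M}L^\infty_{k_1}$: for every $f_0\in\langle k_1\rangle^{-M}L^\infty_{k_1}$ there exists $T>0$ such that $\partial_t f=\mathcal{C}[f]$ has a unique strong solution $f\in C([0,T];\langle k_1\rangle^{-M}L^\infty_{k_1})$ on $[0,T]$ with initial datum $f_0$. (2) (Ill-posedness.) Assume $\frac14<\beta\le 1$. (2a) For every $M>6$, the gain-only equation $\partial_t f=\mathcal{G}[f]$ is ill-posed in $\langle k_1\rangle^{-M}L^\infty_{k_1}$, regardless of the size of the initial datum: for every $\delta>0$ there exists $f_0\in \langle k_1\rangle^{-M}L^\infty_{k_1}$ with $\|\langle k_1\rangle^M f_0\|_{L^\infty_{k_1}}=\delta$ such that for no $T>0$ does $\partial_t f=\mathcal{G}[f]$ have a strong solution on $[0,T]$ with initial datum $f_0$. (2b) For every $M>10$, the full equation $\partial_t f=\mathcal{C}[f]$ is ill-posed in $\langle k_1\rangle^{-M}L^\infty_{k_1}$, regardless of the size of the initial datum: for every $\delta>0$ there exists $f_0\in \langle k_1\rangle^{-M}L^\infty_{k_1}$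 with $\|\langle k_1\rangle^M f_0\|_{L^\infty_{k_1}}=\delta$ such that for no $T>0$ does $\partial_t f=\mathcal{C}[f]$ have a strong solution on $[0,T]$ with initial datum $f_0$.
   Context: Notation: $\langle x\rangle:=\sqrt{1+|x|^2}$. For $M>0$, $\langle k_1\rangle^{-M}L^\infty_{k_1}$ is the Banach space of (classes of) measurable functions $f:\mathbb{R}^3\to\mathbb{R}$ with norm $\|\langle k_1\rangle^M f\|_{L^\infty(\mathbb{R}^3)}<\infty$. For $f$ on $\mathbb{R}^3$, write $f_i=f(k_i)$. Collision operators: for $0\le\beta\le1$, $$\mathcal{C}[f](k_1)=|k_1|^{2\beta}\int_{\mathbb{R}^9}(|k_2||k_3||k_4|)^{2\beta}\,\big(f_2f_3f_4+f_1f_3f_4-f_1f_2f_4-f_1f_2f_3\big)\,\delta(\Sigma)\,\delta(\Omega)\,dk_2\,dk_3\,dk_4,$$ $$\mathcal{G}[f](k_1)=|k_1|^{2\beta}\int_{\mathbb{R}^9}(|k_2||k_3||k_4|)^{2\beta}\,\big(f_2f_3f_4+f_1f_3f_4\big)\,\delta(\Sigma)\,\delta(\Omega)\,dk_2\,dk_3\,dk_4,$$ where $\Sigma=k_1+k_2-k_3-k_4$, $\Omega=|k_1|^2+|k_2|^2-|k_3|^2-|k_4|^2$ and $\delta$ denotes the Dirac delta. Explicitly, after parametrizing the resonant manifold $\{\Sigma=0,\Omega=0\}$, for any $\Phi$, $$\int_{\mathbb{R}^9}\Phi(k_1,k_2,k_3,k_4)\,\delta(\Sigma)\delta(\Omega)\,dk_2dk_3dk_4=\frac18\int_{\mathbb{R}^3\times\mathbb{S}^2}|k_1-k_2|\,\Phi(k_1,k_2,k_1^*,k_2^*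 )\,d\sigma\,dk_2,$$ with $k_1^*=\frac{k_1+k_2}{2}+\frac{|k_1-k_2|}{2}\sigma$ and $k_2^*=\frac{k_1+k_2}{2}-\frac{|k_1-k_2|}{2}\sigma$. Strong solution: let $T>0$ and $f_0\in\langle k_1\rangle^{-M}L^\infty_{k_1}$. A strong solution of $\partial_t f=\mathcal{C}[f]$ on $[0,T]$ with initial datum $f_0$ is a function $f\in C([0,T];\langle k_1\rangle^{-M}L^\infty_{k_1})$ such that $f(t)=f_0+\int_0^t\mathcal{C}[f](s)\,ds$ for all $t\in[0,T]$ (equality for a.e. $k_1$). The definition for the gain-only equation is the same with $\mathcal{C}$ replaced by $\mathcal{G}$. *)

(* Defs.v *)
From HB Require Import structures.
From mathcomp Require Import all_boot all_order all_algebra.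
From mathcomp Require Import all_classical all_reals all_analysis.
Import Order.TTheory GRing.Theory Num.Theory.
Import numFieldNormedType.Exports.

Set Implicit Arguments.
Unset Strict Implicit.
Unset Printing Implicit Defensive.

Local Open Scope classical_set_scope.
Local Open Scope ring_scope.

(* The library's norm on products is the max norm, hence [enorm] below. *)
Notation vec3 R := (R * R * R)%type.

(* The library proves this fact, but its canonical instance is not found for
   measures that are not subprobabilities. *)
Lemma product_sigma_finite d1 d2 (T1 : measurableType d1)
    (T2 : measurableType d2) (R : realType)
    (m1 : {sigma_finite_measure set T1 -> \bar R})
    (m2 : {sigma_finite_measure set T2 -> \bar R}) :
  sigma_finite setT (m1 \x m2)%E.
Proof.
have /sigma_finiteP[F [TF ndF Foo]] := sigma_finiteT m1.
have /sigma_finiteP[G [TG ndG Goo]] := sigma_finiteT m2.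
exists (fun n => F n `*` G n).
  rewrite -setXTT TF TG predeqE => -[x y]; split.
    move=> [/= [n _ Fnx] [k _ Gky]]; exists (maxn n k) => //; split.
    - by move: x Fnx; exact/subsetPset/ndF/leq_maxl.
    - by move: y Gky; exact/subsetPset/ndG/leq_maxr.
  by move=> [n _ []/= ? ?]; split; exists n.
move=> k; have [? ?] := Foo k; have [? ?] := Goo k.
split; first exact: measurableX.
by rewrite product_measure1E// lte_mul_pinfty// ge0_fin_numE.
Qed.

Section KineticWave.
Context {R : realType}.
Implicit Types (k : vec3 R) (f : vec3 R -> R).

Definition enorm k : R := Num.sqrt (k.1.1 ^+ 2 + k.1.2 ^+ 2 + k.2 ^+ 2).

Definition scale3 (a : R) k : vec3 R := (a * k.1.1, a * k.1.2, a * k.2).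

Definition bracket k : R := Num.sqrt (1 + enorm k ^+ 2).

Definition leb2 := (@lebesgue_measure R \x @lebesgue_measure R)%E.

HB.instance Definition _ := Measure.on leb2.
HB.instance Definition _ :=
  Measure_isSigmaFinite.Build _ _ _ leb2 (product_sigma_finite _ _).

Definition leb3 := (leb2 \x @lebesgue_measure R)%E.

HB.instance Definition _ := Measure.on leb3.
HB.instance Definition _ :=
  Measure_isSigmaFinite.Build _ _ _ leb3 (product_sigma_finite _ _).

(* Functions stand for their a.e. classes; the norm is the essential supremum,
   so it does not depend on the representative. *)
Definition wnorm (M : R) f : \bar R :=
  Lnorm leb3 +oo%E (fun k => (bracket k `^ M * f k)%:E).

Definition wLinfty (M : R) f : Prop :=
  measurable_fun setT f /\ (wnorm M f < +oo)%E.

(* The unit sphere S^2 in spherical coordinates a = (theta, phi), with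
   theta in [0, pi], phi in [0, 2 pi] and surface element
   sin theta dtheta dphi. *)
Definition sphere_pt (a : R * R) : vec3 R :=
  (sin a.1 * cos a.2, sin a.1 * sin a.2, cos a.1).

Definition sphere_dom : set (R * R) := `[0, pi] `*` `[0, 2 * pi].

Definition post1 k1 k2 (w : vec3 R) : vec3 R :=
  scale3 2^-1 (k1 + k2) + scale3 (enorm (k1 - k2) / 2) w.

Definition post2 k1 k2 (w : vec3 R) : vec3 R :=
  scale3 2^-1 (k1 + k2) - scale3 (enorm (k1 - k2) / 2) w.

(* The integral of Phi against delta(Sigma) delta(Omega) dk2 dk3 dk4, through
   the parametrization of the resonant manifold by (k2, sigma). *)
Definition resonant_int
    (Phi : vec3 R -> vec3 R -> vec3 R -> vec3 R -> R) k1 : R :=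
  8^-1 * \int[(leb3 \x leb2)%E]_(x in setT `*` sphere_dom)
    (enorm (k1 - x.1) *
     Phi k1 x.1 (post1 k1 x.1 (sphere_pt x.2)) (post2 k1 x.1 (sphere_pt x.2)) *
     sin x.2.1).

Definition collision (beta : R) f k1 : R :=
  enorm k1 `^ (2 * beta) *
  resonant_int (fun k1 k2 k3 k4 =>
    (enorm k2 * enorm k3 * enorm k4) `^ (2 * beta) *
    (f k2 * f k3 * f k4 + f k1 * f k3 * f k4
     - f k1 * f k2 * f k4 - f k1 * f k2 * f k3)) k1.

Definition gain (beta : R) f k1 : R :=
  enorm k1 `^ (2 * beta) *
  resonant_int (fun k1 k2 k3 k4 =>
    (enorm k2 * enorm k3 * enorm k4) `^ (2 * beta) *
    (f k2 * f k3 * f k4 + f k1 * f k3 * f k4)) k1.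

(* The equation u(t) = f0 + \int_0^t Q[u(s)] ds, for a.e. wave vector k. As
   each u(s) is only an a.e. class, the time integral at fixed k is taken along
   a representative F of the curve that is jointly measurable in (s, k). Any
   continuous curve in the weighted L^infty space has such a representative,
   and for Q = collision or gain the choice of F is immaterial, by Fubini. *)
Definition integral_equation (Q : (vec3 R -> R) -> vec3 R -> R) (T : R)
    f0 (u : R -> vec3 R -> R) : Prop :=
  exists F : R -> vec3 R -> R,
  [/\ measurable_fun (`[0, T] `*` setT) (fun p : R * vec3 R => F p.1 p.2),
      forall t, t \in `[0, T] -> F t = u t %[ae leb3],
      {ae leb3, forall k,
        (@lebesgue_measure R).-integrable `[0, T] (fun s => (Q (F s) k)%:E)} &
      forall t, t \in `[0, T] ->
        {ae leb3, forall k,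
          u t k = f0 k + \int[@lebesgue_measure R]_(s in `[0, t]) Q (F s) k}].

Definition continuous_curve (M T : R) (u : R -> vec3 R -> R) : Prop :=
  (forall t, t \in `[0, T] -> wLinfty M (u t)) /\
  (forall t, t \in `[0, T] ->
     wnorm M (u s \- u t) @[s --> within `[0, T] (nbhs t)] --> 0%E).

Definition strong_solution (Q : (vec3 R -> R) -> vec3 R -> R) (M T : R)
    f0 (u : R -> vec3 R -> R) : Prop :=
  continuous_curve M T u /\ integral_equation Q T f0 u.

Definition locally_well_posed (Q : (vec3 R -> R) -> vec3 R -> R) (M : R) :=
  forall f0, wLinfty M f0 ->
  exists T : R, [/\ 0 < T,
    exists u, strong_solution Q M T f0 u &
    forall u v, strong_solution Q M T f0 u -> strong_solution Q M T f0 v ->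
      forall t, t \in `[0, T] -> u t = v t %[ae leb3]].

Definition ill_posed_any_size (Q : (vec3 R -> R) -> vec3 R -> R) (M : R) :=
  forall delta : R, 0 < delta ->
  exists f0, [/\ wLinfty M f0, wnorm M f0 = delta%:E &
    forall T : R, 0 < T -> ~ exists u, strong_solution Q M T f0 u].

End KineticWave.

(* Main.v *)
(* Energy conservation makes the larger of <k1*>, <k2*> comparable to any of
   <k1>, <k2>, so for f = O(<k>^-M) the integrand is dominated by
   <k1>^(4 beta - M) <k2>^(4 beta - M) |k1 - k2| (<k1*>^-4 + <k2*>^-4).
   The spherical averages of <k1*>^-4 and <k2*>^-4 are O(<k1 - k2>^-2), hence
   the operator is bounded by <k1>^(4 beta - 1) <k1>^-M as soon as
   M > 4 beta + 4. For beta <= 1/4 it is therefore locally Lipschitz on the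
   weighted space, and Picard iteration applies.

   The exponent 4 beta - 1 is attained by the interactions with k2, k2* = O(1)
   and k1* at distance O(1) from k1, that is, sigma in a cap of radius
   1 / <k1>. For beta > 1/4 a solution that stays near its datum on [0, tau]
   would have to grow at rate <k1>^(4 beta - 1) <k1>^-M, which leaves the space
   at once. For the gain-only equation the datum is delta <k>^-M. For the full
   equation it is the restriction of delta <k>^-M to a half space: the losses
   of the datum at k1 carry a factor f(k1), so they vanish outside that half
   space, where one looks at k1; the operator bound, which now needs
   M > 4 beta + 4 with beta up to 1, controls the effect of perturbing the
   datum. *)
From HB Require Import structures.
Require Import Defs.
From mathcomp Require Import all_boot all_order all_algebra.
From mathcomp Require Import all_classical all_reals all_analysis.
From mathcomp Require Import measurable_realfun ess_sup_inf.
From mathcomp Require Import ring lra.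
Import Order.TTheory GRing.Theory Num.Theory.
Import numFieldNormedType.Exports.
Set Implicit Arguments.
Unset Strict Implicit.
Unset Printing Implicit Defensive.
Local Open Scope classical_set_scope.
Local Open Scope ring_scope.

(** * Geometry of the collisions *)

Section Geometry.
Context {R : realType}.
Implicit Types (k l : vec3 R) (a : R * R) (x y : R).

(** Gain and full operator are instances of one [cubic_op P], so the estimates are proved once. In a
    gain monomial both outgoing weights are present and pay for the missing incoming weight. In a
    loss monomial both incoming weights are present; of the missing outgoing vector only the power 2
    beta of its modulus remains, and energy conservation bounds that modulus by <k1><k2>. A
    spherical average of <k*>^-4 splits into two successive circle averages, each spending two of
    the four powers and each an arctangent.

    Obstacle: solutions are classes modulo null sets, whereas the operator samples f at k1* and k2*.
    Pointwise estimates are proved for representatives bounded everywhere and carried over by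
    invariance of the operator under null modifications. Likewise an estimate known at each time off
    a null set of wave vectors must become one for almost every wave vector at almost every time,
    before time integrals can be compared.

    For the gain-only equation, M > 6 and beta <= 1 give M > 4 beta + 2, which makes the resonant
    integral converge at each k; positivity then replaces the operator bound. *)

Lemma enorm_ge0 k : 0 <= enorm k.
Proof. exact: sqrtr_ge0. Qed.

Lemma sqr_enorm k : enorm k ^+ 2 = k.1.1 ^+ 2 + k.1.2 ^+ 2 + k.2 ^+ 2.
Proof. by rewrite sqr_sqrtr// !addr_ge0// sqr_ge0. Qed.

Lemma sqr_bracket k :
  bracket k ^+ 2 = 1 + (k.1.1 ^+ 2 + k.1.2 ^+ 2 + k.2 ^+ 2).
Proof. by rewrite sqr_sqrtr sqr_enorm// !addr_ge0// sqr_ge0. Qed.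

Lemma bracket_ge1 k : 1 <= bracket k.
Proof.
by rewrite -(@ler_pXn2r _ 2) ?nnegrE ?ler01 ?sqrtr_ge0// expr1n sqr_bracket
  lerDl !addr_ge0// sqr_ge0.
Qed.

Lemma bracket_gt0 k : 0 < bracket k.
Proof. exact: lt_le_trans ltr01 (bracket_ge1 k). Qed.

Lemma bracket_ge0 k : 0 <= bracket k.
Proof. exact: ltW (bracket_gt0 k). Qed.

Lemma enorm_le_bracket k : enorm k <= bracket k.
Proof.
by rewrite -(@ler_pXn2r _ 2) ?nnegrE ?enorm_ge0 ?bracket_ge0//
  sqr_bracket sqr_enorm lerDr.
Qed.

(** From |k + l|^2 <= 2|k|^2 + 2|l|^2. This is Peetre's inequality, used to move a bracket across a
    difference. *)
Lemma bracketD_le k l : bracket (k + l) <= 2 * (bracket k * bracket l).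
Proof.
rewrite -(@ler_pXn2r _ 2) ?nnegrE ?mulr_ge0 ?bracket_ge0//.
rewrite !exprMn !sqr_bracket/=.
move: k l => [[a b] c] [[x y] z] /=.
have := sqr_ge0 (a - x); have := sqr_ge0 (b - y); have := sqr_ge0 (c - z).
have : 0 <= (a ^+ 2 + b ^+ 2 + c ^+ 2) * (x ^+ 2 + y ^+ 2 + z ^+ 2).
  by rewrite mulr_ge0// !addr_ge0// sqr_ge0.
nra.
Qed.

Lemma bracketN k : bracket (- k) = bracket k.
Proof. by rewrite /bracket !sqr_enorm/= !sqrrN. Qed.

Lemma bracketB_le k l : bracket k <= 2 * (bracket l * bracket (k - l)).
Proof. by rewrite -{1}(subrKC l k) bracketD_le. Qed.

Lemma sphere_pt_norm a : let s := @sphere_pt R a in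
  s.1.1 ^+ 2 + s.1.2 ^+ 2 + s.2 ^+ 2 = 1.
Proof.
rewrite /= !exprMn -mulrDr cos2Dsin2 mulr1 addrC; exact: cos2Dsin2.
Qed.

(** Parallelogram law: the outgoing vectors are c + r w and c - r w with |w| = 1, and 2|c|^2 + 2 r^2
    = |k|^2 + |l|^2 for c the midpoint and r = |k - l| / 2. *)
Lemma post_energy k l a :
  bracket (post1 k l (sphere_pt a)) ^+ 2 +
  bracket (post2 k l (sphere_pt a)) ^+ 2 = bracket k ^+ 2 + bracket l ^+ 2.
Proof.
have := sphere_pt_norm a; rewrite !sqr_bracket /post1 /post2.
have := sqr_enorm (k - l).
move: (sphere_pt a) (enorm _) => [[x y] z] r /=.
move: k l => [[k1 k2] k3] [[l1 l2] l3] /= hr hs.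
rewrite -[RHS]addr0.
have -> : 0 = 2^-1 * (r ^+ 2 - ((k1 - l1) ^+ 2 + (k2 - l2) ^+ 2 + (k3 - l3) ^+ 2)).
  by rewrite hr; ring.
transitivity (1 + 1 + 2^-1 * ((k1 + l1) ^+ 2 + (k2 + l2) ^+ 2 + (k3 + l3) ^+ 2)
  + 2^-1 * r ^+ 2 * (x ^+ 2 + y ^+ 2 + z ^+ 2)); first by field.
by rewrite hs; field.
Qed.

(** With a = <k>^2 and b = <l>^2, energy conservation leaves |k1*|^2 <= a + b - 2, and (a - 1)(b -
    1) >= 0 finishes. The bound serves the loss terms, where the weight of one outgoing vector is
    missing. *)
Lemma post1_le k l a :
  enorm (post1 k l (sphere_pt a)) <= bracket k * bracket l.
Proof.
rewrite -(@ler_pXn2r _ 2) ?nnegrE ?mulr_ge0 ?bracket_ge0 ?enorm_ge0//.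
have := post_energy k l a; rewrite exprMn.
have := sqr_bracket (post1 k l (sphere_pt a)); rewrite -sqr_enorm.
have sq (m : vec3 R) : 1 <= bracket m ^+ 2 by rewrite exprn_ege1 ?bracket_ge1.
move: (sq k) (sq l) (sq (post2 k l (sphere_pt a))); nra.
Qed.

Lemma post2_le k l a :
  enorm (post2 k l (sphere_pt a)) <= bracket k * bracket l.
Proof.
rewrite -(@ler_pXn2r _ 2) ?nnegrE ?mulr_ge0 ?bracket_ge0 ?enorm_ge0//.
have := post_energy k l a; rewrite exprMn.
have := sqr_bracket (post2 k l (sphere_pt a)); rewrite -sqr_enorm.
have sq (m : vec3 R) : 1 <= bracket m ^+ 2 by rewrite exprn_ege1 ?bracket_ge1.
move: (sq k) (sq l) (sq (post1 k l (sphere_pt a))); nra.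
Qed.

(* The larger of the two outgoing brackets is comparable to any incoming one,
   which trades one of the two decay factors for decay in [x]. *)
Lemma energy_trade (p x y c d : R) : 4 <= p -> 1 <= x -> 1 <= c -> 1 <= d ->
  x ^+ 2 <= c ^+ 2 + d ^+ 2 ->
  c `^ (- p) * d `^ (- p) <=
  2 `^ p * x `^ (- p) * (c ^- 4 + d ^- 4).
Proof.
move=> p4 x1.
have dec z : 1 <= z -> z `^ (- p) <= z ^- 4.
  move=> z1; rewrite powRN -powR_mulrn ?(le_trans ler01)//.
  by rewrite lef_pV2 ?posrE ?powR_gt0 ?(lt_le_trans ltr01)// ler_powR.
have half z : 1 <= z -> x / 2 <= z -> z `^ (- p) <= 2 `^ p * x `^ (- p).
  move=> z1 xz; have z0 : 0 < z by exact: lt_le_trans ltr01 z1.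
  have x0 : 0 < x by exact: lt_le_trans ltr01 x1.
  rewrite !powRN ler_pdivlMr ?powR_gt0// mulrC ler_pdivrMr ?powR_gt0//.
  rewrite -powRM ?ler0n ?(ltW z0)// ge0_ler_powR ?nnegrE ?mulr_ge0 ?(ltW z0) ?(ltW x0)//.
    by lra.
  by move: xz; rewrite ler_pdivrMr// mulrC.
(* For c the larger one, 2 c^2 >= x^2 gives c >= x / 2, so [half] applies to c, while [dec] keeps
   d^-4 because p >= 4. *)
wlog cd : c d / d <= c.
  move=> H; have [dc|/ltW cd] := leP d c; first exact: H.
  by move=> *; rewrite mulrC [c^-4 + _]addrC; apply: H => //; rewrite addrC.
move=> c1 d1 h.
rewrite ler_pM ?powR_ge0//; first by rewrite half//; nra.
by rewrite (le_trans (dec _ d1))// lerDr invr_ge0 exprn_ge0// (le_trans ler01).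
Qed.

End Geometry.

(** * Pointwise bound of the cubic weights *)

Section Weight.
Context {R : realType}.
Implicit Types (k l : vec3 R) (a : R * R).

Definition weight (M : R) k := bracket k `^ (- M).

Lemma weight_gt0 M k : 0 < weight M k.
Proof. by rewrite powR_gt0// bracket_gt0. Qed.

Lemma weight_ge0 M k : 0 <= weight M k.
Proof. exact/ltW/weight_gt0. Qed.

(** Here [b] stands for 2 beta, [e] for moduli and [x] for brackets. In the first two monomials, the
    gains, [energy_trade] with exponent M - b converts the two outgoing powers into the missing
    incoming one. In the last two, the losses, e3 or e4 is at most x1 * x2, and the remaining
    outgoing power is at most x^-4 because M - b >= 4. *)
Lemma cubic_weight_le (b M e1 e2 e3 e4 x1 x2 x3 x4 : R) :
  0 <= b -> 4 <= M - b ->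
  0 <= e1 <= x1 -> 0 <= e2 <= x2 -> 0 <= e3 <= x3 -> 0 <= e4 <= x4 ->
  1 <= x1 -> 1 <= x2 -> 1 <= x3 -> 1 <= x4 ->
  e3 <= x1 * x2 -> e4 <= x1 * x2 ->
  x3 ^+ 2 + x4 ^+ 2 = x1 ^+ 2 + x2 ^+ 2 ->
  e1 `^ b * (e2 * e3 * e4) `^ b *
    (x2 `^ (- M) * x3 `^ (- M) * x4 `^ (- M) +
     x1 `^ (- M) * x3 `^ (- M) * x4 `^ (- M) +
     x1 `^ (- M) * x2 `^ (- M) * x4 `^ (- M) +
     x1 `^ (- M) * x2 `^ (- M) * x3 `^ (- M)) <=
  4 * 2 `^ (M - b) * (x1 `^ (2 * b) * x1 `^ (- M)) * x2 `^ (2 * b - M) *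
    (x3 ^- 4 + x4 ^- 4).
Proof.
move=> b0 Mb /andP[e10 e1x] /andP[e20 e2x] /andP[e30 e3x] /andP[e40 e4x].
move=> x11 x21 x31 x41 e312 e412 energy.
have gt0 (x : R) : 1 <= x -> 0 < x by exact: lt_le_trans.
have ge0 (x : R) : 1 <= x -> 0 <= x by move=> /gt0/ltW.
have K1 : 1 <= 2 `^ (M - b) :> R.
  by rewrite -[leLHS](powRr0 (2 : R)) ler_powR ?ler1n//; lra.
have powD (x r s : R) : 1 <= x -> x `^ (r + s) = x `^ r * x `^ s.
  by move=> /gt0 x0; rewrite powRD// (gt_eqF x0) implybT.
set S := x3 ^- 4 + x4 ^- 4.
have i30 : 0 <= x3 ^- 4 by rewrite invr_ge0 exprn_ge0 ?ge0.
have i40 : 0 <= x4 ^- 4 by rewrite invr_ge0 exprn_ge0 ?ge0.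
have S0 : 0 <= S by rewrite addr_ge0.
have t1 : x3 `^ (- (M - b)) * x4 `^ (- (M - b)) <=
    2 `^ (M - b) * x1 `^ (- (M - b)) * S.
  by apply: energy_trade => //; rewrite energy lerDl sqr_ge0.
have t2 : x3 `^ (- (M - b)) * x4 `^ (- (M - b)) <=
    2 `^ (M - b) * x2 `^ (- (M - b)) * S.
  by apply: energy_trade => //; rewrite energy lerDr sqr_ge0.
have pw (e x : R) : 0 <= e <= x -> e `^ b <= x `^ b.
  move=> /andP[e0 ex]; rewrite ge0_ler_powR ?nnegrE//; exact: le_trans ex.
have split_w (x : R) : 1 <= x -> x `^ (- (M - b)) = x `^ b * x `^ (- M).
  by move=> x0; rewrite -powD//; congr (_ `^ _); ring.
have dec (x : R) : 1 <= x -> x `^ b * x `^ (- M) <= x ^- 4.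
  move=> x0; have x0' := gt0 x x0; rewrite -split_w// powRN -powR_mulrn ?(ltW x0')//.
  by rewrite lef_pV2 ?posrE ?powR_gt0// ler_powR.
move: t1 t2; rewrite !split_w// => t1 t2.
rewrite (powRM _ (mulr_ge0 e20 e30) e40) (powRM _ e20 e30).
have E1 := pw e1 x1; have E2 := pw e2 x2; have E3 := pw e3 x3.
have E4 := pw e4 x4.
have E3' : e3 `^ b <= x1 `^ b * x2 `^ b.
  rewrite -powRM ?ge0//; apply: pw; rewrite e30; exact: e312.
have E4' : e4 `^ b <= x1 `^ b * x2 `^ b.
  rewrite -powRM ?ge0//; apply: pw; rewrite e40; exact: e412.
move: E1 E2 E3 E4; rewrite e10 e20 e30 e40 e1x e2x e3x e4x.
move=> /(_ isT) E1 /(_ isT) E2 /(_ isT) E3 /(_ isT) E4.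
have -> : x1 `^ (2 * b) = x1 `^ b * x1 `^ b by rewrite -powD//; congr (_ `^ _); ring.
have -> : x2 `^ (2 * b - M) = x2 `^ b * (x2 `^ b * x2 `^ (- M)).
  by rewrite -!powD//; congr (_ `^ _); ring.
have d3 := dec _ x31; have d4 := dec _ x41.
have Q1 : 1 <= x1 `^ b by rewrite -[leLHS](powRr0 x1) ler_powR.
have Q2 : 1 <= x2 `^ b by rewrite -[leLHS](powRr0 x2) ler_powR.
move: Q1 Q2 t1 t2 E1 E2 E3 E4 E3' E4' d3 d4 K1.
have := powR_ge0 e1 b; have := powR_ge0 e2 b; have := powR_ge0 e3 b.
have := powR_ge0 e4 b; have := powR_ge0 x1 (- M); have := powR_ge0 x2 (- M).
have := powR_ge0 x3 (- M); have := powR_ge0 x4 (- M).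
have := powR_ge0 x1 b; have := powR_ge0 x2 b.
have := powR_ge0 x3 b; have := powR_ge0 x4 b.
(* Only products of powers remain: p = e^b, q = x^b, w = x^-M, with q1 and q2 at least 1. Each
   monomial is compared with K * Z. *)
move: (e1 `^ b) (e2 `^ b) (e3 `^ b) (e4 `^ b) => p1 p2 p3 p4.
move: (x1 `^ b) (x2 `^ b) (x3 `^ b) (x4 `^ b) => q1 q2 q3 q4.
move: (x1 `^ - M) (x2 `^ - M) (x3 `^ - M) (x4 `^ - M) => w1 w2 w3 w4.
move: (2 `^ (M - b)) => K.
move=> q40 q30 q20 q10 w40 w30 w20 w10 p40 p30 p20 p10.
move=> q11 q21 t1 t2 E1 E2 E3 E4 E3' E4' d3 d4 K1.
set Z := q1 * q1 * w1 * (q2 * (q2 * w2)) * S.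
have K0 : 0 <= K by exact: le_trans K1.
have Z0 : 0 <= Z by rewrite /Z !mulr_ge0.
have ZK : Z <= K * Z by rewrite ler_peMl.
(* By [t1] the outgoing pair costs K q1 w1 S; the spare factor q2 is at least 1. *)
have T1 : p1 * (p2 * p3 * p4) * (w2 * w3 * w4) <= K * Z.
  have -> : p1 * (p2 * p3 * p4) * (w2 * w3 * w4) =
    1 * (p1 * p2 * w2 * (p3 * w3 * (p4 * w4))) by ring.
  have -> : K * Z = q2 * (q1 * q2 * w2 * (K * (q1 * w1) * S)) by rewrite /Z; ring.
  apply: ler_pM => //; rewrite ?mulr_ge0//.
  apply: ler_pM => //; rewrite ?mulr_ge0//; first by repeat (apply: ler_pM; rewrite ?mulr_ge0//).
  by apply: le_trans t1; repeat (apply: ler_pM; rewrite ?mulr_ge0//).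
have T2 : p1 * (p2 * p3 * p4) * (w1 * w3 * w4) <= K * Z.
  have -> : p1 * (p2 * p3 * p4) * (w1 * w3 * w4) =
    1 * (p1 * p2 * w1 * (p3 * w3 * (p4 * w4))) by ring.
  have -> : K * Z = q1 * (q1 * q2 * w1 * (K * (q2 * w2) * S)) by rewrite /Z; ring.
  apply: ler_pM => //; rewrite ?mulr_ge0//.
  apply: ler_pM => //; rewrite ?mulr_ge0//; first by repeat (apply: ler_pM; rewrite ?mulr_ge0//).
  by apply: le_trans t2; repeat (apply: ler_pM; rewrite ?mulr_ge0//).
have T3 : p1 * (p2 * p3 * p4) * (w1 * w2 * w4) <= K * Z.
  apply: le_trans ZK.
  have -> : p1 * (p2 * p3 * p4) * (w1 * w2 * w4) =
    p1 * p2 * p3 * (w1 * w2) * (p4 * w4) by ring.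
  have -> : Z = q1 * q2 * (q1 * q2) * (w1 * w2) * S by rewrite /Z; ring.
  apply: ler_pM; rewrite ?mulr_ge0//; first by repeat (apply: ler_pM; rewrite ?mulr_ge0//).
  apply: (@le_trans _ _ (x4 ^- 4)); last by rewrite lerDr.
  by apply: le_trans d4; repeat (apply: ler_pM; rewrite ?mulr_ge0//).
have T4 : p1 * (p2 * p3 * p4) * (w1 * w2 * w3) <= K * Z.
  apply: le_trans ZK.
  have -> : p1 * (p2 * p3 * p4) * (w1 * w2 * w3) =
    p1 * p2 * p4 * (w1 * w2) * (p3 * w3) by ring.
  have -> : Z = q1 * q2 * (q1 * q2) * (w1 * w2) * S by rewrite /Z; ring.
  apply: ler_pM; rewrite ?mulr_ge0//; first by repeat (apply: ler_pM; rewrite ?mulr_ge0//).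
  apply: (@le_trans _ _ (x3 ^- 4)); last by rewrite lerDl.
  by apply: le_trans d3; repeat (apply: ler_pM; rewrite ?mulr_ge0//).
have -> : 4 * K * (q1 * q1 * w1) * (q2 * (q2 * w2)) * S = 4 * (K * Z) by rewrite /Z; ring.
rewrite !mulrDr; lra.
Qed.
End Weight.

(** * Averages over the sphere *)

Section CircleSphere.
Context {R : realType}.
Notation mu := (@lebesgue_measure R).

Lemma measurable_funV d (T : measurableType d) (f : T -> R) :
  (forall x, 0 <= f x) -> measurable_fun setT f ->
  measurable_fun setT (fun x => (f x)^-1).
Proof.
move=> f0 mf; under eq_fun do rewrite -powR_inv1//.
exact: (measurableT_comp (measurable_powR (-1)) mf).
Qed.

Lemma measurable_sin : measurable_fun setT (@sin R).
Proof. by apply: continuous_measurable_fun; exact: continuous_sin. Qed.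

Lemma measurable_cos : measurable_fun setT (@cos R).
Proof. by apply: continuous_measurable_fun; exact: continuous_cos. Qed.

Lemma integral_is_derive (F f : R -> R) (a b : R) : a < b ->
  (forall x : R, is_derive x 1 F (f x)) -> continuous f ->
  (\int[mu]_(x in `[a, b]) (f x)%:E = (F b - F a)%:E)%E.
Proof.
move=> ab dF cf.
have cF : continuous F.
  by move=> x; apply/differentiable_continuous/derivable1_diffP; exact: ex_derive.
rewrite (@continuous_FTC2 _ _ F) ?EFinB//.
- exact: continuous_subspaceT.
- split; first by move=> x _; exact: ex_derive.
  + by apply: cvg_at_right_filter; exact: cF.
  + by apply: cvg_at_left_filter; exact: cF.
- by move=> x _; rewrite derive1E derive_val.
Qed.

(** The integrand is the derivative of s^-1 atan (c + s g), whose values lie in an interval of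
    length pi / s. *)
Lemma integral_arctan_le (g g' : R -> R) (c s a b : R) : 0 < s -> a < b ->
  (forall x : R, is_derive x 1 g (g' x)) -> continuous g' ->
  (\int[mu]_(x in `[a, b]) (g' x / (1 + (c + s * g x) ^+ 2))%:E
   <= (pi / s)%:E)%E.
Proof.
move=> s0 ab dg cg'.
have cg : continuous g.
  by move=> x; apply/differentiable_continuous/derivable1_diffP; exact: ex_derive.
have pos x : 0 < 1 + (c + s * g x) ^+ 2 by rewrite ltr_pwDl// sqr_ge0.
pose F x := s^-1 * atan (c + s * g x).
have dF (x : R) : is_derive x 1 F (g' x / (1 + (c + s * g x) ^+ 2)).
  have di : is_derive x 1 (cst c + s *: g)%R (s * g' x).
    by rewrite -[_ * _]add0r; exact: is_deriveD (is_derive_cst c x 1) (is_deriveZ s (dg x)).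
  have da : is_derive x 1 (atan \o (cst c + s *: g))
      ((1 + (c + s * g x) ^+ 2)^-1 * (s * g' x)).
    exact: is_derive1_comp.
  have dF : is_derive x 1 (s^-1 *: (atan \o (cst c + s *: g)))
      (s^-1 *: ((1 + (c + s * g x) ^+ 2)^-1 * (s * g' x))).
    exact: is_deriveZ.
  apply: is_derive_eq dF _.
  by rewrite /GRing.scale/=; field; rewrite (gt_eqF s0) (gt_eqF (pos x)).
rewrite (integral_is_derive ab dF).
  rewrite lee_fin /F -mulrBr mulrC ler_pM2r ?invr_gt0//.
  have := atan_ltpi2 (c + s * g b); have := atan_gtNpi2 (c + s * g a).
  lra.
move=> x; apply: cvgM; first exact: cg'.
apply: cvgV; first by rewrite gt_eqF.
apply: cvgD; first exact: cvg_cst.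
apply: (@continuous_comp _ _ _ (fun x => c + s * g x) (fun y => y ^+ 2)).
 by apply: cvgD; [exact: cvg_cst|apply: cvgM; [exact: cvg_cst|exact: cg]].
exact: exprn_continuous.
Qed.

Lemma ge0_integral_itv_cat (f : R -> \bar R) (a b c : R) : a <= b -> b <= c ->
  measurable_fun [set: R] f -> (forall x, 0 <= f x)%E ->
  (\int[mu]_(x in `[a, c]) f x =
   \int[mu]_(x in `[a, b]) f x + \int[mu]_(x in `[b, c]) f x)%E.
Proof.
move=> ab bc mf f0.
have -> : `[a, c]%classic = (`[a, b] `|` `]b, c])%classic.
  by rewrite -itv_bndbnd_setU ?bnd_simp.
rewrite ge0_integral_setU//=.
- by rewrite integral_itv_obnd_cbnd//; exact: measurable_funTS.
- exact: measurable_funTS.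
- rewrite disj_set2E; apply/eqP/seteqP; split => x//=.
  by rewrite !in_itv/= => -[/andP[_ xb] /andP[+ _]]; rewrite ltNge xb.
Qed.

(** Where [g'] is nonpositive the bound is applied to -g and -c, which leaves the denominator
    unchanged. *)
Lemma integral_arctan_norm_le (g g' : R -> R) (c s a b : R) : 0 < s -> a < b ->
  (forall x : R, is_derive x 1 g (g' x)) -> continuous g' ->
  (forall x, x \in `[a, b] -> 0 <= g' x) \/
  (forall x, x \in `[a, b] -> g' x <= 0) ->
  (\int[mu]_(x in `[a, b]) (`|g' x| / (1 + (c + s * g x) ^+ 2))%:E
   <= (pi / s)%:E)%E.
Proof.
move=> s0 ab dg cg' [sg|sg].
  apply: le_trans (integral_arctan_le c s0 ab dg cg').
  rewrite le_eqVlt; apply/orP; left; apply/eqP/eq_integral => x.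
  by rewrite inE => /sg g0; rewrite ger0_norm.
have dN (x : R) : is_derive x 1 (- g) (- g' x) by apply: is_deriveN.
have cN : continuous (fun x => - g' x) by move=> x; apply: cvgN; exact: cg'.
apply: le_trans (integral_arctan_le (- c) s0 ab dN cN).
rewrite le_eqVlt; apply/orP; left; apply/eqP/eq_integral => x.
rewrite inE => /sg g0; rewrite ler0_norm//.
by rewrite fctE mulrN -opprD sqrrN.
Qed.

Lemma sin_le0_pi_2pi (x : R) : pi <= x <= 2 * pi -> sin x <= 0.
Proof.
move=> /andP[x1 x2]; rewrite -(subrK pi x) sinDpi oppr_le0 sin_ge0_pi//; lra.
Qed.

Lemma cos_le0_pihalf (x : R) : pi / 2 <= x <= 3 * pi / 2 -> cos x <= 0.
Proof.
move=> /andP[x1 x2]; rewrite -(subrK pi x) cosDpi oppr_le0 cos_ge0_pihalf//; lra.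
Qed.

Lemma cos_ge0_3pihalf (x : R) : 3 * pi / 2 <= x <= 2 * pi -> 0 <= cos x.
Proof.
move=> /andP[x1 x2]; rewrite -(subrK (pi *+ 2) x) cosD2pi cos_ge0_pihalf//; lra.
Qed.

Lemma le1_norm_sin_cos (x : R) : 1 <= `|sin x| + `|cos x|.
Proof.
have := cos2Dsin2 x; rewrite -(real_normK (num_real (cos x))).
rewrite -(real_normK (num_real (sin x))).
have := normr_ge0 (sin x); have := normr_ge0 (cos x); nra.
Qed.

(* On the circle [1 <= |sin| + |cos|], and each of the two resulting integrands
   is, up to sign, the derivative of an arctangent. *)
Lemma circle_integral_le (c1 c2 s : R) : 0 < s ->
  (\int[mu]_(x in `[0%R, (2 * pi)%R])
     (1 + ((c1 + s * cos x) ^+ 2 + (c2 + s * sin x) ^+ 2))^-1%:E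
   <= (5 * pi / s)%:E)%E.
Proof.
move=> s0; have pi0 := pi_gt0 R.
pose h1 (x : R) := `|- sin x| / (1 + (c1 + s * cos x) ^+ 2).
pose h2 (x : R) := `|cos x| / (1 + (c2 + s * sin x) ^+ 2).
have pos (y : R) : 0 < 1 + y ^+ 2 by rewrite ltr_pwDl// sqr_ge0.
have h10 x : 0 <= h1 x by rewrite divr_ge0// ltW.
have h20 x : 0 <= h2 x by rewrite divr_ge0// ltW.
have msin := measurable_sin; have mcos := measurable_cos.
have mq (c : R) (g : R -> R) : measurable_fun setT g ->
    measurable_fun setT (fun x => (c + s * g x) ^+ 2).
  move=> mg; apply: measurable_funX; apply: measurable_funD => //.
  exact: measurable_funM.
have mh1 : measurable_fun setT (EFin \o h1).
  apply/measurable_EFinP; apply: measurable_funM.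
    by apply: measurableT_comp => //; exact: measurableT_comp.
  apply: measurable_funV => [x|]; first exact: ltW.
  by apply: measurable_funD => //; exact: mq.
have mh2 : measurable_fun setT (EFin \o h2).
  apply/measurable_EFinP; apply: measurable_funM.
    exact: measurableT_comp.
  apply: measurable_funV => [x|]; first exact: ltW.
  by apply: measurable_funD => //; exact: mq.
(* [sin] keeps its sign on 2 pieces of the period and [cos] on 3, each piece costing pi / s: hence
   the constant 5. *)
have I1 : (\int[mu]_(x in `[0%R, (2 * pi)%R]) (h1 x)%:E <= (2 * pi / s)%:E)%E.
  rewrite (@ge0_integral_itv_cat (EFin \o h1) _ pi)//; [|lra|lra].
  have -> : (2 * pi / s)%:E = ((pi / s)%:E + (pi / s)%:E)%E.
    by rewrite -EFinD; congr EFin; field; rewrite gt_eqF.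
  have cN : continuous (fun x : R => - sin x).
    by move=> x; apply: cvgN; exact: continuous_sin.
  apply: leeD; apply: integral_arctan_norm_le => //; try lra.
    by right => x; rewrite in_itv/= => xx; rewrite oppr_le0 sin_ge0_pi.
  by left => x; rewrite in_itv/= => xx; rewrite oppr_ge0 sin_le0_pi_2pi.
have I2 : (\int[mu]_(x in `[0%R, (2 * pi)%R]) (h2 x)%:E <= (3 * pi / s)%:E)%E.
  rewrite (@ge0_integral_itv_cat (EFin \o h2) _ (pi / 2))//; [|lra|lra].
  rewrite (@ge0_integral_itv_cat (EFin \o h2) (pi / 2) (3 * pi / 2))//; [|lra|lra].
  have -> : (3 * pi / s)%:E = ((pi / s)%:E + ((pi / s)%:E + (pi / s)%:E))%E.
    by rewrite -!EFinD; congr EFin; field; rewrite gt_eqF.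
  have cc := @continuous_cos R.
  apply: leeD; last apply: leeD; apply: integral_arctan_norm_le => //; try lra.
  - by left => x; rewrite in_itv/= => /andP[x1 x2]; rewrite cos_ge0_pihalf//; lra.
  - by right => x; rewrite in_itv/= => xx; rewrite cos_le0_pihalf.
  - by left => x; rewrite in_itv/= => xx; rewrite cos_ge0_3pihalf.
apply: (@le_trans _ _ (\int[mu]_(x in `[0%R, (2 * pi)%R]) ((h1 x)%:E + (h2 x)%:E)))%E; last first.
  rewrite ge0_integralD//=; last 4 first.
  - by move=> x _; rewrite lee_fin.
  - exact: measurable_funTS.
  - by move=> x _; rewrite lee_fin.
  - exact: measurable_funTS.
  apply: le_trans (leeD I1 I2) _.
  by rewrite -EFinD lee_fin le_eqVlt; apply/orP; left; apply/eqP; field; rewrite gt_eqF.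
apply: ge0_le_integral => //.
- by move=> x _; rewrite lee_fin invr_ge0 !addr_ge0// sqr_ge0.
- apply/measurable_EFinP/measurable_funTS; apply: measurable_funV => [x|].
    by rewrite !addr_ge0// sqr_ge0.
  by apply: measurable_funD => //; apply: measurable_funD; exact: mq.
- by apply: measurable_funTS; apply: emeasurable_funD.
move=> x _; rewrite -EFinD lee_fin /h1 /h2 normrN.
set A := c1 + _; set B := c2 + _.
have := le1_norm_sin_cos x.
have := normr_ge0 (sin x); have := normr_ge0 (cos x).
move: `|sin x| `|cos x| => u v v0 u0 uv.
have AB : 0 < 1 + (A ^+ 2 + B ^+ 2) by rewrite ltr_pwDl// addr_ge0// sqr_ge0.
apply: (@le_trans _ _ ((u + v) / (1 + (A ^+ 2 + B ^+ 2)))).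
  by rewrite -[leLHS]mul1r ler_pM2r ?invr_gt0.
rewrite mulrDl lerD// ler_wpM2l// lef_pV2 ?posrE//.
  by rewrite lerD2l lerDl sqr_ge0.
by rewrite lerD2l lerDr sqr_ge0.
Qed.

Lemma measurable_vec3 d (T : measurableType d) (f g h : T -> R) :
  measurable_fun setT f -> measurable_fun setT g -> measurable_fun setT h ->
  measurable_fun setT (fun x => (f x, g x, h x) : vec3 R).
Proof.
by move=> mf mg mh; apply: measurable_fun_pair => //; exact: measurable_fun_pair.
Qed.

Lemma measurable_coord d (T : measurableType d) (f : T -> vec3 R) :
  measurable_fun setT f ->
  [/\ measurable_fun setT (fun x => (f x).1.1),
     measurable_fun setT (fun x => (f x).1.2) &
     measurable_fun setT (fun x => (f x).2)].
Proof.
move=> mf; split.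
- exact: measurableT_comp measurable_fst (measurableT_comp measurable_fst mf).
- exact: measurableT_comp measurable_snd (measurableT_comp measurable_fst mf).
- exact: measurableT_comp measurable_snd mf.
Qed.

Lemma measurable_vec3D d (T : measurableType d) (f g : T -> vec3 R) :
  measurable_fun setT f -> measurable_fun setT g ->
  measurable_fun setT (fun x => f x + g x).
Proof.
move=> /measurable_coord[f1 f2 f3] /measurable_coord[g1 g2 g3].
by apply: measurable_vec3; exact: measurable_funD.
Qed.

Lemma measurable_vec3N d (T : measurableType d) (f : T -> vec3 R) :
  measurable_fun setT f -> measurable_fun setT (fun x => - f x).
Proof.
move=> /measurable_coord[f1 f2 f3].
by apply: measurable_vec3; exact: measurableT_comp.
Qed.

Lemma measurable_scale3 d (T : measurableType d) (a : T -> R) (f : T -> vec3 R) :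
  measurable_fun setT a -> measurable_fun setT f ->
  measurable_fun setT (fun x => scale3 (a x) (f x)).
Proof.
move=> ma /measurable_coord[f1 f2 f3].
by apply: measurable_vec3; exact: measurable_funM.
Qed.

Lemma measurable_enorm d (T : measurableType d) (f : T -> vec3 R) :
  measurable_fun setT f -> measurable_fun setT (fun x => enorm (f x)).
Proof.
move=> /measurable_coord[f1 f2 f3].
have ms : measurable_fun [set: R] (@Num.sqrt R).
  by apply: continuous_measurable_fun; exact: sqrt_continuous.
apply: (measurableT_comp ms); apply: measurable_funD; last exact: measurable_funX.
by apply: measurable_funD; exact: measurable_funX.
Qed.

Lemma measurable_bracket d (T : measurableType d) (f : T -> vec3 R) :
  measurable_fun setT f -> measurable_fun setT (fun x => bracket (f x)).
Proof.
move=> mf.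
have ms : measurable_fun [set: R] (@Num.sqrt R).
  by apply: continuous_measurable_fun; exact: sqrt_continuous.
apply: (measurableT_comp ms); apply: measurable_funD => //.
by apply: measurable_funX; exact: measurable_enorm.
Qed.

Lemma measurable_sphere_pt d (T : measurableType d) (a : T -> R * R) :
  measurable_fun setT a -> measurable_fun setT (fun x => sphere_pt (a x)).
Proof.
move=> ma.
have m1 := measurableT_comp (@measurable_fst _ _ R R) ma.
have m2 := measurableT_comp (@measurable_snd _ _ R R) ma.
have ms1 := measurableT_comp measurable_sin m1.
have ms2 := measurableT_comp measurable_sin m2.
have mc1 := measurableT_comp measurable_cos m1.
have mc2 := measurableT_comp measurable_cos m2.
by apply: measurable_vec3 => //; exact: measurable_funM.
Qed.

Section post.
Context d (T : measurableType d) (k l w : T -> vec3 R).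
Hypotheses (mk : measurable_fun setT k) (ml : measurable_fun setT l).
Hypothesis mw : measurable_fun setT w.

Let mr : measurable_fun setT (fun x => scale3 (enorm (k x - l x) / 2) (w x)).
Proof.
apply: measurable_scale3 => //; apply: measurable_funM => //.
by apply: measurable_enorm; apply: measurable_vec3D => //; exact: measurable_vec3N.
Qed.

Let mc : measurable_fun setT (fun x => scale3 2^-1 (k x + l x)).
Proof. by apply: measurable_scale3 => //; exact: measurable_vec3D. Qed.

Lemma measurable_post1 :
  measurable_fun setT (fun x => post1 (k x) (l x) (w x)).
Proof. exact: measurable_vec3D. Qed.

Lemma measurable_post2 :
  measurable_fun setT (fun x => post2 (k x) (l x) (w x)).
Proof. by apply: measurable_vec3D => //; exact: measurable_vec3N. Qed.

End post.

End CircleSphere.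

(** * Tonelli on rectangles and integrals depending on a parameter *)

Section FubiniSet.
Context {R : realType} {d1 d2 : measure_display}.
Context {T1 : measurableType d1} {T2 : measurableType d2}.
Variable (m1 : {sigma_finite_measure set T1 -> \bar R}).
Variable (m2 : {sigma_finite_measure set T2 -> \bar R}).

Lemma ge0_integral_setX (D1 : set T1) (D2 : set T2) (f : T1 * T2 -> \bar R) :
  measurable D1 -> measurable D2 -> measurable_fun setT f ->
  (forall z, 0 <= f z)%E ->
  (\int[m1 \x m2]_(z in D1 `*` D2) f z =
   \int[m1]_(x in D1) \int[m2]_(y in D2) f (x, y))%E.
Proof.
move=> mD1 mD2 mf f0.
rewrite integral_mkcond fubini_tonelli1; last 2 first.
- apply/(measurable_restrictT _ (measurableX mD1 mD2)).
  exact: measurable_funTS.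
- by move=> z; rewrite patchE; case: ifP.
rewrite [RHS]integral_mkcond; apply: eq_integral => x _ /=.
rewrite /fubini_F patchE; case: ifPn => [|] xD.
  rewrite [RHS]integral_mkcond; apply: eq_integral => y _ /=.
  by rewrite !patchE in_setX/= xD.
by apply: integral0_eq => y _; rewrite patchE in_setX/= (negbTE xD).
Qed.

Lemma measurable_integral_param (D2 : set T2) (f : T1 * T2 -> \bar R) :
  measurable D2 -> measurable_fun setT f -> (forall z, 0 <= f z)%E ->
  measurable_fun setT (fun x => \int[m2]_(y in D2) f (x, y))%E.
Proof.
move=> mD mf f0.
under eq_fun do rewrite integral_mkcond.
have -> : (fun x => \int[m2]_y ((fun y => f (x, y)) \_ D2) y)%E =
   fubini_F m2 (f \_ (setT `*` D2)).
  apply/funext => x; rewrite /fubini_F; apply: eq_integral => y _.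
  by rewrite !patchE in_setX/= in_setT.
apply: measurable_fun_fubini_tonelli_F.
  apply/(measurable_restrictT _ (measurableX measurableT mD)).
  exact: measurable_funTS.
by move=> z; rewrite patchE; case: ifP.
Qed.

(** Neither sign nor integrability is assumed: [Rintegral] is [fine] of a difference of two
    nonnegative integrals, each measurable in the parameter. Measurability of the operator in time
    and wave vector rests on this. *)
Lemma measurable_Rintegral_param (D2 : set T2) (f : T1 * T2 -> R) :
  measurable D2 -> measurable_fun setT f ->
  measurable_fun setT (fun x => \int[m2]_(y in D2) f (x, y)).
Proof.
move=> mD mf; rewrite /Rintegral.
have mEf : measurable_fun setT (EFin \o f) by exact/measurable_EFinP.
apply: measurableT_comp; first exact: fine_measurable.
under eq_fun do rewrite integralE.
apply: emeasurable_funB.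
  have -> : (fun x => \int[m2]_(y in D2) (fun y => (f (x, y))%:E)^\+ y)%E =
      (fun x => \int[m2]_(y in D2) (EFin \o f)^\+ (x, y))%E.
    by apply/funext => x; apply: eq_integral => y _; rewrite !funeposE.
  by apply: measurable_integral_param => //; exact: measurable_funepos.
have -> : (fun x => \int[m2]_(y in D2) (fun y => (f (x, y))%:E)^\- y)%E =
    (fun x => \int[m2]_(y in D2) (EFin \o f)^\- (x, y))%E.
  by apply/funext => x; apply: eq_integral => y _; rewrite !funenegE.
by apply: measurable_integral_param => //; exact: measurable_funeneg.
Qed.

End FubiniSet.

Section Sphere.
Context {R : realType}.
Notation mu := (@lebesgue_measure R).

Lemma measurable_sphere_dom : measurable (@sphere_dom R).
Proof. exact: measurableX. Qed.

Lemma ge0_integral_sphere_dom (f : R * R -> R) : measurable_fun setT f ->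
  (forall a, 0 <= f a) ->
  (\int[leb2]_(a in sphere_dom) (f a)%:E =
   \int[mu]_(x in `[0%R, pi]) \int[mu]_(y in `[0%R, (2 * pi)%R]) (f (x, y))%:E)%E.
Proof.
move=> mf f0.
apply: (@ge0_integral_setX _ _ _ _ _ mu mu _ _ (EFin \o f)) => //.
exact/measurable_EFinP.
Qed.

Let mb (c : vec3 R) (r : R) : measurable_fun setT
  (fun a : R * R => bracket (c + scale3 r (sphere_pt a)) ^- 4).
Proof.
apply: measurable_funV => [a|]; first by rewrite exprn_ge0 ?bracket_ge0.
apply: measurable_funX; apply: measurable_bracket; apply: measurable_vec3D => //.
by apply: measurable_scale3 => //; exact: measurable_sphere_pt.
Qed.

Let msin1 : measurable_fun setT (fun a : R * R => `|sin a.1|).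
Proof.
apply: measurableT_comp => //.
by apply: measurableT_comp => //; exact: measurable_sin.
Qed.

Let mcircle (c1 c2 s : R) : measurable_fun setT
  (fun y : R => (1 + ((c1 + s * cos y) ^+ 2 + (c2 + s * sin y) ^+ 2))^-1).
Proof.
have msin := @measurable_sin R; have mcos := @measurable_cos R.
apply: measurable_funV => [y|]; first by rewrite !addr_ge0// sqr_ge0.
apply: measurable_funD => //.
by apply: measurable_funD; apply: measurable_funX; apply: measurable_funD => //;
  exact: measurable_funM.
Qed.

(** The fourth power of the bracket is a product of two equal factors. In one, the horizontal
    distance is replaced by its lower bound |r sin th - rho|, constant in y; the other is integrated
    over a circle of radius r sin th. The sin th of the surface element cancels the one in 5 pi / (r
    sin th). *)
Lemma sphere_meridian_le (c : vec3 R) (r rho th : R) : 0 < r ->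
  0 <= rho -> rho ^+ 2 = c.1.1 ^+ 2 + c.1.2 ^+ 2 -> th \in `[0, pi] ->
  (\int[mu]_(y in `[0%R, (2 * pi)%R])
     (bracket (c + scale3 r (sphere_pt (th, y))) ^- 4 * `|sin th|)%:E <=
   (5 * pi / r *
    (1 + ((c.2 + r * cos th) ^+ 2 + (- rho + r * sin th) ^+ 2))^-1)%:E)%E.
Proof.
move=> r0 rho0 hrho thI.
have : 0 <= sin th by apply: sin_ge0_pi; move: thI; rewrite in_itv.
 rewrite le_eqVlt => /predU1P[s0|s0].
  rewrite [leLHS]integral0_eq; last by move=> y _; rewrite -s0 normr0 mulr0.
  rewrite lee_fin mulr_ge0//; first by rewrite divr_ge0 ?(ltW r0)// mulr_ge0 ?pi_ge0.
  by rewrite invr_ge0 !addr_ge0// sqr_ge0.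
set A := c.2 + _; set K := (1 + _)^-1.
have K0 : 0 <= K by rewrite invr_ge0 !addr_ge0// sqr_ge0.
pose s := r * sin th.
have s_gt0 : 0 < s by rewrite mulr_gt0.
apply: (@le_trans _ _ (\int[mu]_(y in `[0%R, (2 * pi)%R]) ((sin th * K)%:E *
    (1 + ((c.1.1 + s * cos y) ^+ 2 + (c.1.2 + s * sin y) ^+ 2))^-1%:E)))%E.
  apply: ge0_le_integral => //.
  - by move=> y _; rewrite lee_fin mulr_ge0// invr_ge0 exprn_ge0// bracket_ge0.
  - apply/measurable_EFinP/measurable_funTS; apply: measurable_funM => //.
    exact: (measurable_fun_pair2 th (mb c r)).
  - apply/measurable_EFinP/measurable_funTS; apply: measurable_funM => //.
    exact: mcircle.
  - move=> y _; rewrite -EFinM lee_fin (ger0_norm (ltW s0)) mulrC -mulrA.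
    rewrite ler_pM2l// (exprM _ 2 2) sqr_bracket /K -invfM.
    rewrite lef_pV2 ?posrE ?exprn_gt0 ?mulr_gt0 ?ltr_pwDl ?addr_ge0 ?sqr_ge0//.
    have := cos2Dsin2 y; rewrite /= /A !mulrA -/s.
    move: (cos y) (sin y) (c.2 + _) s_gt0 hrho => u v B; rewrite -/s.
    move: s c.1.1 c.1.2 => s p q s_gt0 hrho uv.
    (* Cauchy-Schwarz, through Lagrange's identity. *)
    have cs : - rho <= p * u + q * v.
      have h : (p * u + q * v) ^+ 2 <= rho ^+ 2.
        rewrite -[leRHS]mulr1 -uv hrho -subr_ge0.
        have -> : (p ^+ 2 + q ^+ 2) * (u ^+ 2 + v ^+ 2) - (p * u + q * v) ^+ 2 =
          (p * v - q * u) ^+ 2 by ring.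
        exact: sqr_ge0.
      nra.
    have E : (p + s * u) ^+ 2 + (q + s * v) ^+ 2 =
        rho ^+ 2 + 2 * s * (p * u + q * v) + s ^+ 2.
      transitivity (p ^+ 2 + q ^+ 2 + 2 * s * (p * u + q * v) +
        s ^+ 2 * (u ^+ 2 + v ^+ 2)); first by ring.
      by rewrite uv mulr1 hrho.
    have F : (- rho + s) ^+ 2 <= (p + s * u) ^+ 2 + (q + s * v) ^+ 2.
      rewrite E; nra.
    move: F (sqr_ge0 B) (sqr_ge0 (- rho + s)).
    move: (B ^+ 2) ((- rho + s) ^+ 2) => x1 x2.
    have -> : (p + s * u) ^+ 2 + (q + s * v) ^+ 2 + x1 = x1 + ((p + s * u) ^+ 2 + (q + s * v)
        ^+ 2) by rewrite addrC.
    move: ((p + s * u) ^+ 2 + (q + s * v) ^+ 2) => x3 h1 h2 h3.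
    nra.
rewrite ge0_integralZl//; last 3 first.
- by apply/measurable_EFinP/measurable_funTS; exact: mcircle.
- by move=> y _; rewrite lee_fin invr_ge0 !addr_ge0// sqr_ge0.
- by rewrite lee_fin mulr_ge0// ltW.
apply: (@le_trans _ _ ((sin th * K)%:E * (5 * pi / s)%:E)%E).
  apply: lee_wpmul2l; first by rewrite lee_fin mulr_ge0// ltW.
  exact: circle_integral_le.
rewrite -EFinM lee_fin le_eqVlt; apply/orP; left; apply/eqP.
by rewrite /s; field; rewrite !gt_eqF.
Qed.

(** After [sphere_meridian_le] the integrand in th is again that of [circle_integral_le], with
    centre (c.2, - rho) in the meridian plane; enlarging [0, pi] to [0, 2 pi] yields the second
    factor 5 pi / r. *)
Lemma sphere_integral_decay (c : vec3 R) (r : R) : 0 < r ->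
  (\int[leb2]_(a in sphere_dom)
     (bracket (c + scale3 r (sphere_pt a)) ^- 4 * `|sin a.1|)%:E <=
   ((5 * pi / r) ^+ 2)%:E)%E.
Proof.
move=> r0; have pi0 := pi_gt0 R.
have f0 (a : R * R) : 0 <= bracket (c + scale3 r (sphere_pt a)) ^- 4 * `|sin a.1|.
  by rewrite mulr_ge0// invr_ge0 exprn_ge0// bracket_ge0.
have mf : measurable_fun setT
    (fun a : R * R => bracket (c + scale3 r (sphere_pt a)) ^- 4 * `|sin a.1|).
  exact: measurable_funM.
rewrite ge0_integral_sphere_dom//.
pose rho := Num.sqrt (c.1.1 ^+ 2 + c.1.2 ^+ 2).
pose h th := (1 + ((c.2 + r * cos th) ^+ 2 + (- rho + r * sin th) ^+ 2))^-1.
have mh : measurable_fun setT (EFin \o h) by apply/measurable_EFinP; exact: mcircle.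
have h0 th : (0 <= (h th)%:E)%E.
  by rewrite lee_fin invr_ge0 !addr_ge0// sqr_ge0.
have C0 : 0 <= 5 * pi / r by rewrite divr_ge0 ?(ltW r0)// mulr_ge0 ?ltW.
apply: (@le_trans _ _ (\int[mu]_(th in `[0%R, pi]) ((5 * pi / r)%:E * (h th)%:E)))%E.
  apply: ge0_le_integral => //.
  - by move=> th _; apply: integral_ge0 => y _; rewrite lee_fin.
  - apply: measurable_funTS.
    have /measurable_EFinP mEf := mf.
    apply: (measurable_integral_param mu (measurable_itv _) mEf) => z.
    exact: f0.
  - apply: measurable_funTS; apply/measurable_EFinP.
    by apply: measurable_funM => //; exact: mcircle.
  - move=> th thI; rewrite -EFinM.
    apply: sphere_meridian_le => //; first exact: sqrtr_ge0.
    by rewrite sqr_sqrtr// addr_ge0// sqr_ge0.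
rewrite ge0_integralZl//; last exact: measurable_funTS.
rewrite (expr2 (5 * pi / r)) (EFinM (5 * pi / r) (5 * pi / r)); apply: lee_wpmul2l;
    first by rewrite lee_fin.
apply: le_trans (circle_integral_le c.2 (- rho) r0).
apply: ge0_subset_integral => //; first exact: measurable_funTS.
move=> x /=; rewrite !in_itv/= => /andP[-> /le_trans]; apply; lra.
Qed.

Lemma sphere_integral_bounded (c : vec3 R) (r : R) :
  (\int[leb2]_(a in sphere_dom)
     (bracket (c + scale3 r (sphere_pt a)) ^- 4 * `|sin a.1|)%:E <=
   (2 * pi ^+ 2)%:E)%E.
Proof.
have pi0 := pi_gt0 R.
apply: (@le_trans _ _ (\int[leb2]_(a in sphere_dom) (cst 1%E a))%E).
  apply: ge0_le_integral => //.
  - exact: measurable_sphere_dom.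
  - move=> a _; by rewrite lee_fin mulr_ge0// invr_ge0 exprn_ge0// bracket_ge0.
  - by apply/measurable_EFinP/measurable_funTS; exact: (measurable_funM (mb c r) msin1).
  - move=> a _; rewrite lee_fin mulr_ile1// ?invr_ge0 ?exprn_ge0 ?bracket_ge0//.
      by rewrite invf_le1 ?exprn_gt0 ?bracket_gt0// exprn_ege1// bracket_ge1.
    exact: sin_max.
rewrite integral_cst ?mul1e; last exact: measurable_sphere_dom.
rewrite [leLHS](_ : _ = (mu \x mu)%E (`[0%R, pi] `*` `[0%R, (2 * pi)%R]))//.
rewrite product_measure1E//.
have m0 (b : R) : 0 < b -> mu `[0%R, b]%classic = b%:E.
  by move=> b0; rewrite lebesgue_measure_itv/= lte_fin b0 -EFinD subr0.
apply: (@le_trans _ _ (pi%:E * (2 * pi)%:E)%E); last by rewrite -EFinM lee_fin; nra.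
by rewrite -(m0 pi)// -(m0 (2 * pi))// mulr_gt0.
Qed.

(** For r > 1, 1 + r^2 <= 2 r^2 turns 25 pi^2 / r^2 into this bound; for r <= 1 the integrand is at
    most 1 on a rectangle of area 2 pi^2. *)
Lemma sphere_integral_le (c : vec3 R) (r : R) : 0 <= r ->
  (\int[leb2]_(a in sphere_dom)
     (bracket (c + scale3 r (sphere_pt a)) ^- 4 * `|sin a.1|)%:E <=
   (50 * pi ^+ 2 / (1 + r ^+ 2))%:E)%E.
Proof.
move=> r0; have pi0 := pi_gt0 R; have [r1|r1] := leP r 1.
  apply: le_trans (sphere_integral_bounded c r) _; rewrite lee_fin.
  have h : 0 <= pi ^+ 2 * (1 - r ^+ 2).
    by rewrite mulr_ge0 ?sqr_ge0// subr_ge0 exprn_ile1.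
  by rewrite ler_pdivlMr ?ltr_pwDl ?sqr_ge0//; move: h (sqr_ge0 (@pi R)); lra.
have r0' : 0 < r by lra.
apply: le_trans (sphere_integral_decay c r0') _; rewrite lee_fin.
rewrite expr_div_n ler_pdivlMr ?ltr_pwDl ?sqr_ge0// mulrAC.
have h : 0 <= pi ^+ 2 * (r ^+ 2 - 1).
  by rewrite mulr_ge0 ?sqr_ge0// subr_ge0 exprn_ege1// ltW.
by rewrite ler_pdivrMr ?exprn_gt0//; move: h (sqr_ge0 (@pi R)); lra.
Qed.

Lemma post_integral_le (k l : vec3 R) :
  let B := (50 * pi ^+ 2 / (1 + (enorm (k - l) / 2) ^+ 2))%:E in
  (\int[leb2]_(a in sphere_dom)
     (bracket (post1 k l (sphere_pt a)) ^- 4 * `|sin a.1|)%:E <= B)%E /\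
  (\int[leb2]_(a in sphere_dom)
     (bracket (post2 k l (sphere_pt a)) ^- 4 * `|sin a.1|)%:E <= B)%E.
Proof.
have r0 : 0 <= enorm (k - l) / 2 by rewrite divr_ge0 ?enorm_ge0.
split; first exact: sphere_integral_le.
apply: le_trans (sphere_integral_le (- scale3 2^-1 (k + l)) r0).
rewrite le_eqVlt; apply/orP; left; apply/eqP/eq_integral => a _.
by rewrite -bracketN opprD opprK.
Qed.

End Sphere.

(** * Integrability of the majorant *)

Section Tail.
Context {R : realType}.
Notation mu := (@lebesgue_measure R).

Lemma cvgy_powRN (s : R) : 0 < s -> x `^ (- s) @[x --> +oo%R] --> (0 : R).
Proof.
move=> s0; apply/cvgr0Pnorm_lt => e e0; near=> x.
have x0 : 0 < x by near: x; exact: nbhs_pinfty_gt.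
have ex : (e^-1) `^ (s^-1) < x by near: x; exact: nbhs_pinfty_gt.
rewrite ger0_norm ?powR_ge0// powRN invf_plt ?posrE ?powR_gt0//.
have := @gt0_ltr_powR _ s s0 _ _ _ _ ex.
rewrite !nnegrE powR_ge0 (ltW x0) => /(_ isT isT).
by rewrite -powRrM mulVf ?gt_eqF// powRr1// invr_ge0 ltW.
Unshelve. all: by end_near. Qed.

Lemma integral_powR_half (s : R) : 0 < s ->
  (\int[mu]_(x in `[0%R, +oo[) ((1 + x) `^ (- s - 1))%:E = (s^-1)%:E)%E.
Proof.
move=> s0; pose F x : R := - s^-1 * (1 + x) `^ (- s).
have dF (x : R) : -1 < x -> is_derive x 1 F ((1 + x) `^ (- s - 1)).
  move=> x1; have x0 : 0 < 1 + x by lra.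
  have d1 : is_derive x 1 (cst 1 + id : R -> R) 1.
    by apply: is_derive_eq; rewrite add0r.
  have d2 : is_derive (1 + x) 1 (fun y : R => y `^ (- s)) (- s * (1 + x) `^ (- s - 1)).
    exact: is_derive1_powR.
  have d3 := @is_derive1_comp _ (fun y : R => y `^ (- s)) (cst 1 + id : R -> R) x _ _ d2 d1.
  have d4 := is_deriveZ (- s^-1) d3.
  apply: is_derive_eq d4 _.
  by rewrite /GRing.scale/= mulr1 mulrA mulrNN mulVf ?mul1r// gt_eqF.
have cF (f := fun x : R => (1 + x) `^ (- s - 1)) x : -1 < x -> {for x, continuous f}.
  move=> x1; have x0 : 0 < 1 + x by lra.
  apply: (@continuous_comp _ _ _ (fun x : R => 1 + x) (fun y : R => y `^ (- s - 1)));
      first by apply: cvgD; [exact: cvg_cst|exact: cvg_id].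
  apply/differentiable_continuous/derivable1_diffP.
  by apply: derivable_powR; rewrite in_itv/= andbT.
rewrite (@ge0_continuous_FTC2y _ _ F _ 0)//.
- by rewrite sub0e /F addr0 powR1 mulr1 EFinN oppeK.
- by move=> x _; exact: powR_ge0.
- apply/continuous_within_itvcyP; split.
    by move=> x; rewrite in_itv/= andbT => x0; apply: cF; lra.
  have c0 : -1 < 0 :> R by lra.
  by apply: cvg_at_right_filter; exact: (cF 0 c0).
- rewrite -(mulr0 (- s^-1)); apply: cvgM; first exact: cvg_cst.
  exact: (cvg_comp _ _ (cvg_addrl 1) (cvgy_powRN s0)).
- move=> x x0; apply: (@ex_derive _ _ _ _ _ _ _ (dF x _)); lra.
- have : {for 0, continuous F}.
    apply/differentiable_continuous/derivable1_diffP.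
    by apply: (@ex_derive _ _ _ _ _ _ _ (dF 0 _)); lra.
  by move=> cF0; apply: cvg_at_right_filter; exact: cF0.
- by move=> x; rewrite in_itv/= andbT => x0;
    rewrite derive1E (@derive_val _ _ _ _ _ _ _ (dF x _))//; lra.
Qed.

Let u (q x : R) : R := Num.sqrt (1 + x ^+ 2) `^ (- q).

Let u_ge0 q x : 0 <= u q x.
Proof. exact: powR_ge0. Qed.

Let mu_ q : measurable_fun setT (u q).
Proof.
have ms : measurable_fun [set: R] (@Num.sqrt R).
  by apply: continuous_measurable_fun; exact: sqrt_continuous.
apply: (measurableT_comp (measurable_powR (- q))).
by apply: (measurableT_comp ms); apply: measurable_funD => //; exact: measurable_funX.
Qed.

Lemma integral_japanese1_lty (q : R) : 1 < q ->
  (\int[mu]_x (Num.sqrt (1 + x ^+ 2) `^ (- q))%:E < +oo)%E.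
Proof.
move=> q1; have mE : measurable_fun setT (EFin \o u q) by exact/measurable_EFinP.
have half : (\int[mu]_(x in `[0%R, +oo[) (u q x)%:E < +oo)%E.
  apply: (@le_lt_trans _ _ (\int[mu]_(x in `[0%R, +oo[)
      ((2 `^ q)%:E * ((1 + x) `^ (- (q - 1) - 1))%:E))%E).
    apply: ge0_le_integral => //.
    - by move=> x _; rewrite lee_fin.
    - exact: measurable_funTS.
    - apply/measurable_EFinP/measurable_funTS; apply: measurable_funM => //.
      apply: (measurableT_comp (measurable_powR _)).
      exact: measurable_funD.
    - move=> x /=; rewrite in_itv/= andbT => x0; rewrite -EFinM lee_fin /u.
      have -> : - (q - 1) - 1 = - q by ring.
      rewrite !powRN; set t := Num.sqrt _.
      have t0 : 0 < t by rewrite sqrtr_gt0 ltr_pwDl// sqr_ge0.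
      have x1 : 0 < 1 + x by lra.
      rewrite ler_pdivlMr ?powR_gt0// mulrC ler_pdivrMr ?powR_gt0//.
      rewrite -powRM ?ler0n ?(ltW t0)//.
      rewrite ge0_ler_powR ?nnegrE ?mulr_ge0 ?(ltW t0) ?(ltW x1)//; first lra.
      rewrite -(@ler_pXn2r _ 2) ?nnegrE ?mulr_ge0 ?(ltW t0) ?(ltW x1)//.
      rewrite exprMn sqr_sqrtr ?addr_ge0 ?sqr_ge0//.
      by have := sqr_ge0 (x - 1); nra.
  rewrite ge0_integralZl//=.
  - rewrite integral_powR_half; last lra.
    by rewrite -EFinM ltry.
  - apply/measurable_EFinP/measurable_funTS.
    apply: (measurableT_comp (measurable_powR _)).
    exact: measurable_funD.
  - by move=> x _; rewrite lee_fin powR_ge0.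
rewrite [ltLHS](_ : _ = \int[mu]_x (u q x)%:E)%E//.
have -> : [set: R] = (`]-oo, 0%R] `|` `]0%R, +oo[)%classic.
  apply/esym/seteqP; split => x//= _; rewrite !in_itv/= andbT.
  by case: (leP x 0); [left|right].
rewrite ge0_integral_setU//=; last 3 first.
- exact: measurable_funTS.
- by move=> x _; rewrite lee_fin.
- rewrite disj_set2E; apply/eqP/seteqP; split => x//=.
  by rewrite !in_itv/= andbT => -[x0]; rewrite ltNge x0.
apply: lte_add_pinfty; last first.
  rewrite integral_itv_obnd_cbnd//; exact: measurable_funTS.
have u0 x : (0 <= (EFin \o u q) x)%E by rewrite lee_fin.
have hN := ge0_integration_by_substitution0 mE u0.
suff <- : (\int[mu]_(x in `[0%R, +oo[) (u q x)%:E =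
    \int[mu]_(x in `]-oo, 0%R]) (u q x)%:E)%E by exact: half.
rewrite [LHS]hN; apply: eq_integral => x _.
by rewrite /= /u sqrrN.
Qed.

(** Each one-dimensional bracket is at most the full one, so <k>^-p is dominated by a product of
    three one-dimensional factors with exponent p / 3 > 1. *)
Lemma integral_japanese3_lty (p : R) : 3 < p ->
  (\int[leb3]_k (bracket k `^ (- p))%:E < +oo)%E.
Proof.
move=> p3; pose q := p / 3; have q1 : 1 < q by rewrite ltr_pdivlMr//; lra.
have mE : measurable_fun setT (EFin \o u q) by exact/measurable_EFinP.
pose I := (\int[mu]_x (u q x)%:E)%E.
have I0 : (0 <= I)%E by apply: integral_ge0 => x _; rewrite lee_fin.
have Ioo : (I < +oo)%E by exact: integral_japanese1_lty.
have m3 : measurable_fun [set: vec3 R] (fun k : vec3 R => u q k.1.1 * u q k.1.2 * u q k.2).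
  have [m1 m2 m3] := measurable_coord (@measurable_id _ (vec3 R) setT).
  apply: measurable_funM; last exact: (measurableT_comp (mu_ q) m3).
  apply: measurable_funM; first exact: (measurableT_comp (mu_ q) m1).
  exact: (measurableT_comp (mu_ q) m2).
have mbr : measurable_fun [set: vec3 R] (fun k : vec3 R => bracket k `^ (- p)).
  by apply: (measurableT_comp (measurable_powR _)); exact: measurable_bracket.
apply: (@le_lt_trans _ _ (\int[leb3]_k (u q k.1.1 * u q k.1.2 * u q k.2)%:E)%E).
  apply: ge0_le_integral => //.
  - by move=> k _; rewrite lee_fin powR_ge0.
  - exact/measurable_EFinP.
  - exact/measurable_EFinP.
  - move=> k _; rewrite lee_fin.
    have -> : - p = - q + - q + - q by rewrite /q; field.
    rewrite !powRD ?(gt_eqF (bracket_gt0 k)) ?implybT//.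
    have le (x : R) : x ^+ 2 <= k.1.1 ^+ 2 + k.1.2 ^+ 2 + k.2 ^+ 2 ->
        bracket k `^ (- q) <= u q x.
      move=> xk; rewrite /u !powRN lef_pV2 ?posrE ?powR_gt0 ?bracket_gt0//; last first.
        by rewrite sqrtr_gt0 ltr_pwDl// sqr_ge0.
      rewrite ge0_ler_powR ?nnegrE ?sqrtr_ge0 ?bracket_ge0//; first lra.
      by rewrite /bracket sqr_enorm ler_wsqrtr// lerD2l.
    have s0 (x : R) := sqr_ge0 x.
    rewrite !ler_pM ?mulr_ge0 ?powR_ge0// le//.
    + by rewrite -addrA lerDl addr_ge0.
    + by rewrite addrAC lerDr addr_ge0.
    + by rewrite lerDr addr_ge0.
have F1 : (\int[leb3]_k (u q k.1.1 * u q k.1.2 * u q k.2)%:E =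
    \int[leb2]_a \int[mu]_z (u q a.1 * u q a.2 * u q z)%:E)%E.
  have := @fubini_tonelli1 _ _ _ _ R leb2 mu
    (fun k : vec3 R => (u q k.1.1 * u q k.1.2 * u q k.2)%:E).
  apply; first exact/measurable_EFinP.
  by move=> k; rewrite lee_fin !mulr_ge0.
have m2 : measurable_fun setT (fun a : R * R => u q a.1 * u q a.2).
  apply: measurable_funM.
    exact: (measurableT_comp (mu_ q) (@measurable_fst _ _ R R)).
  exact: (measurableT_comp (mu_ q) (@measurable_snd _ _ R R)).
have F2 : (\int[leb2]_a (u q a.1 * u q a.2)%:E =
    \int[mu]_x \int[mu]_y (u q x * u q y)%:E)%E.
  have := @fubini_tonelli1 _ _ _ _ R mu mu
    (fun a : R * R => (u q a.1 * u q a.2)%:E).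
  apply; first exact/measurable_EFinP.
  by move=> k; rewrite lee_fin !mulr_ge0.
have Zl (c : R) : 0 <= c -> (\int[mu]_z (c * u q z)%:E = c%:E * I)%E.
  move=> c0; rewrite /I -ge0_integralZl//.
  by move=> x _; rewrite lee_fin.
have Zr (c : \bar R) : (0 <= c)%E -> (\int[mu]_x ((u q x)%:E * c) = I * c)%E.
  move=> c0; rewrite /I -ge0_integralZr//.
  by move=> x _; rewrite lee_fin.
rewrite F1; under eq_integral do rewrite Zl ?mulr_ge0//.
rewrite ge0_integralZr//; last 2 first.
- exact/measurable_EFinP.
- by move=> a _; rewrite lee_fin mulr_ge0.
rewrite F2; under eq_integral do rewrite Zl//.
rewrite Zr//.
by rewrite -(fineK (_ : I \is a fin_num)) -?EFinM ?ltry ?ge0_fin_numE.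
Qed.

End Tail.

Section Majorant.
Context {R : realType}.
Notation mu := (@lebesgue_measure R).
Notation resonance := (vec3 R * (R * R))%type.
Notation lebY := (@leb3 R \x @leb2 R)%E.
Implicit Types (k l : vec3 R) (x : resonance).

Definition resonant_dom : set resonance := setT `*` @sphere_dom R.

Lemma measurable_resonant_dom : measurable resonant_dom.
Proof. by apply: measurableX => //; exact: measurable_sphere_dom. Qed.

Definition out1 k x := post1 k x.1 (sphere_pt x.2).
Definition out2 k x := post2 k x.1 (sphere_pt x.2).

Lemma measurable_out d (T : measurableType d) (k : T -> vec3 R)
    (x : T -> resonance) :
  measurable_fun setT k -> measurable_fun setT x ->
  measurable_fun setT (fun t => out1 (k t) (x t)) /\
  measurable_fun setT (fun t => out2 (k t) (x t)).
Proof.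
move=> mk mx; have m1 := measurableT_comp (@measurable_fst _ _ (vec3 R) (R * R)%type) mx.
have m2 := measurableT_comp (@measurable_snd _ _ (vec3 R) (R * R)%type) mx.
have ms := measurable_sphere_pt m2.
by split; [exact: measurable_post1|exact: measurable_post2].
Qed.

(** The part of the bound in [cubic_weight_le], for b = 2 beta, that varies with the integration
    variable, times the collision factor |k - l| and the surface element. The absolute value keeps
    it nonnegative off [resonant_dom]. *)
Definition majorant (beta M : R) k x : R :=
  bracket x.1 `^ (2 * (2 * beta) - M) * enorm (k - x.1) *
  ((bracket (out1 k x) ^- 4 + bracket (out2 k x) ^- 4) * `|sin x.2.1|).

Lemma majorant_ge0 beta M k x : 0 <= majorant beta M k x.
Proof.
by rewrite !mulr_ge0 ?powR_ge0 ?enorm_ge0// addr_ge0// invr_ge0 exprn_ge0//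
  bracket_ge0.
Qed.

Let msin d (T : measurableType d) (a : T -> R * R) : measurable_fun setT a ->
  measurable_fun setT (fun t => `|sin (a t).1|).
Proof.
move=> ma; apply: measurableT_comp => //; apply: measurableT_comp.
  exact: measurable_sin.
exact: (measurableT_comp (@measurable_fst _ _ R R) ma).
Qed.

Let mout k : measurable_fun setT (fun x =>
  (bracket (out1 k x) ^- 4 + bracket (out2 k x) ^- 4) * `|sin x.2.1|).
Proof.
have [m1 m2] := measurable_out (measurable_cst k) (@measurable_id _ resonance setT).
apply: measurable_funM; last first.
  exact: (msin (@measurable_snd _ _ (vec3 R) (R * R)%type)).
apply: measurable_funD; apply: measurable_funV => [x|].
- by rewrite exprn_ge0 ?bracket_ge0.
- by apply: measurable_funX; exact: measurable_bracket.
- by rewrite exprn_ge0 ?bracket_ge0.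
- by apply: measurable_funX; exact: measurable_bracket.
Qed.

Let mbr (r : R) : measurable_fun [set: vec3 R] (fun l => bracket l `^ r).
Proof.
by apply: (measurableT_comp (measurable_powR _)); exact: measurable_bracket.
Qed.

Let mrel k : measurable_fun [set: vec3 R] (fun l => enorm (k - l)).
Proof.
apply: measurable_enorm; apply: measurable_vec3D => //; exact: measurable_vec3N.
Qed.

Lemma measurable_majorant beta M k : measurable_fun setT (majorant beta M k).
Proof.
apply: measurable_funM; last exact: mout.
apply: measurable_funM.
  exact: (measurableT_comp (mbr _) (@measurable_fst _ _ (vec3 R) (R * R)%type)).
exact: (measurableT_comp (mrel k) (@measurable_fst _ _ (vec3 R) (R * R)%type)).
Qed.

Let mV k : measurable_fun [set: vec3 R] (fun l => (bracket (k - l))^-1).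
Proof.
apply: measurable_funV => [l|]; first exact: bracket_ge0.
apply: measurable_bracket; apply: measurable_vec3D => //; exact: measurable_vec3N.
Qed.

(** The angular integral is O(<k - l>^-2), and one of these powers absorbs |k - l|. The constant is
    2 * 50 * 4, the 4 coming from e / (1 + e^2 / 4) <= 4 / <k - l>. *)
Lemma integral_majorant_le beta M k :
  (\int[lebY]_(x in resonant_dom) (majorant beta M k x)%:E <=
   (400 * pi ^+ 2)%:E *
   \int[leb3]_l (bracket l `^ (2 * (2 * beta) - M) * (bracket (k - l))^-1)%:E)%E.
Proof.
have mE : measurable_fun setT (EFin \o majorant beta M k).
  by apply/measurable_EFinP; exact: measurable_majorant.
rewrite [leLHS](_ : _ = \int[leb3]_(l in setT) \int[leb2]_(a in sphere_dom)
    (majorant beta M k (l, a))%:E)%E; last first.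
  apply: (@ge0_integral_setX _ _ _ _ _ leb3 leb2 _ _ (EFin \o majorant beta M k)) => //.
  - exact: measurable_sphere_dom.
  - by move=> x; rewrite lee_fin majorant_ge0.
have K0 : (0 <= (400 * pi ^+ 2)%:E :> \bar R)%E by rewrite lee_fin mulr_ge0 ?ler0n ?sqr_ge0.
rewrite -ge0_integralZl//; last 2 first.
- by apply/measurable_EFinP; exact: (measurable_funM (mbr _) (mV k)).
- by move=> l _; rewrite lee_fin mulr_ge0 ?powR_ge0// invr_ge0 bracket_ge0.
apply: ge0_le_integral => //.
- by move=> l _; apply: integral_ge0 => a _; rewrite lee_fin majorant_ge0.
- apply: (measurable_integral_param leb2 measurable_sphere_dom mE) => x.
  by rewrite /= lee_fin majorant_ge0.
- apply/measurable_EFinP; apply: measurable_funM => //.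
  exact: (measurable_funM (mbr _) (mV k)).
move=> l _; rewrite /majorant/=.
have c0 : 0 <= bracket l `^ (2 * (2 * beta) - M) * enorm (k - l).
  by rewrite mulr_ge0 ?powR_ge0 ?enorm_ge0.
under eq_integral do rewrite EFinM.
have mid := @measurable_id _ (R * R)%type setT.
have ms := measurable_sphere_pt mid.
have mi (f : R * R -> vec3 R) : measurable_fun setT f ->
    measurable_fun setT (fun a : R * R => (bracket (f a) ^- 4)).
  move=> mf; apply: measurable_funV => [a|]; first by rewrite exprn_ge0 ?bracket_ge0.
  by apply: measurable_funX; exact: measurable_bracket.
have i1 := mi _ (measurable_post1 (measurable_cst k) (measurable_cst l) ms).
have i2 := mi _ (measurable_post2 (measurable_cst k) (measurable_cst l) ms).
have mp1 : measurable_fun setT (fun a : R * R => bracket (post1 k l (sphere_pt a))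
    ^- 4 * `|sin a.1|).
  exact: (measurable_funM i1 (msin mid)).
have mp2 : measurable_fun setT (fun a : R * R => bracket (post2 k l (sphere_pt a))
    ^- 4 * `|sin a.1|).
  exact: (measurable_funM i2 (msin mid)).
have p0 (m : vec3 R) (t : R) : (0 <= (bracket m ^- 4 * `|t|)%:E)%E.
  by rewrite lee_fin mulr_ge0// invr_ge0 exprn_ge0// bracket_ge0.
rewrite ge0_integralZl//; last 3 first.
- exact: measurable_sphere_dom.
- apply/measurable_EFinP/measurable_funTS.
  exact: (measurable_funM (measurable_funD i1 i2) (msin mid)).
- by move=> a _; rewrite mulrDl EFinD adde_ge0//; exact: p0.
under eq_integral do rewrite mulrDl EFinD.
rewrite ge0_integralD//; last 3 first.
- exact: measurable_sphere_dom.
- by apply/measurable_EFinP/measurable_funTS; exact: mp1.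
- by apply/measurable_EFinP/measurable_funTS; exact: mp2.
have [B1 B2] := post_integral_le k l.
apply: le_trans (lee_wpmul2l _ (leeD B1 B2)) _; first by rewrite lee_fin.
rewrite -EFinD -!EFinM lee_fin.
have := sqr_bracket (k - l); rewrite -sqr_enorm.
have := enorm_ge0 (k - l); have := bracket_gt0 (k - l).
have := powR_ge0 (bracket l) (2 * (2 * beta) - M).
move: (enorm _) (bracket (k - l)) (_ `^ _) => e V b b0 V0 e0 hV.
have := sqr_ge0 (@pi R); move: (pi ^+ 2) => P P0.
have e1 : 0 < 1 + (e / 2) ^+ 2 by rewrite ltr_pwDl// sqr_ge0.
have -> : b * e * (50 * P / (1 + (e / 2) ^+ 2) + 50 * P / (1 + (e / 2) ^+ 2)) =
    100 * P * b * (e / (1 + (e / 2) ^+ 2)).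
  by move: (1 + (e / 2) ^+ 2) e1 => y y0; field; rewrite gt_eqF.
have -> : 400 * P * (b / V) = 100 * P * b * (4 / V) by field; rewrite gt_eqF.
apply: ler_wpM2l; first by rewrite !mulr_ge0.
rewrite ler_pdivrMr// mulrAC ler_pdivlMr//.
have := sqr_ge0 (e - V); have : (e / 2) ^+ 2 = e ^+ 2 / 4 by field.
nra.
Qed.

(** Here 1 / <k - l> <= 2 <k> / <l>: the additional decay in l relaxes the condition to M - 4 beta >
    2, at the price of a bound that grows with k. Only finiteness at each k results. *)
Lemma integral_majorant_lty beta M k : 2 < M - 2 * (2 * beta) ->
  (\int[lebY]_(x in resonant_dom) (majorant beta M k x)%:E < +oo)%E.
Proof.
move=> qM; apply: le_lt_trans (integral_majorant_le beta M k) _.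
have K0 : (0 <= (400 * pi ^+ 2)%:E :> \bar R)%E by rewrite lee_fin mulr_ge0 ?ler0n ?sqr_ge0.
apply: lte_mul_pinfty => //.
set q := 2 * (2 * beta) - M; have p3 : 3 < - (q - 1) by rewrite /q; lra.
apply: (@le_lt_trans _ _ (\int[leb3]_l ((2 * bracket k)%:E * (bracket l `^ (q - 1))%:E)))%E.
  apply: ge0_le_integral => //.
  - by move=> l _; rewrite lee_fin mulr_ge0 ?powR_ge0// invr_ge0 bracket_ge0.
  - apply/measurable_EFinP; apply: (measurable_funM (mbr _) (mV _)).
  - by apply/measurable_EFinP; apply: (measurable_funM (measurable_cst _) (mbr _)).
  move=> l _; rewrite -EFinM lee_fin.
  have -> : bracket l `^ (q - 1) = bracket l `^ q / bracket l.
    by rewrite powRD ?powR_inv1 ?bracket_ge0// (gt_eqF (bracket_gt0 l)) implybT.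
  rewrite mulrCA; apply: ler_wpM2l; first exact: powR_ge0.
  have k0 := bracket_gt0 k; have l0 := bracket_gt0 l; have kl0 := bracket_gt0 (k - l).
  rewrite ler_pdivlMr// mulrC ler_pdivrMr//.
  have := bracketB_le l k; rewrite -(bracketN (l - k)) opprB; lra.
rewrite ge0_integralZl//; last 3 first.
- by apply/measurable_EFinP; exact: mbr.
- by move=> l _; rewrite lee_fin powR_ge0.
- by rewrite lee_fin mulr_ge0// bracket_ge0.
rewrite -(opprK (q - 1)).
apply: lte_mul_pinfty => //; first by rewrite lee_fin mulr_ge0// bracket_ge0.
exact: integral_japanese3_lty.
Qed.

(** Conversely 1 / <k - l> <= 2 <l> / <k> gains decay in k and costs one power of <l>, so that
    integrability in dimension three asks for M - 4 beta - 1 > 3. *)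
Lemma integral_majorant_decay beta M : 4 < M - 2 * (2 * beta) ->
  exists2 C : R, 0 <= C & forall k,
  (\int[lebY]_(x in resonant_dom) (majorant beta M k x)%:E <=
   (C / bracket k)%:E)%E.
Proof.
move=> qM; set q := 2 * (2 * beta) - M.
pose I := (\int[leb3]_l (bracket l `^ (- (- (q + 1))))%:E)%E.
have Ioo : (I < +oo)%E by apply: integral_japanese3_lty; rewrite /q; lra.
have I0 : (0 <= I)%E by apply: integral_ge0 => l _; rewrite lee_fin powR_ge0.
have If : I \is a fin_num by rewrite ge0_fin_numE.
exists (400 * pi ^+ 2 * (2 * fine I)).
  by apply: mulr_ge0; rewrite mulr_ge0 ?ler0n ?sqr_ge0 ?fine_ge0.
move=> k; apply: le_trans (integral_majorant_le beta M k) _.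
rewrite -(mulrA (400 * _)) (EFinM (400 * _)); apply: lee_wpmul2l.
  by rewrite lee_fin mulr_ge0 ?ler0n ?sqr_ge0.
apply: (@le_trans _ _ (\int[leb3]_l ((2 / bracket k)%:E * (bracket l `^ (- (- (q + 1))))%:E)))%E.
  apply: ge0_le_integral => //.
  - by move=> l _; rewrite lee_fin mulr_ge0 ?powR_ge0// invr_ge0 bracket_ge0.
  - by apply/measurable_EFinP; apply: (measurable_funM (mbr _) (mV _)).
  - by apply/measurable_EFinP; apply: (measurable_funM (measurable_cst _) (mbr _)).
  move=> l _; rewrite -EFinM lee_fin opprK.
  have -> : bracket l `^ (q + 1) = bracket l `^ q * bracket l.
    by rewrite powRD ?powRr1 ?bracket_ge0// (gt_eqF (bracket_gt0 l)) implybT.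
  rewrite -/q mulrCA; apply: ler_wpM2l; first exact: powR_ge0.
  have k0 := bracket_gt0 k; have l0 := bracket_gt0 l; have kl0 := bracket_gt0 (k - l).
  rewrite mulrAC ler_pdivlMr// mulrC ler_pdivrMr//.
  have := bracketB_le k l; lra.
rewrite ge0_integralZl//; last 3 first.
- by apply/measurable_EFinP; exact: mbr.
- by move=> l _; rewrite lee_fin powR_ge0.
- by rewrite lee_fin divr_ge0// bracket_ge0.
rewrite -/I -(fineK If) -EFinM lee_fin le_eqVlt; apply/orP; left; apply/eqP.
by rewrite mulrAC.
Qed.

End Majorant.

(** * The trilinear operators *)

Section Operator.
Context {R : realType}.
Notation resonance := (vec3 R * (R * R))%type.
Notation lebY := (@leb3 R \x @leb2 R)%E.
Implicit Types (k l : vec3 R) (x : resonance) (f g : vec3 R -> R).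
Implicit Type P : R -> R -> R -> R -> R.

(* The sigma-finite structure of this product is not inferred. *)
Definition leb5 := lebY.

HB.instance Definition _ := Measure.on leb5.
HB.instance Definition _ := Measure_isSigmaFinite.Build _ _ _ leb5
  (product_sigma_finite (@leb3 R) (@leb2 R)).

Definition kern P (beta : R) f k x : R :=
  enorm (k - x.1) *
  ((enorm x.1 * enorm (out1 k x) * enorm (out2 k x)) `^ (2 * beta) *
   P (f k) (f x.1) (f (out1 k x)) (f (out2 k x))) * sin x.2.1.

Definition cubic_op P (beta : R) f k : R :=
  enorm k `^ (2 * beta) *
  (8^-1 * \int[lebY]_(x in @resonant_dom R) kern P beta f k x).

Definition coll_form (a1 a2 a3 a4 : R) : R :=
  a2 * a3 * a4 + a1 * a3 * a4 - a1 * a2 * a4 - a1 * a2 * a3.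

Definition gain_form (a1 a2 a3 a4 : R) : R := a2 * a3 * a4 + a1 * a3 * a4.

Lemma collisionE beta : @collision R beta = cubic_op coll_form beta.
Proof. by []. Qed.

Lemma gainE beta : @gain R beta = cubic_op gain_form beta.
Proof. by []. Qed.

(** The right-hand side of the Lipschitz clause is the sum of weights bounded by [cubic_weight_le].
    The amplitude [A] and the difference [D] are separate because contraction and perturbation use a
    small [D] at fixed [A]. *)
Record cubic_form P : Prop := CubicForm {
  cubic_form_measurable : measurable_fun [set: R * R * R * R]
    (fun p => P p.1.1.1 p.1.1.2 p.1.2 p.2);
  cubic_form0 : P 0 0 0 0 = 0;
  cubic_form_lipschitz : forall A D w1 w2 w3 w4 a1 a2 a3 a4 b1 b2 b3 b4 : R,
    `|a1| <= A * w1 -> `|a2| <= A * w2 -> `|a3| <= A * w3 -> `|a4| <= A * w4 ->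
    `|b1| <= A * w1 -> `|b2| <= A * w2 -> `|b3| <= A * w3 -> `|b4| <= A * w4 ->
    `|a1 - b1| <= D * w1 -> `|a2 - b2| <= D * w2 ->
    `|a3 - b3| <= D * w3 -> `|a4 - b4| <= D * w4 ->
    `|P a1 a2 a3 a4 - P b1 b2 b3 b4| <= 3 * A ^+ 2 * D *
      (w2 * w3 * w4 + w1 * w3 * w4 + w1 * w2 * w4 + w1 * w2 * w3) }.

(** Telescoping, one factor at a time; hence the 3. *)
Lemma monomial_lipschitz (A D u v w x y z x' y' z' : R) :
  `|x| <= A * u -> `|y| <= A * v -> `|z| <= A * w ->
  `|x'| <= A * u -> `|y'| <= A * v -> `|z'| <= A * w ->
  `|x - x'| <= D * u -> `|y - y'| <= D * v -> `|z - z'| <= D * w ->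
  `|x * y * z - x' * y' * z'| <= 3 * A ^+ 2 * D * (u * v * w).
Proof.
move=> hx hy hz hx' hy' hz' dx dy dz.
have -> : x * y * z - x' * y' * z' =
  (x - x') * y * z + x' * (y - y') * z + x' * y' * (z - z') by ring.
apply: le_trans (ler_normD _ _) _; apply: le_trans (lerD (ler_normD _ _) (lexx _)) _.
rewrite !normrM.
have h1 : `|x - x'| * `|y| * `|z| <= (D * u) * (A * v) * (A * w).
  by rewrite !ler_pM ?mulr_ge0.
have h2 : `|x'| * `|y - y'| * `|z| <= (A * u) * (D * v) * (A * w).
  by rewrite !ler_pM ?mulr_ge0.
have h3 : `|x'| * `|y'| * `|z - z'| <= (A * u) * (A * v) * (D * w).
  by rewrite !ler_pM ?mulr_ge0.
apply: le_trans (lerD (lerD h1 h2) h3) _.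
by rewrite le_eqVlt; apply/orP; left; apply/eqP; ring.
Qed.

Let coord_measurable :
  [/\ measurable_fun setT (fun p : R * R * R * R => p.1.1.1),
   measurable_fun setT (fun p : R * R * R * R => p.1.1.2),
   measurable_fun setT (fun p : R * R * R * R => p.1.2) &
   measurable_fun setT (fun p : R * R * R * R => p.2)].
Proof.
have m2 := @measurable_snd _ _ (vec3 R) R.
have [? ? ?] := measurable_coord (@measurable_fst _ _ (vec3 R) R).
by split.
Qed.

Lemma coll_form_cubic : cubic_form coll_form.
Proof.
have [m1 m2 m3 m4] := coord_measurable.
split=> [|| A D w1 w2 w3 w4 a1 a2 a3 a4 b1 b2 b3 b4 h1 h2 h3 h4 i1 i2 i3 i4 d1 d2 d3 d4].
- have p3 (f g h : R * R * R * R -> R) : measurable_fun setT f ->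
      measurable_fun setT g -> measurable_fun setT h ->
      measurable_fun setT (fun p => f p * g p * h p).
    by move=> *; apply: measurable_funM => //; exact: measurable_funM.
  by apply: measurable_funB; [apply: measurable_funB; [apply: measurable_funD|]|]; exact: p3.
- by rewrite /coll_form; ring.
have e1 := monomial_lipschitz h2 h3 h4 i2 i3 i4 d2 d3 d4.
have e2 := monomial_lipschitz h1 h3 h4 i1 i3 i4 d1 d3 d4.
have e3 := monomial_lipschitz h1 h2 h4 i1 i2 i4 d1 d2 d4.
have e4 := monomial_lipschitz h1 h2 h3 i1 i2 i3 d1 d2 d3.
rewrite !mulrDr; apply: le_trans (lerD (lerD (lerD e1 e2) e3) e4).
rewrite /coll_form.
set t1 := _ - _ in e1 *; set t2 := _ - _ in e2 *; set t3 := _ - _ in e3 *; set t4 := _ - _ in e4 *.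
rewrite (_ : _ - _ = t1 + t2 - t3 - t4); last by rewrite /t1 /t2 /t3 /t4; ring.
apply: le_trans (ler_normB _ _) _; rewrite lerD2r.
apply: le_trans (ler_normB _ _) _; rewrite lerD2r.
exact: ler_normD.
Qed.

Lemma gain_form_cubic : cubic_form gain_form.
Proof.
have [m1 m2 m3 m4] := coord_measurable.
split=> [|| A D w1 w2 w3 w4 a1 a2 a3 a4 b1 b2 b3 b4 h1 h2 h3 h4 i1 i2 i3 i4 d1 d2 d3 d4].
- by apply: measurable_funD; do 2![apply: measurable_funM => //].
- by rewrite /gain_form; ring.
have e1 := monomial_lipschitz h2 h3 h4 i2 i3 i4 d2 d3 d4.
have e2 := monomial_lipschitz h1 h3 h4 i1 i3 i4 d1 d3 d4.
have e3 := monomial_lipschitz h1 h2 h4 i1 i2 i4 d1 d2 d4.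
have e4 := monomial_lipschitz h1 h2 h3 i1 i2 i3 d1 d2 d3.
rewrite !mulrDr; apply: (@le_trans _ _ (`|a2 * a3 * a4 - b2 * b3 * b4|
    + `|a1 * a3 * a4 - b1 * b3 * b4|)).
  apply: le_trans (ler_normD _ _); rewrite le_eqVlt; apply/orP; left; apply/eqP.
  by congr (`| _ |); rewrite /gain_form; ring.
(* The bounds of the two loss monomials are added; [e3] and [e4] show that they are nonnegative. *)
apply: le_trans (lerD e1 e2) _; rewrite -addrA lerDl.
exact: le_trans (normr_ge0 _) (le_trans (ler_normD _ _) (lerD e3 e4)).
Qed.

Section kern_measurable.
Context P (beta : R) (cP : cubic_form P).

Lemma measurable_kern d (T : measurableType d) (F : T * vec3 R -> R)
    (k : T -> vec3 R) : measurable_fun setT F -> measurable_fun setT k ->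
  measurable_fun setT
    (fun z : T * resonance => kern P beta (fun l => F (z.1, l)) (k z.1) z.2).
Proof.
move=> mF mk.
have m1 := @measurable_fst _ _ T resonance.
have m2 := @measurable_snd _ _ T resonance.
have mk1 : measurable_fun setT (fun z : T * resonance => k z.1).
  exact: (measurableT_comp mk m1).
have ml : measurable_fun setT (fun z : T * resonance => z.2.1).
  exact: (measurableT_comp (@measurable_fst _ _ (vec3 R) (R * R)%type) m2).
have [mo1 mo2] := measurable_out mk1 m2.
have ms : measurable_fun setT (fun z : T * resonance => sin z.2.2.1).
  apply: (measurableT_comp (@measurable_sin R)).
  apply: (measurableT_comp (@measurable_fst _ _ R R)).
  exact: (measurableT_comp (@measurable_snd _ _ (vec3 R) (R * R)%type) m2).
have mF' (h : T * resonance -> vec3 R) : measurable_fun setT h ->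
    measurable_fun setT (fun z => F (z.1, h z)).
  by move=> mh; apply: (measurableT_comp mF); exact: measurable_fun_pair.
apply: measurable_funM => //; apply: measurable_funM.
  by apply: measurable_enorm; apply: measurable_vec3D => //; exact: measurable_vec3N.
apply: measurable_funM.
  apply: (measurableT_comp (measurable_powR _)).
  apply: measurable_funM; last exact: measurable_enorm.
  by apply: measurable_funM; exact: measurable_enorm.
have mP := cubic_form_measurable cP.
have mq : measurable_fun setT (fun z : T * resonance =>
    (F (z.1, k z.1), F (z.1, z.2.1), F (z.1, out1 (k z.1) z.2), F (z.1, out2 (k z.1) z.2))).
  by apply: measurable_fun_pair; [apply: measurable_vec3|]; exact: mF'.
exact: (measurableT_comp mP mq).
Qed.

Lemma measurable_kern1 f k : measurable_fun setT f ->
  measurable_fun setT (kern P beta f k).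
Proof.
move=> mf.
have mF : measurable_fun setT (fun z : vec3 R * vec3 R => f z.2).
  exact: (measurableT_comp mf measurable_snd).
have := measurable_kern mF (measurable_cst k).
by move/(measurable_fun_pair2 k).
Qed.

(** The parameter type is left free: it is instantiated with times and with products of times and
    wave vectors. *)
Lemma measurable_cubic_op d (T : measurableType d) (F : T * vec3 R -> R)
    (k : T -> vec3 R) : measurable_fun setT F -> measurable_fun setT k ->
  measurable_fun setT (fun t => cubic_op P beta (fun l => F (t, l)) (k t)).
Proof.
move=> mF mk; apply: measurable_funM.
  by apply: (measurableT_comp (measurable_powR _)); exact: measurable_enorm.
apply: measurable_funM => //.
have := measurable_kern mF mk.
exact: (measurable_Rintegral_param leb5 measurable_resonant_dom).
Qed.

End kern_measurable.

End Operator.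

(** * Lipschitz bound of the operator at a fixed wave vector *)

Section OperatorBounds.
Context {R : realType}.
Notation resonance := (vec3 R * (R * R))%type.
Notation lebY := (@leb3 R \x @leb2 R)%E.
Context (beta M : R) (beta0 : 0 <= beta) (M4 : 4 <= M - 2 * beta).
Context (P : R -> R -> R -> R -> R) (cP : cubic_form P).
Implicit Types (k l : vec3 R) (x : resonance) (f g : vec3 R -> R).

(** Required at every point, since the kernel at k uses f at [out1 k x] and [out2 k x]; bounds valid
    almost everywhere are first converted by [ae_bounded_repr]. *)
Definition bounded_by A f := forall k, `|f k| <= A * weight M k.

Lemma bounded_by_ge0 A f : bounded_by A f -> 0 <= A.
Proof.
move=> /(_ 0) h; rewrite -(pmulr_lge0 _ (weight_gt0 M 0)).
exact: le_trans h.
Qed.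

Definition kern_const k :=
  4 * 2 `^ (M - 2 * beta) * (bracket k `^ (2 * (2 * beta)) * weight M k).

Lemma kern_const_ge0 k : 0 <= kern_const k.
Proof. by rewrite !mulr_ge0 ?powR_ge0 ?weight_ge0. Qed.

Lemma kern_diff_le f g A D k x :
  bounded_by A f -> bounded_by A g -> bounded_by D (f \- g) ->
  enorm k `^ (2 * beta) * `|kern P beta f k x - kern P beta g k x| <=
  3 * A ^+ 2 * D * kern_const k * majorant beta M k x.
Proof.
move=> hf hg hd.
have A0 := bounded_by_ge0 hf; have D0 := bounded_by_ge0 hd.
have hP := cubic_form_lipschitz cP (hf k) (hf x.1) (hf (out1 k x)) (hf (out2 k x))
  (hg k) (hg x.1) (hg (out1 k x)) (hg (out2 k x))
  (hd k) (hd x.1) (hd (out1 k x)) (hd (out2 k x)).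
have en l : 0 <= enorm l <= bracket l by rewrite enorm_ge0 enorm_le_bracket.
have b0 : 0 <= 2 * beta by rewrite mulr_ge0.
have hW := cubic_weight_le b0 M4 (en k) (en x.1) (en (out1 k x)) (en (out2 k x))
  (bracket_ge1 _) (bracket_ge1 _) (bracket_ge1 _) (bracket_ge1 _)
  (post1_le _ _ _) (post2_le _ _ _) (post_energy _ _ _).
rewrite /kern -mulrBl -mulrBr -mulrBr !normrM.
rewrite (ger0_norm (enorm_ge0 _)) (ger0_norm (powR_ge0 _ _)).
move: hP hW; rewrite /kern_const /majorant /weight.
set S := _ + _ + _ + bracket k `^ _ * _ * _; set S4 := _ ^- 4 + _ ^- 4.
set e := enorm k `^ _; set p := (_ * enorm (out2 k x)) `^ _.
set dP := `|P _ _ _ _ - _| => hP hW.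
have -> : e * (enorm (k - x.1) * (p * dP) * `|sin x.2.1|) =
  e * p * dP * (enorm (k - x.1) * `|sin x.2.1|) by ring.
apply: (@le_trans _ _ (e * p * (3 * A ^+ 2 * D * S) * (enorm (k - x.1) * `|sin x.2.1|))).
  apply: ler_wpM2r; first by rewrite mulr_ge0 ?enorm_ge0.
  by apply: ler_wpM2l => //; rewrite mulr_ge0 ?powR_ge0.
have -> : e * p * (3 * A ^+ 2 * D * S) * (enorm (k - x.1) * `|sin x.2.1|) =
  3 * A ^+ 2 * D * (enorm (k - x.1) * `|sin x.2.1|) * (e * p * S) by ring.
apply: le_trans (ler_wpM2l _ hW) _.
  by rewrite !mulr_ge0 ?sqr_ge0 ?enorm_ge0.
rewrite le_eqVlt; apply/orP; left; apply/eqP.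
move: (2 `^ _) (bracket k `^ (2 * _)) (bracket k `^ (- M)) (bracket x.1 `^ _)
  (enorm (k - x.1)) `|sin x.2.1| => a b c v w z; ring.
Qed.

Lemma bounded_by0 A : 0 <= A -> bounded_by A (fun=> 0).
Proof. by move=> A0 k; rewrite normr0 mulr_ge0// weight_ge0. Qed.

Lemma kern0 k x : kern P beta (fun=> 0) k x = 0.
Proof. by rewrite /kern (cubic_form0 cP) !mulr0 mul0r. Qed.

Let integrable_scale c (h : resonance -> R) :
  lebY.-integrable (@resonant_dom R) (EFin \o h) ->
  lebY.-integrable (@resonant_dom R) (EFin \o (fun x => c * h x)).
Proof.
move=> ih.
have : lebY.-integrable (@resonant_dom R) (fun x => (c%:E * (EFin \o h) x)%E).
  by apply: integrableZl ih; exact: measurable_resonant_dom.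
by apply: eq_integrable => //; exact: measurable_resonant_dom.
Qed.

Section at_point.
Variable k : vec3 R.
Hypothesis majorant_lty :
  (\int[lebY]_(x in @resonant_dom R) (majorant beta M k x)%:E < +oo)%E.

Lemma majorant_integrable :
  lebY.-integrable (@resonant_dom R) (EFin \o majorant beta M k).
Proof.
apply/integrableP; split.
  by apply/measurable_EFinP/measurable_funTS; exact: measurable_majorant.
apply: le_lt_trans majorant_lty; rewrite le_eqVlt; apply/orP; left; apply/eqP.
by apply: eq_integral => x _; rewrite /= ger0_norm// majorant_ge0.
Qed.

(** Comparison of [f] with 0 in [kern_diff_le], divided by |k|^(2 beta); this is where positivity of
    that factor enters. *)
Lemma kern_integrable f A : 0 < enorm k `^ (2 * beta) ->
  measurable_fun setT f -> bounded_by A f ->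
  lebY.-integrable (@resonant_dom R) (EFin \o kern P beta f k).
Proof.
move=> e0 mf hf; have A0 := bounded_by_ge0 hf.
have hd : bounded_by A (f \- (fun=> 0)) by move=> l; rewrite /= subr0.
have mk := measurable_kern1 beta cP k mf.
pose c := 3 * A ^+ 2 * A * kern_const k / enorm k `^ (2 * beta).
have ic : lebY.-integrable (@resonant_dom R) (EFin \o (fun x => c * majorant beta M k x)).
  exact: (integrable_scale c majorant_integrable).
apply: le_integrable ic; first exact: measurable_resonant_dom.
  by apply/measurable_EFinP/measurable_funTS.
move=> x _; rewrite /= lee_fin [leRHS]ger0_norm; last first.
  rewrite mulr_ge0 ?majorant_ge0// /c divr_ge0 ?powR_ge0//.
  apply: mulr_ge0; last exact: kern_const_ge0. by rewrite mulr_ge0// mulr_ge0// sqr_ge0.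
have := kern_diff_le k x hf (bounded_by0 A0) hd; rewrite kern0 subr0.
have -> : c * majorant beta M k x =
    3 * A ^+ 2 * A * kern_const k * majorant beta M k x / enorm k `^ (2 * beta).
  by rewrite /c mulrAC.
by rewrite ler_pdivlMr// mulrC.
Qed.

Definition op_const :=
  8^-1 * kern_const k * \int[lebY]_(x in @resonant_dom R) majorant beta M k x.

Lemma op_const_ge0 : 0 <= op_const.
Proof.
apply: mulr_ge0; first by rewrite mulr_ge0 ?invr_ge0 ?kern_const_ge0.
by apply: Rintegral_ge0 => x _; exact: majorant_ge0.
Qed.

Lemma cubic_op_diff_le f g A D : measurable_fun setT f -> measurable_fun setT g ->
  bounded_by A f -> bounded_by A g -> bounded_by D (f \- g) ->
  `|cubic_op P beta f k - cubic_op P beta g k| <= 3 * A ^+ 2 * D * op_const.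
Proof.
move=> mf mg hf hg hd.
have A0 := bounded_by_ge0 hf; have D0 := bounded_by_ge0 hd.
rewrite /cubic_op -mulrBr -mulrBr.
(* Where the prefactor vanishes, so do both values of the operator; elsewhere [kern_integrable]
   applies. *)
have := powR_ge0 (enorm k) (2 * beta); rewrite le_eqVlt => /predU1P[e0|e0].
  rewrite -e0 mul0r normr0; apply: mulr_ge0; last exact: op_const_ge0.
  by rewrite mulr_ge0// mulr_ge0// sqr_ge0.
have i_f := kern_integrable e0 mf hf; have i_g := kern_integrable e0 mg hg.
rewrite -RintegralB//; last exact: measurable_resonant_dom.
rewrite normrM (ger0_norm (ltW e0)) normrM (ger0_norm (_ : 0 <= 8^-1)) ?invr_ge0//.
have -> : 3 * A ^+ 2 * D * op_const = 8^-1 * (3 * A ^+ 2 * D * kern_const k *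
    \int[lebY]_(x in @resonant_dom R) majorant beta M k x).
  by rewrite /op_const; ring.
rewrite mulrCA; apply: ler_wpM2l; first by rewrite invr_ge0.
have i_d : lebY.-integrable (@resonant_dom R)
    (EFin \o (fun x => kern P beta f k x - kern P beta g k x)).
  have : lebY.-integrable (@resonant_dom R) (fun x =>
      ((EFin \o kern P beta f k) x - (EFin \o kern P beta g k) x)%E).
    by apply: integrableB i_f i_g; exact: measurable_resonant_dom.
  by apply: eq_integrable => //; exact: measurable_resonant_dom.
have h : `|\int[lebY]_(x in @resonant_dom R)
    (kern P beta f k x - kern P beta g k x)| <= \int[lebY]_(x in @resonant_dom R)
    `|kern P beta f k x - kern P beta g k x|.
  by apply: le_normr_Rintegral i_d; exact: measurable_resonant_dom.
apply: le_trans (ler_wpM2l (ltW e0) h) _.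
have i_n := integrable_norm i_d.
rewrite -RintegralZl//; last 2 first.
- exact: measurable_resonant_dom.
- exact: majorant_integrable.
rewrite -RintegralZl//; last exact: measurable_resonant_dom.
apply: le_Rintegral => //.
- exact: measurable_resonant_dom.
- exact: (integrable_scale (enorm k `^ (2 * beta)) i_n).
- exact: (integrable_scale (3 * A ^+ 2 * D * kern_const k) majorant_integrable).
by move=> x _; exact: kern_diff_le.
Qed.

End at_point.

End OperatorBounds.

(** * Almost everywhere equal functions *)

Section Invariance.
Context {R : realType}.
Notation mu := (@lebesgue_measure R).

Definition integral_invariant (phi : R -> R) :=
  measurable_fun setT phi /\
  forall f : R -> \bar R, measurable_fun [set: R] f -> (forall x, 0 <= f x)%E ->
  (\int[mu]_x f (phi x) = \int[mu]_x f x)%E.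

Let invariant_pushforward (phi : R -> R) : measurable_fun setT phi ->
  (forall A : set R, measurable A -> mu (phi @^-1` A) = mu A) ->
  integral_invariant phi.
Proof.
move=> mphi inv; split=> // f mf f0.
transitivity (\int[pushforward mu (phi : measurableTypeR R -> measurableTypeR R)]_y f y)%E.
  by rewrite ge0_integral_pushforward//; rewrite preimage_setT.
by apply: eq_measure_integral => A mA _; exact: inv.
Qed.

(** The pushforward agrees with Lebesgue measure on half-open intervals, which determine it. *)
Lemma invariant_shift (c : R) : integral_invariant (fun x => c + x).
Proof.
have mc : measurable_fun setT (fun x : R => c + x) by exact: measurable_funD.
apply: invariant_pushforward => // A mA; apply/esym.
apply: (@lebesgue_measure_unique _ (pushforward mu (fun x : measurableTypeR R =>
    c + x : measurableTypeR R))) => //.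
move=> _ [[a b]] _ <-; rewrite /pushforward.
transitivity (mu `](a - c), (b - c)]%classic); last first.
  congr (mu _); apply/seteqP; split => x /=.
    by rewrite !in_itv/= ltrBlDl lerBrDl.
  by rewrite !in_itv/= ltrBlDl lerBrDl.
rewrite /= !lebesgue_measure_itv/= !lte_fin ltrD2r; case: ifP => // _.
by rewrite -!EFinD; congr EFin; ring.
Qed.

Lemma invariant_opp : integral_invariant -%R.
Proof.
apply: invariant_pushforward => // A mA; exact: lebesgue_measureN.
Qed.

Lemma invariant_reflect (c : R) : integral_invariant (fun x => c - x).
Proof.
have [m1 h1] := invariant_opp; have [m2 h2] := invariant_shift c.
split; first exact: (measurableT_comp m2 m1).
move=> f mf f0; rewrite (h1 (fun x => f (c + x)))//; first exact: h2.
exact: (measurableT_comp mf m2).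
Qed.

Lemma ge0_integral_leb3 (f : vec3 R -> \bar R) : measurable_fun setT f ->
  (forall k, 0 <= f k)%E ->
  (\int[leb3]_k f k = \int[mu]_x \int[mu]_y \int[mu]_z f (x, y, z))%E.
Proof.
move=> mf f0.
transitivity (\int[leb2]_a \int[mu]_z f (a, z))%E.
  exact: (@fubini_tonelli1 _ _ _ _ R leb2 mu f mf f0).
apply: (@fubini_tonelli1 _ _ _ _ R mu mu (fun a => \int[mu]_z f (a, z))%E).
  exact: (@measurable_fun_fubini_tonelli_F _ _ _ _ R mu f mf f0).
by move=> a; exact: integral_ge0.
Qed.

Lemma ge0_integral_leb3_invariant (f : vec3 R -> \bar R) p1 p2 p3 :
  integral_invariant p1 -> integral_invariant p2 -> integral_invariant p3 ->
  measurable_fun setT f -> (forall k, 0 <= f k)%E ->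
  (\int[leb3]_k f (p1 k.1.1, p2 k.1.2, p3 k.2) = \int[leb3]_k f k)%E.
Proof.
move=> [m1 h1] [m2 h2] [m3 h3] mf f0.
have mp : measurable_fun setT (fun k : vec3 R => (p1 k.1.1, p2 k.1.2, p3 k.2) : vec3 R).
  have [c1 c2 c3] := measurable_coord (@measurable_id _ (vec3 R) setT).
  apply: measurable_vec3; [exact: (measurableT_comp m1 c1)|
    exact: (measurableT_comp m2 c2)|exact: (measurableT_comp m3 c3)].
transitivity (\int[mu]_x \int[mu]_y \int[mu]_z f (p1 x, p2 y, p3 z))%E.
  have f0' (k : vec3 R) : (0 <= (f (p1 k.1.1, p2 k.1.2, p3 k.2)))%E by [].
  exact: (ge0_integral_leb3 (measurableT_comp mf mp) f0').
transitivity (\int[mu]_x \int[mu]_y \int[mu]_z f (x, y, z))%E; last first.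
  exact: (esym (ge0_integral_leb3 mf f0)).
have mz (a : R * R) : measurable_fun setT (fun z => f (a, z)).
  exact: measurable_fun_pair2.
have mF : measurable_fun setT (fun a : R * R => \int[mu]_z f (a, z))%E.
  exact: (@measurable_fun_fubini_tonelli_F _ _ _ _ R mu f mf f0).
have F0 (a : R * R) : (0 <= \int[mu]_z f (a, z))%E by exact: integral_ge0.
transitivity (\int[mu]_x \int[mu]_y \int[mu]_z f (p1 x, y, z))%E.
  apply: eq_integral => x _.
  transitivity (\int[mu]_y \int[mu]_z f (p1 x, p2 y, z))%E.
    by apply: eq_integral => y _; exact: (h3 (fun z => f (p1 x, p2 y, z))).
  apply: (h2 (fun y => \int[mu]_z f (p1 x, y, z))%E) => //.
  exact: (measurable_fun_pair2 (p1 x) mF).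
apply: (h1 (fun x => \int[mu]_y \int[mu]_z f (x, y, z))%E).
  exact: (@measurable_fun_fubini_tonelli_F _ _ _ _ R mu (fun a => \int[mu]_z f (a, z))%E mF F0).
by move=> x; exact: integral_ge0.
Qed.

Lemma ge0_integral_leb3_shift (f : vec3 R -> \bar R) (t : vec3 R) :
  measurable_fun setT f -> (forall k, 0 <= f k)%E ->
  (\int[leb3]_k f (t + k)%R = \int[leb3]_k f k)%E.
Proof.
exact: ge0_integral_leb3_invariant (invariant_shift _) (invariant_shift _)
  (invariant_shift _).
Qed.

Lemma ge0_integral_leb3_reflect (f : vec3 R -> \bar R) (t : vec3 R) :
  measurable_fun setT f -> (forall k, 0 <= f k)%E ->
  (\int[leb3]_k f (t - k)%R = \int[leb3]_k f k)%E.
Proof.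
exact: ge0_integral_leb3_invariant (invariant_reflect _) (invariant_reflect _)
  (invariant_reflect _).
Qed.

End Invariance.

(** * Independence of the operator from the representative *)

Section NullSets.
Context {R : realType}.
Notation resonance := (vec3 R * (R * R))%type.
Notation lebY := (@leb3 R \x @leb2 R)%E.

(* For fixed [v] and [a] the map [k |-> s v a + k] preserves null sets; this
   makes the operator independent of the representative of [f]. *)
Lemma null_fiber (N : set (vec3 R)) (o : vec3 R -> resonance -> vec3 R)
    (s : vec3 R -> R * R -> vec3 R) : measurable N -> leb3 N = 0%E ->
  measurable_fun setT (fun z : vec3 R * resonance => o z.1 z.2) ->
  (forall k v a, o k (k - v, a) = s v a + k) ->
  {ae leb3, forall k, (\int[lebY]_x (\1_N (o k x))%:E = 0)%E}.
Proof.
move=> mN N0 mo ho.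
have mi : measurable_fun [set: vec3 R] (fun k : vec3 R => (\1_N k : R)%:E).
  by apply/measurable_EFinP; exact: measurable_indic.
pose phi (z : vec3 R * resonance) := (\1_N (o z.1 z.2) : R)%:E.
have mphi : measurable_fun setT phi by exact: (measurableT_comp mi mo).
have phi0 z : (0 <= phi z)%E by rewrite lee_fin.
have mT d1 d2 d3 (T1 : measurableType d1) (T2 : measurableType d2) (T3 : measurableType d3)
   : measurable_fun setT (fun y : T1 * T2 * T3 => (y.1.1, (y.2, y.1.2))).
  have m1 := @measurable_fst _ _ (T1 * T2)%type T3.
  apply: measurable_fun_pair; first exact: (measurableT_comp (@measurable_fst _ _ T1 T2) m1).
  apply: measurable_fun_pair; first exact: (@measurable_snd _ _ (T1 * T2)%type T3).
  exact: (measurableT_comp (@measurable_snd _ _ T1 T2) m1).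
pose G k := (\int[lebY]_x phi (k, x))%E.
have mG : measurable_fun setT G.
  exact: (@measurable_fun_fubini_tonelli_F _ _ _ _ R (@leb5 R) phi mphi phi0).
have G0 k : (0 <= G k)%E by exact: integral_ge0.
have mka : measurable_fun setT (fun ka : vec3 R * (R * R) =>
    \int[leb3]_l phi (ka.1, (l, ka.2)))%E.
  have mq : measurable_fun setT (fun y : vec3 R * (R * R) * vec3 R =>
      phi (y.1.1, (y.2, y.1.2))) by exact: (measurableT_comp mphi (mT _ _ _ _ _ _)).
  apply: (@measurable_fun_fubini_tonelli_F _ _ _ _ R (@leb3 R)
    (fun y : vec3 R * (R * R) * vec3 R => phi (y.1.1, (y.2, y.1.2))) mq).
  by move=> y.
(* After the substitution l = k - v and exchanges of integrals, the innermost integral runs over k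
   at fixed v and a, and is the measure of a translate of [N]. *)
have IG : (\int[leb3]_k G k = 0)%E.
  transitivity (\int[leb3]_k \int[leb2]_a \int[leb3]_l phi (k, (l, a)))%E.
    apply: eq_integral => k _.
    have mphik : measurable_fun setT (fun x => phi (k, x)) by exact: measurable_fun_pair2.
    exact: (@fubini_tonelli2 _ _ _ _ R (@leb3 R) (@leb2 R) (fun x => phi (k, x)) mphik (fun x =>
        phi0 (k, x))).
  transitivity (\int[leb2]_a \int[leb3]_k \int[leb3]_l phi (k, (l, a)))%E.
    apply: (@fubini_tonelli _ _ _ _ R (@leb3 R) (@leb2 R) (fun ka => \int[leb3]_l phi (ka.1, (l,
        ka.2)))%E mka).
    by move=> ka; exact: integral_ge0.
  apply: integral0_eq => a _.
  have mkl : measurable_fun setT (fun y : vec3 R * vec3 R => phi (y.1, (y.1 - y.2, a))).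
    apply: (measurableT_comp mphi).
    apply: measurable_fun_pair => //; apply: measurable_fun_pair => //.
    by apply: measurable_vec3D => //; exact: measurable_vec3N.
  transitivity (\int[leb3]_k \int[leb3]_v phi (k, (k - v, a)%R))%E.
    apply: eq_integral => k _; apply/esym.
    apply: (ge0_integral_leb3_reflect (f := fun l => phi (k, (l, a)))) => //.
    apply: (measurableT_comp mphi).
    by apply: measurable_fun_pair => //; exact: measurable_fun_pair.
  transitivity (\int[leb3]_v \int[leb3]_k phi (k, (k - v, a)%R))%E.
    by apply: (@fubini_tonelli _ _ _ _ R (@leb3 R) (@leb3 R)
      (fun y : vec3 R * vec3 R => phi (y.1, (y.1 - y.2, a))) mkl).
  apply: integral0_eq => v _; rewrite /phi/=.
  under eq_integral do rewrite ho.
  rewrite (ge0_integral_leb3_shift (f := fun k => (\1_N k : R)%:E))//.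
  by rewrite integral_indic// setIT.
have := (ae_eq_integral_abs leb3 measurableT mG).1.
move=> H; have {}H : ae_eq leb3 setT G (cst 0%E).
  apply: H; rewrite -[RHS]IG; apply: eq_integral => k _; exact: gee0_abs.
by apply: filterS H => k /(_ I).
Qed.

Let out1_shift k v a : out1 k (k - v, a) =
  (scale3 (- 2^-1) v + scale3 (enorm v / 2) (sphere_pt a)) + k :> vec3 R.
Proof.
rewrite /out1 /post1 [_ - _.1](_ : _ = v); last by rewrite opprB addrC subrK.
move: (sphere_pt a) (enorm v) => [[x y] z] r.
case: k v => [[k1 k2] k3] [[v1 v2] v3].
by rewrite /scale3 /=; congr ((_, _), _) => /=; field.
Qed.

Let out2_shift k v a : out2 k (k - v, a) =
  (scale3 (- 2^-1) v - scale3 (enorm v / 2) (sphere_pt a)) + k :> vec3 R.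
Proof.
rewrite /out2 /post2 [_ - _.1](_ : _ = v); last by rewrite opprB addrC subrK.
move: (sphere_pt a) (enorm v) => [[x y] z] r.
case: k v => [[k1 k2] k3] [[v1 v2] v3].
by rewrite /scale3 /=; congr ((_, _), _) => /=; field.
Qed.

(** For almost every k, the point k avoids the exceptional set and, for almost every x, so do [x.1],
    [out1 k x] and [out2 k x]: the first through a product null set, the others through
    [null_fiber]. *)
Lemma cubic_op_ae_eq P (beta : R) (f g : vec3 R -> R) : cubic_form P ->
  measurable_fun setT f -> measurable_fun setT g -> f = g %[ae leb3] ->
  {ae leb3, forall k, cubic_op P beta f k = cubic_op P beta g k}.
Proof.
move=> cP mf mg [N [mN N0 fgN]].
have fg k : ~ N k -> f k = g k by move=> Nk; apply: contrapT => fgk; apply/Nk/fgN => /(_ I).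
have [mo1 mo2] := measurable_out (@measurable_fst _ _ (vec3 R) resonance)
  (@measurable_snd _ _ (vec3 R) resonance).
have n1 := null_fiber mN N0 mo1 out1_shift.
have n2 := null_fiber mN N0 mo2 out2_shift.
have n0 : {ae leb3, forall k, ~ N k}.
  by exists N; split => // k /= /contrapT.
have nl : {ae lebY, forall x, ~ N x.1}.
  exists (N `*` setT); split; first exact: measurableX.
    transitivity (leb3 N * leb2 [set: R * R])%E; last by rewrite N0 mul0e.
    exact: product_measure1E.
  by move=> x /= /contrapT.
have mi : measurable_fun [set: vec3 R] (fun k : vec3 R => (\1_N k : R)%:E).
  by apply/measurable_EFinP; exact: measurable_indic.
have out_ae (o : vec3 R -> resonance -> vec3 R) k :
    measurable_fun setT (fun z : vec3 R * resonance => o z.1 z.2) ->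
    (\int[lebY]_x (\1_N (o k x))%:E = 0)%E -> {ae lebY, forall x, ~ N (o k x)}.
  move=> mo i0.
  have mok : measurable_fun setT (fun x => (\1_N (o k x) : R)%:E).
    apply: (measurableT_comp mi); exact: (measurable_fun_pair2 k mo).
  have H : ae_eq lebY setT (fun x => (\1_N (o k x) : R)%:E) (cst 0%E).
    apply/(ae_eq_integral_abs lebY measurableT mok).
    by rewrite -[RHS]i0; apply: eq_integral => x _; exact: gee0_abs.
  apply: filterS H => x /(_ I)/= [] /eqP; rewrite indicE pnatr_eq0 eqb0.
  by move=> /negP h /mem_set.
move: n0 n1 n2; apply: filterS3 => k Nk i1 i2.
have o1 := out_ae _ k mo1 i1; have o2 := out_ae _ k mo2 i2.
rewrite /cubic_op; congr (_ * (_ * _)); rewrite /Rintegral; congr fine.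
apply: ae_eq_integral.
- exact: measurable_resonant_dom.
- by apply/measurable_EFinP/measurable_funTS; exact: (measurable_kern1 beta cP k mf).
- by apply/measurable_EFinP/measurable_funTS; exact: (measurable_kern1 beta cP k mg).
move: nl o1 o2; apply: filterS3 => x x0 x1 x2 _.
by rewrite /kern !fg.
Qed.

End NullSets.

Global Instance ae_leb3_filter {R : realType} :
  Filter (nbhs (almost_everywhere (@leb3 R))).
Proof. exact: (@ae_filter_ringOfSetsType _ _ _ (@leb3 R)). Qed.

(** * The weighted norm and bounds valid almost everywhere *)

Section WeightedNorm.
Context {R : realType}.
Context (M : R).
Implicit Types (k l : vec3 R) (f g : vec3 R -> R).
Notation mu := (@lebesgue_measure R).

Lemma leb3_box (a1 b1 a2 b2 a3 b3 : R) : a1 < b1 -> a2 < b2 -> a3 < b3 ->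
  (leb3 ([set` `[a1, b1]] `*` [set` `[a2, b2]] `*` [set` `[a3, b3]]) =
  ((b1 - a1) * (b2 - a2) * (b3 - a3))%:E)%E.
Proof.
move=> ab1 ab2 ab3.
have m1 (a b : R) : a < b -> mu [set` `[a, b]] = (b - a)%:E.
  by move=> ab; rewrite lebesgue_measure_itv/= lte_fin ab EFinB.
transitivity (leb2 ([set` `[a1, b1]] `*` [set` `[a2, b2]]) * mu [set` `[a3, b3]])%E.
  by apply: product_measure1E => //; exact: measurableX.
rewrite m1// (EFinM (_ * _)); congr (_ * _)%E.
transitivity (mu [set` `[a1, b1]] * mu [set` `[a2, b2]])%E.
  exact: product_measure1E.
by rewrite !m1.
Qed.

(** [Lnorm] at infinity unfolds to the essential supremum only on a space of positive measure. *)
Lemma leb3T_gt0 : (0 < leb3 [set: vec3 R])%E.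
Proof.
apply: (@lt_le_trans _ _ (leb3 (([set` `[0, 1]] `*` [set` `[0, 1]]) `*` [set` `[0,
    1]] : set (vec3 R)))).
  by rewrite leb3_box// subr0 !mulr1 lte_fin.
by apply: le_measure => //; rewrite inE//; apply: measurableX => //; exact: measurableX.
Qed.

Lemma weightK k : bracket k `^ M * weight M k = 1.
Proof.
by rewrite /weight -powRD ?subrr ?powRr0// (gt_eqF (bracket_gt0 k)) implybT.
Qed.

Lemma le_weight f c k : (`|f k| <= c * weight M k) =
  (`|(bracket k `^ M * f k)%:E| <= c%:E)%E.
Proof.
rewrite /= lee_fin normrM (ger0_norm (powR_ge0 _ _)).
rewrite -[in RHS](mulr1 c) -(weightK k) mulrCA ler_pM2l//.
by rewrite powR_gt0// bracket_gt0.
Qed.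

Lemma wnorm_leP f c :
  reflect {ae leb3, forall k, `|f k| <= c * weight M k} (wnorm M f <= c%:E)%E.
Proof.
have -> : wnorm M f = ess_sup leb3 (fun k => `|(bracket k `^ M * f k)%:E|%E).
  by rewrite /wnorm unlock leb3T_gt0.
apply: (iffP idP) => h.
  have h' : {ae leb3, forall k, (`|(bracket k `^ M * f k)%:E| <= c%:E)%E}.
    by move: h => /ess_supP.
  by apply: filterS h' => k; rewrite le_weight.
have h' : {ae leb3, forall k, (`|(bracket k `^ M * f k)%:E| <= c%:E)%E}.
  by apply: filterS h => k; rewrite le_weight.
by apply/ess_supP.
Qed.

Lemma wnorm_ge0 f : (0 <= wnorm M f)%E.
Proof. exact: Lnorm_ge0. Qed.

Lemma wLinfty_bound f : wLinfty M f ->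
  exists2 A, 0 < A & {ae leb3, forall k, `|f k| <= A * weight M k}.
Proof.
move=> [mf foo]; have fin : wnorm M f \is a fin_num by rewrite ge0_fin_numE ?wnorm_ge0.
exists (fine (wnorm M f) + 1); first by rewrite ltr_wpDl// fine_ge0 ?wnorm_ge0.
by apply/wnorm_leP; rewrite EFinD fineK// leeDl.
Qed.

Lemma bounded_by_wLinfty A f : measurable_fun setT f -> bounded_by M A f ->
  wLinfty M f.
Proof.
move=> mf hf; split=> //; apply: (@le_lt_trans _ _ A%:E); last exact: ltry.
by apply/wnorm_leP; exact: aeW.
Qed.

Lemma measurable_weight : measurable_fun [set: vec3 R] (weight M).
Proof.
by apply: (measurableT_comp (measurable_powR _)); exact: measurable_bracket.
Qed.

(** Truncation towards [g] makes the bound by [D] hold everywhere and, when it already holds almost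
    everywhere, stays in the class of [f]. *)
Lemma measurable_truncate f g D : measurable_fun setT f -> measurable_fun setT g ->
  measurable_fun setT (fun k => if `|f k - g k| <= D * weight M k then f k else g k).
Proof.
move=> mf mg; apply: measurable_fun_ifT => //.
apply: measurable_fun_ler.
  by apply: measurableT_comp => //; exact: measurable_funB.
by apply: measurable_funM => //; exact: measurable_weight.
Qed.

Lemma ae_bounded_repr f A : 0 <= A -> measurable_fun setT f ->
  {ae leb3, forall k, `|f k| <= A * weight M k} ->
  exists f', [/\ measurable_fun setT f', bounded_by M A f' & f' = f %[ae leb3]].
Proof.
move=> A0 mf hf; exists (fun k => if `|f k - 0| <= A * weight M k then f k else 0); split.
- exact: measurable_truncate.
- by move=> k; case: ifP; rewrite ?subr0// normr0 mulr_ge0// weight_ge0.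
- by apply: filterS hf => k fk _; rewrite subr0 fk.
Qed.

Context (beta : R) (beta0 : 0 <= beta) (M4 : 4 <= M - 2 * beta).
Context (M2 : 2 < M - 2 * (2 * beta)).
Context (P : R -> R -> R -> R -> R) (cP : cubic_form P).

Lemma cubic_op_diff_ae f g A D : 0 <= A -> 0 <= D ->
  measurable_fun setT f -> measurable_fun setT g ->
  {ae leb3, forall k, `|f k| <= A * weight M k} ->
  {ae leb3, forall k, `|g k| <= A * weight M k} ->
  {ae leb3, forall k, `|f k - g k| <= D * weight M k} ->
  {ae leb3, forall k, `|cubic_op P beta f k - cubic_op P beta g k| <=
    3 * A ^+ 2 * D * op_const beta M k}.
Proof.
move=> A0 D0 mf mg hf hg hd.
have [f' [mf' bf' ff']] := ae_bounded_repr A0 mf hf.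
have [g' [mg' bg' gg']] := ae_bounded_repr A0 mg hg.
(* [g2] takes its values from [g'] and [f'], so enforcing the distance [D] from [f'] everywhere
   preserves the bound [A]. *)
pose g2 k := if `|g' k - f' k| <= D * weight M k then g' k else f' k.
have mg2 : measurable_fun setT g2 by exact: measurable_truncate.
have bg2 : bounded_by M A g2 by move=> k; rewrite /g2; case: ifP.
have bd : bounded_by M D (f' \- g2).
  move=> k; rewrite /g2/=; case: ifP; first by rewrite distrC.
  by rewrite subrr normr0 mulr_ge0// weight_ge0.
have g2g : g2 = g %[ae leb3].
  move: ff' gg' hd; apply: filterS3 => k fk gk dk _.
  by rewrite /g2 fk// gk// distrC dk.
have Qf := cubic_op_ae_eq beta cP mf' mf ff'.
have Qg := cubic_op_ae_eq beta cP mg2 mg g2g.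
move: Qf Qg; apply: filterS2 => k <- <-.
apply: cubic_op_diff_le => //; exact: integral_majorant_lty.
Qed.

End WeightedNorm.

(** The factor <k>^(4 beta) of [kern_const] meets the decay 1 / <k> of the integrated majorant: this
    is the origin of the exponent 4 beta - 1. The summand 1 in the witness makes it positive. *)
Lemma op_const_le {R : realType} (beta M : R) : 4 < M - 2 * (2 * beta) ->
  exists2 C : R, 0 < C & forall k,
  op_const beta M k <= C * (bracket k `^ (2 * (2 * beta) - 1) * weight M k).
Proof.
move=> q4; have [C0 C00 hC] := integral_majorant_decay q4.
exists (8^-1 * 4 * 2 `^ (M - 2 * beta) * C0 + 1).
  by rewrite ltr_wpDl// mulr_ge0// mulr_ge0 ?powR_ge0// mulr_ge0.
move=> k; have b0 := bracket_gt0 k.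
have J : \int[(leb3 \x leb2)%E]_(x in @resonant_dom R) majorant beta M k x <=
    C0 / bracket k.
  rewrite -lee_fin /Rintegral fineK; first exact: hC.
  rewrite ge0_fin_numE; first exact: le_lt_trans (hC k) (ltry _).
  by apply: integral_ge0 => x _; rewrite lee_fin majorant_ge0.
apply: (@le_trans _ _ (8^-1 * kern_const beta M k * (C0 / bracket k))).
  by apply: ler_wpM2l => //; rewrite mulr_ge0 ?kern_const_ge0.
have -> : bracket k `^ (2 * (2 * beta) - 1) = bracket k `^ (2 * (2 * beta)) / bracket k.
  by rewrite powRD ?powR_inv1 ?ltW// (gt_eqF b0) implybT.
rewrite /kern_const [leRHS]mulrDl [X in _ <= _ + X]mul1r.
set e := bracket k `^ _; set w := weight M k; set p := 2 `^ _.
have -> : 8^-1 * (4 * p * (e * w)) * (C0 / bracket k) = 8^-1 * 4 * p * C0 * (e / bracket k * w)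
    by ring.
by rewrite lerDl !mulr_ge0 ?powR_ge0 ?weight_ge0 ?invr_ge0// ltW.
Qed.

(** * Existence *)

Section TimeIntegral.
Context {R : realType}.
Notation mu := (@lebesgue_measure R).

(** The booleans select the endpoints: [true false] gives [a, b] and [false false] gives ]a, b], the
    interval left by a difference of two integrals from 0. *)
Lemma bounded_integrable_itv (h : R -> R) (a b c : R) (x y : bool) : a <= b ->
  measurable_fun setT h -> (forall s, s \in `[a, b] -> `|h s| <= c) ->
  mu.-integrable [set` Interval (BSide x a) (BSide y b)] (EFin \o h) /\
  `|\int[mu]_(s in [set` Interval (BSide x a) (BSide y b)]) h s| <= c * (b - a).
Proof.
move=> ab mh hc; set I := [set` _].
have subI s : I s -> s \in `[a, b].
  rewrite /I/= !itv_boundlr => /andP[h1 h2]; apply/andP; split.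
    by apply: le_trans h1; case: (x); rewrite bnd_simp.
  by apply: le_trans h2 _; case: (y); rewrite bnd_simp.
have muI : mu I = (b - a)%:E.
  rewrite lebesgue_measure_itv/= lte_fin; case: ltP => // ba.
  by have -> : b - a = 0 by lra.
have muIoo : (mu I < +oo)%E by rewrite muI ltry.
have ih : mu.-integrable I (EFin \o h).
  apply: measurable_bounded_integrable.
  - exact: measurable_itv.
  - exact: muIoo.
  - exact: measurable_funTS.
  - exists c; split; first exact: num_real.
    by move=> r cr s /subI/hc h1; apply: le_trans h1 _; exact: ltW.
split=> //.
apply: le_trans (le_normr_Rintegral _ ih) _; first exact: measurable_itv.
apply: (@le_trans _ _ (\int[mu]_(s in I) cst c s)).
  apply: le_Rintegral.
  - exact: measurable_itv.
  - exact: (integrable_norm ih).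
  - apply: (@measurable_bounded_integrable _ _ _ mu (cst c)).
    + exact: measurable_itv.
    + exact: muIoo.
    + exact: measurable_cst.
    + exists `|c|; split; first exact: num_real.
      by move=> r cr s _; apply: ltW.
  - by move=> s /subI/hc.
rewrite Rintegral_cst; last exact: measurable_itv.
by rewrite (_ : fine _ = b - a)// -[RHS]/(fine (b - a)%:E) -muI.
Qed.

Lemma Rintegral_cutoff (h : R -> R) (t T : R) : t \in `[0, T] ->
  \int[mu]_(s in `[0, T]) (if s <= t then h s else 0) = \int[mu]_(s in `[0, t]) h s.
Proof.
rewrite in_itv/= => /andP[t0 tT].
rewrite [LHS]Rintegral_mkcond [RHS]Rintegral_mkcond; apply: eq_Rintegral => s _.
rewrite !patchE !mem_setE !in_itv/=; case: (leP s t) => st; last by rewrite andbF if_same.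
by rewrite (le_trans st tT).
Qed.

Lemma geometric_cauchy (u : nat -> R) (c : R) : 0 <= c ->
  (forall n, `|u n.+1 - u n| <= c * 2^-1 ^+ n) ->
  exists l, u n @[n --> \oo] --> l /\ forall n, `|l - u n| <= 2 * c * 2^-1 ^+ n.
Proof.
move=> c0 hu.
have d n m : `|u (n + m)%N - u n| <= 2 * c * (2^-1 ^+ n - 2^-1 ^+ (n + m)).
  elim: m => [|m IHm]; first by rewrite addn0 !subrr normr0 mulr0.
  rewrite addnS -(subrKA (u (n + m)%N)) (le_trans (ler_normD _ _))//.
  apply: le_trans (lerD (hu _) IHm) _; rewrite exprS; lra.
have g0 n : 0 <= 2^-1 ^+ n :> R by rewrite exprn_ge0// invr_ge0.
have d' n m : (n <= m)%N -> `|u m - u n| <= 2 * c * 2^-1 ^+ n.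
  move=> /subnKC <-; apply: le_trans (d _ _) _.
  by rewrite ler_wpM2l ?mulr_ge0// gerBl.
have g_cvg : 2 * c * 2^-1 ^+ n @[n --> \oo] --> (0 : R).
  rewrite -(mulr0 (2 * c)); apply: cvgM; first exact: cvg_cst.
  by apply: cvg_expr; rewrite ger0_norm ?invr_ge0// invf_lt1// ltr1n.
have cu : cvgn u.
  apply/cauchy_cvgP/cauchy_exP => e e0.
  have /cvgr0Pnorm_lt/(_ e e0)[n _ hn] := g_cvg.
  exists (u n); exists n => // m /= nm; rewrite /ball/= distrC.
  apply: le_lt_trans (d' _ _ nm) _; apply: le_lt_trans (hn n (leqnn n)).
  exact: ler_norm.
exists (limn u); split => // n.
have : `|u m - u n| @[m --> \oo] --> `|limn u - u n|.
  by apply: cvg_norm; apply: cvgB => //; exact: cvg_cst.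
move=> h; rewrite -(cvg_lim _ h)//; apply: limr_le; first by apply/cvg_ex; exists `|limn u - u n|.
by exists n => // m /= nm; exact: d'.
Qed.

End TimeIntegral.

Section Existence.
Context {R : realType} (beta M : R) (beta0 : 0 <= beta).
Context (M4 : 4 <= M - 2 * beta) (M2 : 2 < M - 2 * (2 * beta)).
Context (P : R -> R -> R -> R -> R) (cP : cubic_form P).
Context (C : R) (C0 : 0 < C).
Hypothesis op_C : forall k, op_const beta M k <= C * weight M k.
Notation mu := (@lebesgue_measure R).
Notation Q := (cubic_op P beta).
Implicit Types (k : vec3 R) (F G : R * vec3 R -> R).

Lemma cubic_op_lip (f g : vec3 R -> R) A D k :
  measurable_fun setT f -> measurable_fun setT g ->
  bounded_by M A f -> bounded_by M A g -> bounded_by M D (f \- g) ->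
  `|Q f k - Q g k| <= 3 * A ^+ 2 * D * C * weight M k.
Proof.
move=> mf mg hf hg hd.
have lip := cubic_op_diff_le beta0 M4 cP (integral_majorant_lty k M2) mf mg hf hg hd.
apply: le_trans lip _; rewrite -[leRHS]mulrA; apply: ler_wpM2l; last exact: op_C.
by rewrite mulr_ge0 ?(bounded_by_ge0 hd)// mulr_ge0// sqr_ge0.
Qed.

Lemma cubic_op0 k : Q (fun=> 0) k = 0.
Proof.
rewrite /cubic_op; under eq_Rintegral do rewrite kern0//.
by rewrite /Rintegral integral0 /= !mulr0.
Qed.

Lemma cubic_op_bound (f : vec3 R -> R) A k :
  measurable_fun setT f -> bounded_by M A f ->
  `|Q f k| <= 3 * A ^+ 2 * A * C * weight M k.
Proof.
move=> mf hf; rewrite -[Q f k]subr0 -(cubic_op0 k); apply: cubic_op_lip => //.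
- exact: bounded_by0 (bounded_by_ge0 hf).
- by move=> l; rewrite /= subr0.
Qed.

Section Picard.
Context (g0 : vec3 R -> R) (mg0 : measurable_fun setT g0).
Context (A : R) (A0 : 0 < A) (hg0 : bounded_by M A g0).

(* The Lipschitz constant on the ball of radius [2 A] is [12 A^2 C], so this
   time makes the Picard map a contraction of ratio 1/2. *)
Let T := (24 * A ^+ 2 * C)^-1.

Let T_gt0 : 0 < T.
Proof. by rewrite invr_gt0 !mulr_gt0. Qed.

(** The domain of integration is fixed and the time enters through a cutoff, so that joint
    measurability follows from [measurable_Rintegral_param]; [Rintegral_cutoff] recovers the
    integral over [0, t]. *)
Definition picard F (z : R * vec3 R) : R :=
  g0 z.2 + \int[mu]_(s in `[0, T])
    (if s <= z.1 then Q (fun l => F (s, l)) z.2 else 0).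

Lemma measurable_picard F : measurable_fun setT F ->
  measurable_fun setT (picard F).
Proof.
move=> mF; apply: measurable_funD.
  exact: (measurableT_comp mg0 (@measurable_snd _ _ R (vec3 R))).
have m1 := @measurable_fst _ _ (R * vec3 R)%type R.
have m2 := @measurable_snd _ _ (R * vec3 R)%type R.
have mz1 := measurableT_comp (@measurable_fst _ _ R (vec3 R)) m1.
have mz2 := measurableT_comp (@measurable_snd _ _ R (vec3 R)) m1.
have mFq : measurable_fun setT (fun q : R * vec3 R * R * vec3 R => F (q.1.2, q.2)).
  apply: (measurableT_comp mF); apply: measurable_fun_pair.
    exact: (measurableT_comp m2 (@measurable_fst _ _ (R * vec3 R * R)%type (vec3 R))).
  exact: (@measurable_snd _ _ (R * vec3 R * R)%type (vec3 R)).
have mq : measurable_fun setT (fun y : R * vec3 R * R =>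
    if y.2 <= y.1.1 then Q (fun l => F (y.2, l)) y.1.2 else 0).
  apply: measurable_fun_ifT => //; first exact: measurable_fun_ler.
  exact: (measurable_cubic_op beta cP mFq mz2).
exact: (measurable_Rintegral_param mu (measurable_itv `[0, T]) mq).
Qed.

Let measurable_slice F (s : R) : measurable_fun setT F ->
  measurable_fun setT (fun l => F (s, l)).
Proof. by move=> mF; exact: measurable_fun_pair2. Qed.

Lemma measurable_op_slice F k : measurable_fun setT F ->
  measurable_fun setT (fun s : R => Q (fun l => F (s, l)) k).
Proof. by move=> mF; exact: measurable_cubic_op. Qed.

Let mcut F k (t : R) : measurable_fun setT F ->
  measurable_fun setT (fun s : R => if s <= t then Q (fun l => F (s, l)) k else 0).
Proof.
move=> mF; apply: measurable_fun_ifT => //; first exact: measurable_fun_ler.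
exact: measurable_op_slice.
Qed.

Lemma picard_lip F G B D z : measurable_fun setT F -> measurable_fun setT G ->
  (forall s, bounded_by M B (fun l => F (s, l))) ->
  (forall s, bounded_by M B (fun l => G (s, l))) ->
  (forall s, bounded_by M D (fun l => F (s, l) - G (s, l))) ->
  `|picard F z - picard G z| <= T * (3 * B ^+ 2 * D * C) * weight M z.2.
Proof.
move=> mF mG hF hG hD.
have itv_bd H : measurable_fun setT H -> (forall s, bounded_by M B (fun l => H (s, l))) ->
    mu.-integrable `[0, T] (EFin \o (fun s : R => if s <= z.1 then Q (fun l => H (s, l))
        z.2 else 0)).
  move=> mH hH; apply: (@bounded_integrable_itv _ _ 0 T (3 * B ^+ 2 * B * C * weight M z.2)
      true false _ _ _).1.
  - exact: ltW.
  - exact: mcut.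
  move=> s _; case: ifP => _; first exact: (cubic_op_bound _ (measurable_slice _ mH)).
  by apply: le_trans (cubic_op_bound z.2 (measurable_slice 0 mH) (hH 0)); rewrite normr0.
rewrite /picard opprD addrACA subrr add0r -RintegralB//; last 2 first.
- exact: itv_bd.
- exact: itv_bd.
pose d (s : R) := (if s <= z.1 then Q (fun l => F (s, l)) z.2 else 0) -
  (if s <= z.1 then Q (fun l => G (s, l)) z.2 else 0).
have md : measurable_fun setT d by exact: measurable_funB (mcut _ _ mF) (mcut _ _ mG).
have hd s : s \in `[0, T] -> `|d s| <= 3 * B ^+ 2 * D * C * weight M z.2.
  move=> _; rewrite /d.
  have hl := cubic_op_lip z.2 (measurable_slice s mF) (measurable_slice s mG) (hF s) (hG s) (hD s).
  by case: ifP => _ //; rewrite subrr normr0; exact: le_trans hl.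
have [_] := bounded_integrable_itv true false (ltW T_gt0) md hd.
by rewrite subr0 [leRHS]mulrC [leRHS]mulrA.
Qed.

Fixpoint picard_iter n : R * vec3 R -> R :=
  if n is m.+1 then picard (picard_iter m) else fun z => g0 z.2.

Lemma measurable_picard_iter n : measurable_fun setT (picard_iter n).
Proof.
elim: n => [|n IHn]; last exact: measurable_picard.
exact: (measurableT_comp mg0 (@measurable_snd _ _ R (vec3 R))).
Qed.

(** [Q] vanishes at 0, so [picard_lip] against the zero function, with amplitude and difference 2 A,
    bounds the displacement from [g0] by T * 24 A^3 C = A. *)
Lemma picard_in_ball F z : measurable_fun setT F ->
  (forall s, bounded_by M (2 * A) (fun l => F (s, l))) ->
  `|picard F z - g0 z.2| <= A * weight M z.2.
Proof.
move=> mF hF.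
have A2 : 0 <= 2 * A by rewrite mulr_ge0// ltW.
have h0 (s : R) : bounded_by M (2 * A) (fun l : vec3 R => (fun _ : R * vec3 R => 0) (s, l)).
  exact: bounded_by0.
have hd (s : R) : bounded_by M (2 * A) (fun l : vec3 R => F (s, l) - (fun _ : R * vec3 R => 0)
    (s, l)).
  by move=> l; rewrite subr0; exact: hF.
have := picard_lip z mF (measurable_cst (0 : R)) hF h0 hd.
have -> : picard (cst 0) z = g0 z.2.
  rewrite /picard (_ : Rintegral _ _ _ = 0) ?addr0//.
  rewrite /Rintegral integral0_eq// => s _.
  by case: ifP => // _; rewrite [cubic_op _ _ _ _]cubic_op0.
have -> // : T * (3 * (2 * A) ^+ 2 * (2 * A) * C) = A.
by rewrite /T; field; rewrite !gt_eqF.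
Qed.

Lemma picard_iter_bound n s : bounded_by M (2 * A) (fun l => picard_iter n (s, l)).
Proof.
elim: n s => [|n IHn] s l /=.
  by apply: le_trans (hg0 l) _; rewrite ler_wpM2r ?weight_ge0//; move: A0; lra.
rewrite -(subrK (g0 l) (picard _ _)) (le_trans (ler_normD _ _))//.
apply: le_trans (lerD (picard_in_ball (s, l) (measurable_picard_iter n) IHn) (hg0 l)) _.
by rewrite /=; lra.
Qed.

Lemma picard_iter_diff n z :
  `|picard_iter n.+1 z - picard_iter n z| <= A * weight M z.2 * 2^-1 ^+ n.
Proof.
elim: n z => [|n IHn] z.
  rewrite expr0 mulr1.
  exact: (picard_in_ball z (measurable_picard_iter 0) (picard_iter_bound 0)).
have hd (s : R) : bounded_by M (A * 2^-1 ^+ n) (fun l => picard_iter n.+1 (s, l)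
    - picard_iter n (s, l)).
  by move=> l; rewrite mulrAC; exact: (IHn (s, l)).
have := picard_lip z (measurable_picard_iter n.+1) (measurable_picard_iter n)
  (picard_iter_bound n.+1) (picard_iter_bound n) hd.
have -> : T * (3 * (2 * A) ^+ 2 * (A * 2^-1 ^+ n) * C) = A * 2^-1 ^+ n.+1.
  by rewrite (exprS _ n) /T; field; rewrite !gt_eqF.
by rewrite mulrAC.
Qed.

(** The iterates converge at every point, at a geometric rate relative to the weight. The defect |F
    - picard F| is at most |F - F_(n+1)| + |picard F_n - picard F|, which tends to 0. *)
Lemma picard_fixpoint : exists F, [/\ measurable_fun setT F,
  forall s, bounded_by M (2 * A) (fun l => F (s, l)) &
  forall z, F z = picard F z].
Proof.
have Aw z : 0 <= A * weight M (z : R * vec3 R).2 by rewrite mulr_ge0 ?weight_ge0// ltW.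
have lim z := geometric_cauchy (Aw z) (picard_iter_diff ^~ z).
pose F z := sval (cid (lim z)).
have FE z : picard_iter n z @[n --> \oo] --> F z /\
    forall n, `|F z - picard_iter n z| <= 2 * (A * weight M z.2) * 2^-1 ^+ n.
  exact: (svalP (cid (lim z))).
have mF : measurable_fun setT F.
  apply: (measurable_fun_cvg (h := picard_iter)); first exact: measurable_picard_iter.
  by move=> z _; have [] := FE z.
have hF s : bounded_by M (2 * A) (fun l => F (s, l)).
  move=> l; have [cF _] := FE (s, l).
  have h : `|picard_iter n (s, l)| @[n --> \oo] --> `|F (s, l)| by exact: cvg_norm.
  rewrite -(cvg_lim _ h)//; apply: limr_le; first by apply/cvg_ex; exists `|F (s, l)|.
  by apply: nearW => n; exact: picard_iter_bound.
exists F; split => // z; apply/eqP; rewrite -subr_eq0 -normr_le0.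
have g_cvg : 4 * (A * weight M z.2) * 2^-1 ^+ n @[n --> \oo] --> (0 : R).
  rewrite -(mulr0 (4 * (A * weight M z.2))); apply: cvgM; first exact: cvg_cst.
  by apply: cvg_expr; rewrite ger0_norm ?invr_ge0// invf_lt1// ltr1n.
rewrite -(cvg_lim _ g_cvg)//; apply: limr_ge; first by apply/cvg_ex; exists 0.
apply: nearW => n.
have hd s : bounded_by M (2 * A * 2^-1 ^+ n) (fun l => F (s, l) - picard_iter n (s, l)).
  move=> l; have [_ /(_ n)] := FE (s, l).
  by rewrite (_ : 2 * (A * weight M l) * 2^-1 ^+ n = 2 * A * 2^-1 ^+ n * weight M l)//; ring.
have h1 := picard_lip z mF (measurable_picard_iter n) hF (picard_iter_bound n) hd.
have [_ /(_ n.+1) h2] := FE z.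
rewrite -(subrKA (picard_iter n.+1 z)) (le_trans (ler_normD _ _))//.
rewrite distrC in h1; apply: le_trans (lerD h2 h1) _.
have -> : T * (3 * (2 * A) ^+ 2 * (2 * A * 2^-1 ^+ n) * C) = A * 2^-1 ^+ n.
  by rewrite /T; field; rewrite !gt_eqF.
rewrite (exprS _ n); have := Aw z; have : 0 <= 2^-1 ^+ n :> R by rewrite exprn_ge0// invr_ge0.
move: (2^-1 ^+ n) (weight M z.2) => p w p0 a0.
have pa : 0 <= p * (A * w) by exact: mulr_ge0.
rewrite -subr_ge0 [leRHS](_ : _ = p * (A * w) + p * (A * w)); first exact: addr_ge0.
by field.
Qed.

(** The fixed point is both the curve and its own jointly measurable representative. Boundedness of
    [Q] along it makes the curve Lipschitz in time with constant [L]. *)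
Lemma picard_strong_solution (f0 : vec3 R -> R) : f0 = g0 %[ae leb3] ->
  exists u, strong_solution Q M T f0 u.
Proof.
move=> f0g0; have [F [mF hF FE]] := picard_fixpoint.
pose L := 3 * (2 * A) ^+ 2 * (2 * A) * C.
have L0 : 0 <= L by rewrite !mulr_ge0 ?ltW.
have Qb s k : `|Q (fun l => F (s, l)) k| <= L * weight M k.
  exact: (cubic_op_bound k (measurable_slice s mF) (hF s)).
have mQ k := measurable_op_slice k mF.
have FE' t k : t \in `[0, T] ->
    F (t, k) = g0 k + \int[mu]_(s in `[0, t]) Q (fun l => F (s, l)) k.
  by move=> tT; rewrite FE /picard Rintegral_cutoff.
have iQ t k : 0 <= t -> mu.-integrable `[0, t] (EFin \o (fun s => Q (fun l => F (s, l)) k)).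
  move=> t0; exact: (bounded_integrable_itv true false t0 (mQ k) (fun s _ => Qb s k)).1.
have lip s t k : s \in `[0, T] -> t \in `[0, T] -> s <= t ->
    `|F (t, k) - F (s, k)| <= L * (t - s) * weight M k.
  move=> sT tT st; rewrite !FE'// opprD addrACA subrr add0r.
  have s0 : 0 <= s by move: sT; rewrite in_itv/= => /andP[].
  have t0 : 0 <= t by exact: le_trans st.
  rewrite (@Rintegral_itvB _ _ (BLeft 0) (BRight t) s) ?bnd_simp//; last exact: iQ.
  have [_] := bounded_integrable_itv false false st (mQ k) (fun s _ => Qb s k).
  by rewrite mulrAC.
exists (fun t k => F (t, k)); split; first split.
- by move=> t _; exact: bounded_by_wLinfty (measurable_slice t mF) (hF t).
- move=> t tT.
  have lip' s k : s \in `[0, T] -> `|F (s, k) - F (t, k)| <= L * `|s - t| * weight M k.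
    move=> sT; have [st|/ltW ts] := leP s t.
      by rewrite distrC (distrC s) (ger0_norm (_ : 0 <= t - s)) ?subr_ge0//; exact: lip.
    by rewrite (ger0_norm (_ : 0 <= s - t)) ?subr_ge0//; exact: lip.
  apply: (@squeeze_cvge _ _ _ _ (fun=> 0%E) _ (fun s => (L * `|s - t|)%:E)).
  + near=> s; rewrite wnorm_ge0/=; apply/wnorm_leP/aeW => k; apply: lip'.
    near: s; exact: withinT.
  + exact: cvg_cst.
  + apply: cvg_EFin; first exact: nearW.
    apply: cvg_within_filter.
    have h : L * `|s - t| @[s --> t] --> L * `|t - t|.
      apply: cvgM; first exact: cvg_cst.
      by apply: cvg_norm; apply: cvgB; [exact: cvg_id|exact: cvg_cst].
    by rewrite subrr normr0 mulr0 in h; exact: h.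
- exists (fun t k => F (t, k)); split.
  + apply: measurable_funTS.
    by rewrite (_ : (fun p => _) = F)//; apply/funext => -[].
  + by move=> t _; exact: aeW.
  + apply: aeW => k; apply: iQ; exact: ltW.
  + move=> t tT; apply: filterS f0g0 => k /(_ I) ->; exact: FE'.
Unshelve. all: by end_near. Qed.

End Picard.
End Existence.

Global Instance ae_lebesgue_filter {R : realType} :
  Filter (nbhs (almost_everywhere (@lebesgue_measure R))).
Proof. exact: (@ae_filter_ringOfSetsType _ _ _ (@lebesgue_measure R)). Qed.

(** * Exchanging exceptional sets of times and wave vectors *)

Section AlmostEverywhere.
Context {R : realType}.
Notation mu := (@lebesgue_measure R).
Implicit Types (k : vec3 R).

(** Replacing f by min(f, g) changes it on a null subset of [D] and yields an inequality valid
    everywhere. *)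
Lemma ae_le_Rintegral (f g : R -> R) (D : set R) : measurable D ->
  mu.-integrable D (EFin \o f) -> mu.-integrable D (EFin \o g) ->
  {ae mu, forall s, D s -> f s <= g s} ->
  \int[mu]_(s in D) f s <= \int[mu]_(s in D) g s.
Proof.
move=> mD intf intg fg.
have mf := measurable_int mu intf; have mg := measurable_int mu intg.
have -> : \int[mu]_(s in D) f s = \int[mu]_(s in D) Num.min (f s) (g s).
  rewrite /Rintegral; congr fine; apply: ae_eq_integral => //.
    by apply/measurable_EFinP; apply: measurable_minr; exact/measurable_EFinP.
  by apply: filterS fg => s fgs Ds; rewrite min_l// fgs.
apply: le_Rintegral => //; last by move=> s _; rewrite ge_min lexx orbT.
apply: (@eq_integrable _ _ _ mu D mD (fun s => mine (f s)%:E (g s)%:E)) => //.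
  by move=> s _; rewrite /= EFin_min.
apply: (@le_integrable _ _ _ mu D mD _ (fun s => (`|f s| + `|g s|)%:E)).
- by apply: measurable_mine.
- move=> s _; rewrite -EFin_min /= lee_fin [leRHS]ger0_norm ?addr_ge0//.
  by rewrite minEle; case: ifP => _; rewrite ?lerDl ?lerDr normr_ge0.
- have ig := integrable_norm intg; have jf := integrable_norm intf.
  have : mu.-integrable D ((EFin \o (Num.norm \o f)) \+ (EFin \o (Num.norm \o g)))%E.
    exact: integrableD.
  by apply: eq_integrable.
Qed.

(* Tonelli for the indicator of the exceptional set. *)
Lemma ae_swap (T : R) (h c : R * vec3 R -> R) :
  measurable_fun setT h -> measurable_fun setT c ->
  (forall s, s \in `[0, T] -> {ae leb3, forall k, h (s, k) <= c (s, k)}) ->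
  {ae leb3, forall k, {ae mu, forall s, s \in `[0, T] -> h (s, k) <= c (s, k)}}.
Proof.
move=> mh mc hc.
pose b (z : R * vec3 R) : bool := (z.1 \in `[0, T]) && (c z < h z).
have mb : measurable_fun setT b.
  apply: measurable_and; last exact: measurable_fun_ltr.
  rewrite (_ : (fun z => _) = (fun z : R * vec3 R => (0 <= z.1) && (z.1 <= T))); last first.
    by apply/funext => z; rewrite in_itv.
  have m1 := @measurable_fst _ _ R (vec3 R).
  by apply: measurable_and; apply: measurable_fun_ler.
pose phi (z : R * vec3 R) : \bar R := (if b z then 1 else 0)%:E.
have mphi : measurable_fun setT phi.
  by apply/measurable_EFinP; exact: measurable_fun_ifT.
have phi0 z : (0 <= phi z)%E by rewrite lee_fin; case: ifP.
pose G k := (\int[mu]_s phi (s, k))%E.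
have mG : measurable_fun setT G.
  exact: (@measurable_fun_fubini_tonelli_G _ _ _ _ R mu phi mphi phi0).
have IG : (\int[leb3]_k G k = 0)%E.
  transitivity (\int[mu]_s \int[leb3]_k phi (s, k))%E.
    exact: (esym (@fubini_tonelli _ _ _ _ R mu (@leb3 R) phi mphi phi0)).
  apply: integral0_eq => s _.
  have mphis : measurable_fun setT (fun k => phi (s, k)) by exact: measurable_fun_pair2.
  rewrite -[RHS](@integral0 _ _ _ leb3 setT); apply: ae_eq_integral => //.
  have [sT|sT] := boolP (s \in `[0, T]).
    have hs := hc s sT; apply: filterS hs => k hk _.
    by rewrite /phi /b /= ltNge hk andbF.
  by apply: aeW => k _; rewrite /phi /b /= (negbTE sT).
have H : ae_eq leb3 setT G (cst 0%E).
  apply/(ae_eq_integral_abs leb3 measurableT mG).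
  rewrite -[RHS]IG; apply: eq_integral => k _; apply: gee0_abs.
  by apply: integral_ge0.
apply: filterS H => k /(_ I) Gk.
have mphik : measurable_fun setT (fun s => phi (s, k)) by exact: measurable_fun_pair1.
have : ae_eq mu setT (fun s => phi (s, k)) (cst 0%E).
  apply/(ae_eq_integral_abs mu measurableT mphik).
  by rewrite -[RHS]Gk; apply: eq_integral => s _; exact: gee0_abs.
apply: filterS => s /(_ I) + sT; rewrite /phi /b /= sT/=.
by case: ltP => // _ [] /eqP; rewrite oner_eq0.
Qed.

End AlmostEverywhere.

(** * Continuous curves and their representatives *)

Section Curves.
Context {R : realType} (M : R).
Notation mu := (@lebesgue_measure R).
Implicit Types (k : vec3 R) (u : R -> vec3 R -> R).

Lemma cvge0_near (T : Type) (F : set_system T) {FF : Filter F} (f : T -> \bar R) (e : R) :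
  0 < e -> f x @[x --> F] --> 0%E -> \forall x \near F, (f x < e%:E)%E.
Proof.
move=> e0 cf; apply: (cf [set x | (x < e%:E)%E]).
have h : nbhs (0 : R) (fun x => (x%:E < e%:E)%E).
  by near=> x; rewrite lte_fin; near: x; exact: lt_nbhsl.
exact: h.
Unshelve. all: by end_near. Qed.

Lemma continuous_curve_near (T : R) u (t : R) (e : R) : continuous_curve M T u ->
  0 < e -> t \in `[0, T] ->
  \forall s \near t, s \in `[0, T] ->
    {ae leb3, forall k, `|u s k - u t k| <= e * weight M k}.
Proof.
move=> [_ cu] e0 tT.
have := cvge0_near e0 (cu t tT); rewrite near_withinE => H.
near=> s => sT; apply/wnorm_leP/ltW.
by move: sT; near: s; exact: H.
Unshelve. all: by end_near. Qed.

(** Near each time the bound at that time plus 1 works by continuity; compactness of [0, T] makes it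
    uniform. *)
Lemma continuous_curve_bounded (T : R) u : continuous_curve M T u ->
  exists2 A : R, 0 < A & forall t, t \in `[0, T] ->
    {ae leb3, forall k, `|u t k| <= A * weight M k}.
Proof.
move=> cu.
have := compact_near_coveringP `[0, T]%classic.
move=> [+ _] => /(_ (@segment_compact _ _ _)) cov.
have {cov} := cov nat \oo (fun n s => s \in `[0, T] -> {ae leb3, forall k, `|u s k| <=
    n%:R * weight M k}) _.
have H (t : R) : `[0, T]%classic t -> \forall s \near t & n \near \oo,
    s \in `[0, T] -> {ae leb3, forall k, `|u s k| <= n%:R * weight M k}.
  move=> tT; have [A A0 hA] := wLinfty_bound (cu.1 t tT).
  have nr := continuous_curve_near cu ltr01 tT.
  have nn : \forall n \near \oo, A + 1 <= n%:R :> R by exact: nbhs_infty_ger.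
  near=> s n.
  have hs : s \in `[0, T] -> {ae leb3, forall k, `|u s k - u t k| <= 1 * weight M k}.
    by near: s; exact: nr.
  move=> /hs h1.
  have h2 : A + 1 <= n%:R by near: n.
  move: hA h1; apply: filterS2 => k hk h1.
  rewrite -(subrK (u t k) (u s k)) (le_trans (ler_normD _ _))//.
  apply: le_trans (lerD h1 hk) _; rewrite -mulrDl addrC.
  by rewrite ler_wpM2r// weight_ge0.
move=> /(_ _ H)[N _ hN].
exists (N.+1%:R) => // t tT; exact: (hN N.+1 (leqnSn _) t tT tT).
Unshelve. all: by end_near. Qed.

(** Extension by 0 outside [0, T] makes the representative measurable on the whole product, as
    [ae_swap] and [measurable_cubic_op] ask. *)
Lemma integral_equation_repr Q (T : R) f0 u : integral_equation Q T f0 u ->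
  exists F : R * vec3 R -> R, [/\ measurable_fun setT F,
    forall t, t \in `[0, T] -> (fun k => F (t, k)) = u t %[ae leb3],
    {ae leb3, forall k, mu.-integrable `[0, T] (EFin \o (fun s => Q (fun l => F (s, l)) k))} &
    forall t, t \in `[0, T] -> {ae leb3, forall k,
      u t k = f0 k + \int[mu]_(s in `[0, t]) Q (fun l => F (s, l)) k}].
Proof.
move=> [F [mF Fu iF eF]].
pose F' (z : R * vec3 R) := if z.1 \in `[0, T] then F z.1 z.2 else 0.
have F'E s : s \in `[0, T] -> (fun l => F' (s, l)) = F s.
  by move=> sT; apply/funext => l; rewrite /F'/= sT.
exists F'; split.
- have mD : measurable (`[0, T] `*` [set: vec3 R]) by exact: measurableX.
  rewrite (_ : F' = (fun p : R * vec3 R => F p.1 p.2) \_ (`[0, T] `*` [set: vec3 R])).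
    exact/(measurable_restrictT _ mD).
  apply/funext => z; rewrite /F' patchE; congr (if _ then _ else _).
  by rewrite in_setX in_setT andbT mem_setE.
- by move=> t tT; have := Fu t tT; rewrite -(F'E t tT).
- apply: filterS iF => k; apply: eq_integrable => //.
  by move=> s; rewrite inE/= => sT; rewrite F'E.
- move=> t tT; apply: filterS (eF t tT) => k ->; congr (_ + _).
  apply: eq_Rintegral => s; rewrite inE/= in_itv/= => /andP[s0 st].
  rewrite F'E// in_itv/= s0 (le_trans st)//.
  by move: tT; rewrite in_itv/= => /andP[].
Qed.

End Curves.

(** * Uniqueness *)

Section Uniqueness.
Context {R : realType} (beta M : R) (beta0 : 0 <= beta).
Context (M4 : 4 <= M - 2 * beta) (M2 : 2 < M - 2 * (2 * beta)).
Context (P : R -> R -> R -> R -> R) (cP : cubic_form P).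
Context (C : R) (C0 : 0 < C).
Hypothesis op_C : forall k, op_const beta M k <= C * weight M k.
Notation mu := (@lebesgue_measure R).
Notation Q := (cubic_op P beta).
Implicit Types (k : vec3 R).

Lemma integral_expR_le (l t : R) : 0 < l -> 0 <= t ->
  \int[mu]_(s in `[0, t]) expR (l * s) <= expR (l * t) / l.
Proof.
move=> l0; rewrite le_eqVlt => /predU1P[<-|t0].
  by rewrite set_itv1 Rintegral_set1 divr_ge0 ?expR_ge0// ltW.
have dF (s : R) : is_derive s 1 (fun s => l^-1 * expR (l * s)) (expR (l * s)).
  have d1 : is_derive s 1 (l *: id : R -> R) (l *: 1) by exact: is_deriveZ.
  have d2 := @is_derive1_comp _ (@expR R) (l *: id : R -> R) s _ _ (is_derive_expR _) d1.
  have d3 := is_deriveZ l^-1 d2.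
  apply: is_derive_eq d3 _.
  by rewrite /GRing.scale/=; field; rewrite gt_eqF.
have ce : continuous (fun s => expR (l * s)).
  move=> s; apply: (@continuous_comp _ _ _ ( *%R l) (@expR R)).
    exact: mulrl_continuous.
  exact: continuous_expR.
rewrite /Rintegral (integral_is_derive t0 dF ce)/=.
by rewrite mulr0 expR0 mulr1 [leRHS]mulrC lerBlDr lerDl invr_ge0 ltW.
Qed.

(* Gronwall by iteration: the difference is bounded by
   [2 A 2^-n exp (2 L t)] for all [n]. *)
Lemma strong_solution_unique (T : R) f0 u v : strong_solution Q M T f0 u ->
  strong_solution Q M T f0 v ->
  forall t, t \in `[0, T] -> u t = v t %[ae leb3].
Proof.
move=> [cu /integral_equation_repr[F [mF Fu iF eF]]].
move=> [cv /integral_equation_repr[G [mG Gv iG eG]]].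
have [Au Au0 hu] := continuous_curve_bounded cu.
have [Av Av0 hv] := continuous_curve_bounded cv.
pose A := Num.max Au Av.
have A0 : 0 < A by rewrite lt_max Au0.
pose L := 3 * A ^+ 2 * C.
have L0 : 0 < L by rewrite !mulr_gt0.
(* With the rate 2 L, the integral of L D_n over [0, t] is at most half of D_n at t, which is
   D_(n+1). *)
pose D n (t : R) := 2 * A * 2^-1 ^+ n * expR (2 * L * t).
have D0 n t : 0 <= D n t by rewrite !mulr_ge0 ?expR_ge0 ?exprn_ge0 ?(ltW A0).
have wM B k : B <= A -> B * weight M k <= A * weight M k.
  by move=> BA; rewrite ler_wpM2r// weight_ge0.
have huA t : t \in `[0, T] -> {ae leb3, forall k, `|u t k| <= A * weight M k}.
  move=> /hu h; apply: filterS h => k h; apply: le_trans h (wM _ _ _).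
  by rewrite le_max lexx.
have hvA t : t \in `[0, T] -> {ae leb3, forall k, `|v t k| <= A * weight M k}.
  move=> /hv h; apply: filterS h => k h; apply: le_trans h (wM _ _ _).
  by rewrite le_max lexx orbT.
have mslice (H : R * vec3 R -> R) s : measurable_fun setT H -> measurable_fun setT (fun l =>
    H (s, l)).
  by move=> mH; exact: measurable_fun_pair2.
have mop (H : R * vec3 R -> R) : measurable_fun setT H ->
    measurable_fun setT (fun z : R * vec3 R => Q (fun l => H (z.1, l)) z.2).
  move=> mH; apply: (measurable_cubic_op beta cP (T := (R * vec3 R)%type) (F := fun q =>
      H (q.1.1, q.2))).
    apply: (measurableT_comp mH); apply: measurable_fun_pair.
      exact: (measurableT_comp (@measurable_fst _ _ R (vec3 R))
          (@measurable_fst _ _ (R * vec3 R)%type (vec3 R))).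
    exact: (@measurable_snd _ _ (R * vec3 R)%type (vec3 R)).
  exact: (@measurable_snd _ _ R (vec3 R)).
have key n t : t \in `[0, T] -> {ae leb3, forall k, `|u t k - v t k| <= D n t * weight M k}.
  elim: n t => [|n IHn] t tT.
    move: (huA t tT) (hvA t tT); apply: filterS2 => k h1 h2.
    apply: le_trans (ler_normB _ _) _; apply: le_trans (lerD h1 h2) _.
    have e1 : 1 <= expR (2 * L * t).
      have t0 : 0 <= t by move: tT; rewrite in_itv/= => /andP[].
      apply: le_trans (expR_ge1Dx _); rewrite lerDl; apply: mulr_ge0 => //.
      by rewrite mulr_ge0// ltW.
    have : 0 <= A * weight M k * (expR (2 * L * t) - 1).
      by rewrite !mulr_ge0 ?(ltW A0) ?weight_ge0// subr_ge0.
    by rewrite /D expr0; lra.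
  have slice s : s \in `[0, T] -> {ae leb3, forall k,
      `|Q (fun l => F (s, l)) k - Q (fun l => G (s, l)) k| <= L * D n s * weight M k}.
    move=> sT.
    have hF : {ae leb3, forall k, `|F (s, k)| <= A * weight M k}.
      by move: (Fu s sT) (huA s sT); apply: filterS2 => k /(_ I) ->.
    have hG : {ae leb3, forall k, `|G (s, k)| <= A * weight M k}.
      by move: (Gv s sT) (hvA s sT); apply: filterS2 => k /(_ I) ->.
    have hd : {ae leb3, forall k, `|F (s, k) - G (s, k)| <= D n s * weight M k}.
      by move: (Fu s sT) (Gv s sT) (IHn s sT); apply: filterS3 => k /(_ I) -> /(_ I) ->.
    have h := cubic_op_diff_ae beta0 M4 M2 cP (ltW A0) (D0 n s) (mslice F s mF) (mslice G s mG)
        hF hG hd.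
    apply: filterS h => k h; apply: le_trans h _.
    rewrite /L (_ : 3 * A ^+ 2 * C * D n s * weight M k = 3 * A ^+ 2 * D n s * (C * weight M k));
        last by ring.
    by apply: ler_wpM2l (op_C k); rewrite mulr_ge0// mulr_ge0// sqr_ge0.
  have mh : measurable_fun setT (fun z : R * vec3 R =>
      `|Q (fun l => F (z.1, l)) z.2 - Q (fun l => G (z.1, l)) z.2|).
    by apply: measurableT_comp => //; apply: measurable_funB; exact: mop.
  have mE : measurable_fun setT (fun s : R => expR (2 * L * s)).
    by apply: measurableT_comp; [exact: measurable_expR|exact: measurable_funM].
  have mD : measurable_fun setT (fun s : R => L * D n s).
    by apply: measurable_funM => //; apply: measurable_funM.
  have mc : measurable_fun setT (fun z : R * vec3 R => L * D n z.1 * weight M z.2).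
    apply: measurable_funM.
      exact: (measurableT_comp mD (@measurable_fst _ _ R (vec3 R))).
    exact: (measurableT_comp (measurable_weight M) (@measurable_snd _ _ R (vec3 R))).
  (* [slice] fixes the time before discarding wave vectors; the integral at a given k needs the
     bound for almost all times. *)
  have sw := ae_swap mh mc slice.
  have [t0 tT'] : 0 <= t /\ t <= T by move: tT; rewrite in_itv/= => /andP[].
  have sub : `[0, t] `<=` `[0, T].
    by move=> s /=; rewrite !in_itv/= => /andP[-> /le_trans]; apply.
  have eE : {ae leb3, forall k, u t k - v t k =
      \int[mu]_(s in `[0, t]) Q (fun l => F (s, l)) k - \int[mu]_(s in `[0, t]) Q (fun l => G (s,
          l)) k}.
    by move: (eF t tT) (eG t tT); apply: filterS2 => k -> ->; rewrite opprD addrACA subrr add0r.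
  have iFG : {ae leb3, forall k, mu.-integrable `[0, T] (EFin \o (fun s => Q (fun l => F (s, l))
      k - Q (fun l => G (s, l)) k)) /\
     u t k - v t k = \int[mu]_(s in `[0, t]) (Q (fun l => F (s, l)) k - Q (fun l => G (s, l)) k)}.
    move: iF iG eE; apply: filterS3 => k ifk igk ->; split.
      have : mu.-integrable `[0, T] (fun s => ((EFin \o (fun s => Q (fun l => F (s, l)) k)) s -
          (EFin \o (fun s => Q (fun l => G (s, l)) k)) s)%E) by exact: integrableB.
      by apply: eq_integrable.
    rewrite -RintegralB//; first exact: integrableS ifk.
    exact: integrableS igk.
  move: sw iFG; apply: filterS2 => k swk [ik ->].
  have ikt : mu.-integrable `[0, t] (EFin \o (fun s => Q (fun l => F (s, l)) k - Q (fun l =>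
      G (s, l)) k)).
    exact: integrableS ik.
  apply: le_trans (le_normr_Rintegral _ ikt) _; first exact: measurable_itv.
  pose K := 2 * A * 2^-1 ^+ n * L * weight M k.
  have iK : mu.-integrable `[0, t] (EFin \o (fun s => expR (2 * L * s))).
    apply: (@bounded_integrable_itv _ _ 0 t (expR (2 * L * t)) true false t0 mE _).1 => s.
    rewrite in_itv/= => /andP[_ st]; rewrite ger0_norm ?expR_ge0// ler_expR.
    by apply: ler_wpM2l => //; rewrite mulr_ge0// ltW.
  apply: (@le_trans _ _ (\int[mu]_(s in `[0, t]) (K * expR (2 * L * s)))).
    apply: ae_le_Rintegral.
    - exact: measurable_itv.
    - exact: (integrable_norm ikt).
    - have : mu.-integrable `[0, t] (fun s => (K%:E * (EFin \o (fun s => expR (2 * L * s))) s)%E).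
        exact: integrableZl.
      by apply: eq_integrable.
    apply: filterS swk => s hs st; have := hs (sub s st).
    by rewrite /= (_ : L * D n s * weight M k = K * expR (2 * L * s))// /D /K; ring.
  rewrite RintegralZl//.
  have K0 : 0 <= K.
    apply: mulr_ge0; last exact: weight_ge0.
    apply: mulr_ge0; last exact: ltW.
    by apply: mulr_ge0; rewrite ?exprn_ge0 ?invr_ge0 ?mulr_ge0// ltW.
  apply: le_trans (ler_wpM2l K0 (integral_expR_le _ t0)) _; first by rewrite mulr_gt0.
  rewrite /K /D (exprS _ n) le_eqVlt; apply/orP; left; apply/eqP.
  by field; rewrite gt_eqF.
have kn t : t \in `[0, T] -> {ae leb3, forall k, forall n, `|u t k - v t k| <= D n t * weight M k}.
  by move=> tT; apply: ae_foralln => n; exact: key.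
move=> t tT; have h := kn t tT; apply: filterS h => k h _.
apply/eqP; rewrite -subr_eq0 -normr_le0.
have cD : D n t * weight M k @[n --> \oo] --> (0 : R).
  have -> : (fun n => D n t * weight M k) =
      (fun n => 2 * A * expR (2 * L * t) * weight M k * 2^-1 ^+ n).
    by apply/funext => n; rewrite /D; ring.
  rewrite -(mulr0 (2 * A * expR (2 * L * t) * weight M k)).
  apply: cvgM; first exact: cvg_cst.
  by apply: cvg_expr; rewrite ger0_norm ?invr_ge0// invf_lt1// ltr1n.
rewrite -(cvg_lim _ cD)//; apply: limr_ge; first by apply/cvg_ex; exists 0.
exact: nearW.
Qed.

End Uniqueness.

(** * Norm inflation *)

Section Cap.
Context {R : realType}.
Implicit Types (k l : vec3 R) (a : R * R).

Lemma sin_le (x : R) : 0 <= x -> sin x <= x.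
Proof.
rewrite le_eqVlt => /predU1P[<-|x0]; first by rewrite sin0.
have [|c _] := @MVT R (@sin R) (@cos R) _ _ x0 (fun z _ => is_derive_sin z).
  by apply: continuous_subspaceT; exact: continuous_sin.
by rewrite sin0 !subr0 => ->; rewrite ler_piMl ?cos_le1// ltW.
Qed.

(** The middle coordinate is nonpositive: these k lie outside the half space carrying the datum of
    the full equation. Boxes of positive measure with |k| arbitrarily large remain inside. *)
Definition far_region k : Prop := [/\ 20 <= k.1.1, -1 <= k.1.2 <= 0 & 0 <= k.2 <= 1].

(** The middle coordinate is so large that both outgoing vectors stay in the half space: the
    midpoint with a far k lies in [2, 3] there, and the displacement over the cap in [0, 1]. *)
Definition near_box : set (vec3 R) :=
  [set` `[1, 2]] `*` [set` `[5, 6]] `*` [set` `[0, 1]].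

(* Directions within O(1 / <k>) of the first coordinate axis, which is the
   direction of [k - l] up to that error for [far_region k] and [near_box l]. *)
Definition cap k : set (R * R) :=
  [set` `[pi / 2 - (bracket k)^-1, pi / 2]] `*` [set` `[0, (bracket k)^-1]].

Lemma far_bracket k : far_region k -> k.1.1 <= bracket k <= 2 * k.1.1.
Proof.
move=> [h1 /andP[h2 h3] /andP[h4 h5]].
have b0 := bracket_ge0 k; have bE := sqr_bracket k.
apply/andP; split; rewrite -(@ler_pXn2r _ 2) ?nnegrE// ?bE; nra.
Qed.

(** cos a.1 and sin a.2 are sines of angles at most 1 / <k>; the other two bounds follow because a
    sine or cosine in [0, 1] is at least its square. *)
Lemma cap_trig k a : far_region k -> cap k a ->
  [/\ 0 <= cos a.1 <= (bracket k)^-1, 0 <= sin a.2 <= (bracket k)^-1,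
      1 - (bracket k)^-1 ^+ 2 <= sin a.1 <= 1 &
      1 - (bracket k)^-1 ^+ 2 <= cos a.2 <= 1].
Proof.
move=> fk []; rewrite /= !in_itv/= => /andP[h1 h2] /andP[h3 h4].
have B1 : (bracket k)^-1 <= 1 by rewrite invf_le1 ?bracket_gt0 ?bracket_ge1.
have B0 : 0 <= (bracket k)^-1 by rewrite invr_ge0 bracket_ge0.
have pi1 := pihalf_ge1 R.
have c1 : 0 <= cos a.1 <= (bracket k)^-1.
  rewrite cos_ge0_pihalf ?h2 ?andbT; last by lra.
  rewrite -(subKr (pi / 2) a.1) -opprB cosN cosBpihalf.
  by apply: le_trans (sin_le _) _; lra.
have s2 : 0 <= sin a.2 <= (bracket k)^-1.
  rewrite sin_ge0_pi; last by lra.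
  by apply: le_trans (sin_le _) _.
have s1 : 0 <= sin a.1 by apply: sin_ge0_pi; lra.
have c2 : 0 <= cos a.2 by apply: cos_ge0_pihalf; lra.
have t1 := cos2Dsin2 a.1; have t2 := cos2Dsin2 a.2.
move/andP: (c1) => [? ?]; move/andP: (s2) => [? ?].
split => //; apply/andP; split; nra.
Qed.

Lemma coord_le_enorm k : k.1.1 <= enorm k /\ k.1.2 <= enorm k.
Proof.
have e0 := enorm_ge0 k; have eE := sqr_enorm k.
have h (x : R) : x ^+ 2 <= enorm k ^+ 2 -> x <= enorm k.
  by move=> xe; have [x0|x0] := leP 0 x; [rewrite -(@ler_pXn2r _ 2) ?nnegrE|lra].
have := sqr_ge0 k.1.1; have := sqr_ge0 k.1.2; have := sqr_ge0 k.2.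
by move=> h1 h2 h3; split; apply: h; rewrite eE; lra.
Qed.

Lemma bracket_le k (b : R) : 0 <= b -> bracket k ^+ 2 <= b ^+ 2 -> bracket k <= b.
Proof. by move=> b0; rewrite ler_pXn2r ?nnegrE ?bracket_ge0. Qed.

Let sq_le (b x c : R) : - c <= x <= b -> c <= b -> x ^+ 2 <= b ^+ 2.
Proof. by move=> /andP[h1 h2] cb; nra. Qed.

(** The large first component goes to [post1], while [post2] stays bounded. The bracket of k3 is
    read off energy conservation, that of k4 from its coordinates, each at most 3 in absolute
    value. *)
Lemma cap_post k l a : far_region k -> near_box l -> cap k a ->
  forall k3 k4, k3 = post1 k l (sphere_pt a) -> k4 = post2 k l (sphere_pt a) ->
  [/\ [/\ 0 < l.1.2, 0 < k3.1.2 & 0 < k4.1.2],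
      [/\ bracket l <= 10, bracket k3 <= 2 * bracket k & bracket k4 <= 10],
      [/\ bracket k / 4 <= enorm (k - l), 1 <= enorm l,
          bracket k / 4 <= enorm k3 & 1 <= enorm k4] &
      2^-1 <= sin a.1].
Proof.
move=> fk nb ca k3 k4 hk3 hk4; move: nb => [] [].
rewrite /= !in_itv/= => /andP[x1 x2] /andP[y1 y2] /andP[z1 z2].
have /andP[BL1 BL2] := far_bracket fk.
have [/andP[ca0 ca1] /andP[sb0 sb1] /andP[sa0 sa1] /andP[cb0 cb1]] := cap_trig fk ca.
have energy : bracket k3 ^+ 2 + bracket k4 ^+ 2 = bracket k ^+ 2 + bracket l ^+ 2.
  by rewrite hk3 hk4; exact: post_energy.
have [X20 /andP[Y1 Y2] /andP[Z1 Z2]] := fk.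
have B0 := bracket_gt0 k; have iB : (bracket k)^-1 * bracket k = 1 by rewrite mulVf ?gt_eqF.
have i0 : 0 <= (bracket k)^-1 by rewrite invr_ge0 ltW.
have := sqr_enorm (k - l); have := enorm_ge0 (k - l).
pose d := enorm (k - l).
have k3E : k3 = (2^-1 * (k.1.1 + l.1.1) + d / 2 * (sin a.1 * cos a.2),
   2^-1 * (k.1.2 + l.1.2) + d / 2 * (sin a.1 * sin a.2), 2^-1 * (k.2 + l.2) + d / 2 * cos a.1)
       by rewrite hk3.
have k4E : k4 = (2^-1 * (k.1.1 + l.1.1) - d / 2 * (sin a.1 * cos a.2),
   2^-1 * (k.1.2 + l.1.2) - d / 2 * (sin a.1 * sin a.2), 2^-1 * (k.2 + l.2) - d / 2 * cos a.1)
       by rewrite hk4.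
rewrite -/d /= => d0 dE.
have bl := sqr_bracket l; have [_ el] := coord_le_enorm l.
have [e31 _] := coord_le_enorm k3; have [_ e42] := coord_le_enorm k4.
have b4 := sqr_bracket k4.
rewrite {1}k3E /= in e31; rewrite {1}k4E /= in e42; rewrite {2 3 4}k4E /= in b4.
have sd1 : k.1.1 - l.1.1 <= d.
  rewrite -(@ler_pXn2r _ 2) ?nnegrE//; last by lra.
  by rewrite dE; have := sqr_ge0 (k.1.2 - l.1.2); have := sqr_ge0 (k.2 - l.2); lra.
(* For D = k.1.1 - l.1.1 >= 18, (D + 2)^2 >= D^2 + 76, while the transverse squares add up to at
   most 50. *)
have sd2 : d <= k.1.1 - l.1.1 + 2.
  rewrite -(@ler_pXn2r _ 2) ?nnegrE//; last by lra.
  have q1 : (k.1.2 - l.1.2) ^+ 2 <= 7 ^+ 2 by apply: (@sq_le _ _ 7); lra.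
  have q2 : (k.2 - l.2) ^+ 2 <= 1 ^+ 2 by apply: (@sq_le _ _ 1); lra.
  by rewrite dE; lra.
move: (bracket k) (bracket k)^-1 (sin a.1) (cos a.1) (sin a.2) (cos a.2)
    BL1 BL2 ca0 ca1 sb0 sb1 sa0 sa1 cb0 cb1 energy B0 iB i0 e31 e42 b4 k3E k4E
  => B i s c S K BL1 BL2 ca0 ca1 sb0 sb1 sa0 sa1 cb0 cb1 energy B0 iB i0 e31 e42 b4 k3E k4E.
have i20 : i <= 20^-1.
  by rewrite -(@ler_pM2r _ B)// iB; lra.
have ii : i ^+ 2 <= 400^-1.
  have : i ^+ 2 <= 20^-1 ^+ 2 by rewrite ler_pXn2r ?nnegrE ?invr_ge0.
  by move=> h; apply: le_trans h _; lra.
have s0 : 0 <= s by lra.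
have K0 : 0 <= K by lra.
have di : d / 2 * i <= 1.
  have : d / 2 * i <= B * i by rewrite ler_wpM2r//; lra.
  by rewrite (mulrC B) iB.
have d2 : 0 <= d / 2 by lra.
have p1 : d / 2 * (s * K) <= d / 2.
  by rewrite ler_piMr// mulr_ile1.
(* The product s K is at least 1 - 2 i^2; since d / 2 * i <= 1 and i <= 1 / 20, the first component
   loses at most 1 / 10. *)
have p2 : d / 2 - 20^-1 * 2 <= d / 2 * (s * K).
  have sK : 1 - 2 * i ^+ 2 <= s * K.
    have : (1 - i ^+ 2) * (1 - i ^+ 2) <= s * K by rewrite ler_pM//; lra.
    by have := sqr_ge0 (i ^+ 2); lra.
  have h := ler_wpM2l d2 sK; apply: le_trans h.
  have : d / 2 * i * i <= 1 * 20^-1 by rewrite ler_pM// mulr_ge0.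
  by lra.
have q0 : 0 <= d / 2 * (s * S) by rewrite mulr_ge0// mulr_ge0.
have q1 : d / 2 * (s * S) <= 1.
  apply: le_trans di; apply: ler_wpM2l => //; apply: le_trans sb1.
  by rewrite ler_piMl.
have t0 : 0 <= d / 2 * c by rewrite mulr_ge0.
have t1 : d / 2 * c <= 1 by apply: le_trans di; apply: ler_wpM2l.
move: (d / 2 * (s * K)) (d / 2 * (s * S)) (d / 2 * c) p1 p2 q0 q1 t0 t1 e31 e42 b4 k3E k4E
  => p q t p1 p2 q0 q1 t0 t1 e31 e42 b4 k3E k4E.
clear ca0 ca1 sb0 sb1 sa1 cb0 cb1 iB i0 K0 di d2 dE.
have bl10 : bracket l ^+ 2 <= 42.
  have h1 : l.1.1 ^+ 2 <= 2 ^+ 2 by apply: (@sq_le _ _ 2); lra.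
  have h2 : l.1.2 ^+ 2 <= 6 ^+ 2 by apply: (@sq_le _ _ 6); lra.
  have h3 : l.2 ^+ 2 <= 1 ^+ 2 by apply: (@sq_le _ _ 1); lra.
  by rewrite bl; lra.
split.
- by rewrite k3E k4E /=; split; lra.
- split.
  + by apply: bracket_le => //; lra.
  + apply: bracket_le; first by lra.
    have B2 : 20 ^+ 2 <= B ^+ 2 by rewrite ler_pXn2r ?nnegrE ?ler0n ?(ltW B0)//; lra.
    by have := sqr_ge0 (bracket k4); rewrite exprMn; lra.
  + apply: bracket_le => //; rewrite b4.
    have h1 : (2^-1 * (k.1.1 + l.1.1) - p) ^+ 2 <= 3 ^+ 2 by apply: (@sq_le _ _ 3); lra.
    have h2 : (2^-1 * (k.1.2 + l.1.2) - q) ^+ 2 <= 3 ^+ 2 by apply: (@sq_le _ _ 3); lra.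
    have h3 : (2^-1 * (k.2 + l.2) - t) ^+ 2 <= 3 ^+ 2 by apply: (@sq_le _ _ 3); lra.
    by lra.
- by split; lra.
- by lra.
Qed.

End Cap.

(** * Lower bound of the operator from the cap *)

Section LowerBound.
Context {R : realType} (beta M : R) (beta0 : 0 <= beta) (M0 : 0 <= M).
Notation mu := (@lebesgue_measure R).
Notation resonance := (vec3 R * (R * R))%type.
Notation lebY := (@leb3 R \x @leb2 R)%E.
Implicit Types (k l : vec3 R) (x : resonance) (f : vec3 R -> R).

(** From [cap_post]: |k - l| >= <k> / 4, |k3| >= <k> / 4, the weights at brackets at most 10, 2 <k>
    and 10, and sin a.1 >= 1 / 2. *)
Definition cap_const : R :=
  4^-1 * 4^-1 `^ (2 * beta) * (10 `^ (- M) * 2 `^ (- M) * 10 `^ (- M)) / 2.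

Lemma cap_const_gt0 : 0 < cap_const.
Proof. by rewrite !mulr_gt0 ?powR_gt0 ?invr_gt0. Qed.

Lemma weight_ge k (b : R) : bracket k <= b -> b `^ (- M) <= weight M k.
Proof.
move=> kb; have k0 := bracket_gt0 k; have b0 := lt_le_trans k0 kb.
rewrite /weight !powRN lef_pV2 ?posrE ?powR_gt0//.
by rewrite ge0_ler_powR ?nnegrE ?(ltW k0) ?(ltW b0).
Qed.

(** The hypothesis on [P] covers both equations: it holds for the gain form when f(k) >= 0 and for
    the full form when f(k) = 0. *)
Lemma cap_lower (d : R) P f k x : 0 <= d -> far_region k ->
  near_box x.1 -> cap k x.2 ->
  (forall l, 0 < l.1.2 -> d * weight M l <= f l) ->
  (forall a2 a3 a4, 0 <= a2 -> 0 <= a3 -> 0 <= a4 ->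
    a2 * a3 * a4 <= P (f k) a2 a3 a4) ->
  cap_const * d ^+ 3 * (bracket k * bracket k `^ (2 * beta) * weight M k) <=
  kern P beta f k x.
Proof.
move=> d0 fk hl ha hf hP.
have [[l2 p2 q2] [bl b3 b4] [e1 e2 e3 e4] s2] := cap_post fk hl ha erefl erefl.
have B0 := bracket_gt0 k.
have Wl := weight_ge bl; have W3 := weight_ge b3; have W4 := weight_ge b4.
have fl : d * 10 `^ (- M) <= f x.1 by apply: le_trans (hf _ l2); exact: (ler_wpM2l d0 Wl).
have f3 : d * (2 `^ (- M) * weight M k) <= f (out1 k x).
  apply: le_trans (hf _ p2); apply: (ler_wpM2l d0); apply: le_trans W3.
  by rewrite powRM ?ler0n ?(ltW B0).
have f4 : d * 10 `^ (- M) <= f (out2 k x) by apply: le_trans (hf _ q2); exact: (ler_wpM2l d0 W4).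
have w0 (y : R) : 0 <= d * y `^ (- M) by rewrite mulr_ge0 ?powR_ge0.
have w0' : 0 <= d * (2 `^ (- M) * weight M k) by rewrite !mulr_ge0 ?powR_ge0 ?weight_ge0.
have fP : d * 10 `^ (- M) * (d * (2 `^ (- M) * weight M k)) * (d * 10 `^ (- M)) <=
    P (f k) (f x.1) (f (out1 k x)) (f (out2 k x)).
  apply: le_trans (hP _ _ _ _ _ _); last 3 first.
  - exact: le_trans fl.
  - exact: le_trans f3.
  - exact: le_trans f4.
  by apply: ler_pM => //; [exact: mulr_ge0|exact: ler_pM].
have eP : (bracket k / 4) `^ (2 * beta) <=
    (enorm x.1 * enorm (out1 k x) * enorm (out2 k x)) `^ (2 * beta).
  rewrite ge0_ler_powR ?nnegrE ?mulr_ge0 ?enorm_ge0 ?invr_ge0 ?(ltW B0)//.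
  rewrite -[leLHS]mulr1 -[X in X * 1]mul1r.
  by rewrite !ler_pM ?mulr_ge0 ?invr_ge0 ?(ltW B0).
apply: (@le_trans _ _ (bracket k / 4 * ((bracket k / 4) `^ (2 * beta) *
  (d * 10 `^ (- M) * (d * (2 `^ (- M) * weight M k)) * (d * 10 `^ (- M)))) * 2^-1)).
  rewrite powRM ?invr_ge0 ?(ltW B0)// /cap_const le_eqVlt; apply/orP; left; apply/eqP.
  by ring.
have t0 : 0 <= d * 10 `^ (- M) * (d * (2 `^ (- M) * weight M k)) * (d * 10 `^ (- M)).
  by rewrite mulr_ge0// mulr_ge0.
rewrite /kern; apply: ler_pM => //.
- by apply: mulr_ge0; [rewrite divr_ge0 ?ltW|rewrite mulr_ge0 ?powR_ge0].
- apply: ler_pM => //.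
  + by rewrite divr_ge0 ?ltW.
  + by rewrite mulr_ge0 ?powR_ge0.
  + by apply: ler_pM; rewrite ?powR_ge0.
Qed.

Lemma leb5_cap k : far_region k ->
  (lebY (@near_box R `*` cap k) = ((bracket k)^-1 ^+ 2)%:E)%E.
Proof.
move=> fk; have i0 : 0 < (bracket k)^-1 by rewrite invr_gt0 bracket_gt0.
have m1 (a b : R) : a < b -> mu [set` `[a, b]] = (b - a)%:E.
  by move=> ab; rewrite lebesgue_measure_itv/= lte_fin ab EFinB.
transitivity (leb3 (@near_box R) * leb2 (cap k))%E.
  apply: product_measure1E; first by do 2?apply: measurableX.
  exact: measurableX.
rewrite leb3_box; [|lra|lra|lra].
have -> : leb2 (cap k) = ((bracket k)^-1 * (bracket k)^-1)%:E.
  transitivity (mu [set` `[pi / 2 - (bracket k)^-1, pi / 2]%R] * mu [set` `[0%R,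
      (bracket k)^-1]%R])%E.
    exact: product_measure1E.
  by rewrite !m1// ?ltrBlDr ?ltrDl// opprB subr0 addrC subrK EFinM.
by rewrite -EFinM; congr EFin; ring.
Qed.

Lemma cubic_op_lower P f k (c : R) : far_region k -> 0 <= c ->
  lebY.-integrable (@resonant_dom R) (EFin \o kern P beta f k) ->
  (forall x, resonant_dom x -> 0 <= kern P beta f k x) ->
  (forall x, near_box x.1 -> cap k x.2 -> c <= kern P beta f k x) ->
  enorm k `^ (2 * beta) * (8^-1 * (c * (bracket k)^-1 ^+ 2)) <= cubic_op P beta f k.
Proof.
move=> fk c0 ik k0 kc; apply: ler_wpM2l; first exact: powR_ge0.
apply: ler_wpM2l; first by rewrite invr_ge0.
have i0 : 0 < (bracket k)^-1 by rewrite invr_gt0 bracket_gt0.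
have i1 : (bracket k)^-1 <= 1 by rewrite invf_le1 ?bracket_gt0 ?bracket_ge1.
have mS : measurable (@near_box R `*` cap k).
  by apply: measurableX; [do 2?apply: measurableX|exact: measurableX].
have sub : @near_box R `*` cap k `<=` @resonant_dom R.
  have p1 := pihalf_ge1 R.
  move=> x [_ []]/=; rewrite !in_itv/= => /andP[a1 a2] /andP[b1 b2]; split => //.
  by split; rewrite /= in_itv/=; apply/andP; split => //; lra.
have mk := measurable_int _ ik.
(* [fine] would send an infinite integral to 0; integrability excludes this. *)
rewrite -lee_fin /Rintegral fineK; last first.
  by apply: integrable_fin_num ik; exact: measurable_resonant_dom.
apply: (@le_trans _ _ (\int[lebY]_(x in @near_box R `*` cap k) (kern P beta f k x)%:E)%E);
    last first.
  apply: ge0_subset_integral => //; exact: measurable_resonant_dom.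
apply: (@le_trans _ _ (\int[lebY]_(x in @near_box R `*` cap k) (cst c%:E x))%E).
  rewrite integral_cst// EFinM; apply: lee_wpmul2l; first by rewrite lee_fin.
  by rewrite -(leb5_cap fk).
apply: ge0_le_integral => //.
  by apply: measurable_funS mk => //; exact: measurable_resonant_dom.
by move=> x [h1 h2]; rewrite lee_fin; exact: kc.
Qed.

End LowerBound.

Section NormInflation.
Context {R : realType} (beta M : R) (beta0 : 0 <= beta) (M0 : 0 <= M).
Notation mu := (@lebesgue_measure R).
Notation lebY := (@leb3 R \x @leb2 R)%E.
Implicit Types (k l : vec3 R) (f g : vec3 R -> R).

Lemma ae_not_null (S : set (vec3 R)) : measurable S ->
  {ae leb3, forall k, ~ S k} -> leb3 S = 0%E.
Proof.
move=> mS [N [mN N0 SN]]; apply: (@subset_measure0 _ _ _ leb3 S N) => //.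
by move=> k Sk; apply: SN => /=; exact.
Qed.

Lemma wnorm_eq f (d : R) : bounded_by M d f ->
  (forall k, near_box k -> f k = d * weight M k) -> wnorm M f = d%:E.
Proof.
move=> hf fd; have d0 := bounded_by_ge0 hf.
have le_d : (wnorm M f <= d%:E)%E by apply/wnorm_leP/aeW.
apply/eqP; rewrite eq_le le_d /= leNgt; apply/negP => lt_d.
have fin : wnorm M f \is a fin_num by rewrite ge0_fin_numE ?wnorm_ge0// (lt_le_trans lt_d)// leey.
have h : (wnorm M f <= (fine (wnorm M f))%:E)%E by rewrite fineK.
move/wnorm_leP in h; move: lt_d; rewrite -(fineK fin) lte_fin => lt_d.
have mB : measurable (@near_box R) by do 2?apply: measurableX.
have : leb3 (@near_box R) = 0%E.
  apply: ae_not_null => //; apply: filterS h => k hk /fd fk.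
  move: hk; rewrite fk ger0_norm ?mulr_ge0 ?weight_ge0// ler_pM2r ?weight_gt0//.
  by rewrite leNgt lt_d.
rewrite leb3_box; [|lra|lra|lra] => -[] /eqP; apply/negP; rewrite gt_eqF//; lra.
Qed.

Definition far_b k : bool := [&& 20 <= k.1.1, -1 <= k.1.2 <= 0 & 0 <= k.2 <= 1].

Lemma far_bP k : reflect (far_region k) (far_b k).
Proof. exact: and3P. Qed.

Lemma measurable_far_b : measurable_fun [set: vec3 R] far_b.
Proof.
have [m1 m2 m3] := measurable_coord (@measurable_id _ (vec3 R) setT).
by do ![apply: measurable_and]; apply: measurable_fun_ler.
Qed.

Context (P : R -> R -> R -> R -> R) (cP : cubic_form P).
Notation Q := (cubic_op P beta).

(* A strong solution stays within [e] of [f0] on some [0, tau], where the lower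
   bound on [Q] forces [tau * c * <k>^(4 beta - 1)] to be bounded. *)
Lemma norm_inflation f0 (d e c : R) : 4^-1 < beta -> measurable_fun setT f0 ->
  bounded_by M d f0 -> 0 < e -> 0 < c ->
  (forall g, measurable_fun setT g -> bounded_by M e (g \- f0) ->
    forall k, far_region k ->
    c * (bracket k `^ (2 * (2 * beta) - 1) * weight M k) <= Q g k) ->
  forall T : R, 0 < T -> ~ exists u, strong_solution Q M T f0 u.
Proof.
move=> b4 mf0 hf0 e0 c0 H T T0 [u [cu /integral_equation_repr[F [mF Fu iF eF]]]].
have d0 := bounded_by_ge0 hf0.
have T00 : (0 : R) \in `[0, T] by rewrite in_itv/= lexx ltW.
have u0 : {ae leb3, forall k, u 0 k = f0 k}.
  by apply: filterS (eF 0 T00) => k ->; rewrite set_itv1 Rintegral_set1 addr0.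
have [tau [tau0 tauT htau]] : exists tau, [/\ 0 < tau, tau <= T & forall s, s \in `[0, tau] ->
    {ae leb3, forall k, `|u s k - u 0 k| <= e * weight M k}].
  have [r /= r0 hr] := continuous_curve_near cu e0 T00.
  exists (Num.min T (r / 2)); split.
  - by rewrite lt_min T0 divr_gt0.
  - by rewrite ge_min lexx.
  - move=> s; rewrite in_itv/= le_min => /andP[s0 /andP[sT sr]].
    apply: hr; last by rewrite in_itv/= s0.
    by rewrite /ball_/= sub0r normrN ger0_norm//; lra.
have tauI : tau \in `[0, T] by rewrite in_itv/= tauT ltW.
(* The cutoff to the far region gives an inequality for almost every k, the form that [ae_swap]
   accepts. *)
have slice s : s \in `[0, tau] -> {ae leb3, forall k,
    (if far_b k then c * (bracket k `^ (2 * (2 * beta) - 1) * weight M k) else 0) <=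
    (if far_b k then Q (fun l => F (s, l)) k else 0)}.
  move=> st; have sT : s \in `[0, T].
    by move: st; rewrite !in_itv/= => /andP[-> /le_trans]; apply.
  have mFs : measurable_fun setT (fun l => F (s, l)) by exact: measurable_fun_pair2.
  (* [g] equals F(s) off a null set and is within [e] of [f0] everywhere, as [H] demands. *)
  pose g k := if `|F (s, k) - f0 k| <= e * weight M k then F (s, k) else f0 k.
  have mg : measurable_fun setT g by exact: measurable_truncate.
  have gF : (fun l => F (s, l)) = g %[ae leb3].
    move: (Fu s sT) u0 (htau s st); apply: filterS3 => k /(_ I) Fk uk hk _.
    by rewrite /g Fk -uk hk.
  have hg : bounded_by M e (g \- f0).
    move=> k; rewrite /= /g; case: ifP => //.
    by rewrite subrr normr0 mulr_ge0 ?weight_ge0// ltW.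
  have QE := cubic_op_ae_eq beta cP mFs mg gF.
  apply: filterS QE => k ->; case: ifP => // /far_bP fk.
  exact: H.
have mfar : measurable_fun setT (fun z : R * vec3 R => far_b z.2).
  exact: (measurableT_comp measurable_far_b (@measurable_snd _ _ R (vec3 R))).
have mop : measurable_fun setT (fun z : R * vec3 R => Q (fun l => F (z.1, l)) z.2).
  apply: (measurable_cubic_op beta cP (T := (R * vec3 R)%type) (F := fun q => F (q.1.1, q.2))).
    apply: (measurableT_comp mF); apply: measurable_fun_pair.
      exact: (measurableT_comp (@measurable_fst _ _ R (vec3 R))
          (@measurable_fst _ _ (R * vec3 R)%type (vec3 R))).
    exact: (@measurable_snd _ _ (R * vec3 R)%type (vec3 R)).
  exact: (@measurable_snd _ _ R (vec3 R)).
have mlow : measurable_fun setT (fun z : R * vec3 R =>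
    c * (bracket z.2 `^ (2 * (2 * beta) - 1) * weight M z.2)).
  have m2 := @measurable_snd _ _ R (vec3 R).
  apply: measurable_funM => //; apply: measurable_funM.
    by apply: (measurableT_comp (measurable_powR _)); exact: measurable_bracket.
  exact: (measurableT_comp (measurable_weight M) m2).
have sw := ae_swap (measurable_fun_ifT mfar mlow (measurable_cst (0 : R)))
  (measurable_fun_ifT mfar mop (measurable_cst (0 : R))) slice.
have [A A0 hA] := continuous_curve_bounded cu.
pose gam := 2 * (2 * beta) - 1.
have gam0 : 0 < gam by rewrite /gam; lra.
have bound : {ae leb3, forall k, far_region k -> tau * c * bracket k `^ gam <= A + d}.
  have h4 : {ae leb3, forall k, `|u tau k| <= A * weight M k /\
      u tau k = f0 k + \int[mu]_(s in `[0, tau]) Q (fun l => F (s, l)) k}.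
    by move: (hA tau tauI) (eF tau tauI); apply: filterS2.
  move: sw iF h4; apply: filterS3 => k swk ik [uA uE] fk.
  have sub : `[0, tau] `<=` `[0, T].
    by move=> s /=; rewrite !in_itv/= => /andP[-> /le_trans]; apply.
  have tau0' := ltW tau0.
  set X := c * (bracket k `^ gam * weight M k).
  have int_ge : \int[mu]_(s in `[0, tau]) cst X s <=
      \int[mu]_(s in `[0, tau]) Q (fun l => F (s, l)) k.
    apply: ae_le_Rintegral.
    - exact: measurable_itv.
    - apply: (@bounded_integrable_itv _ (cst X) 0 tau `|X| true false tau0' _ _).1 => [|s _].
        exact: measurable_cst.
      exact: lexx.
    - exact: integrableS ik.
    apply: filterS swk => s hs st; have := hs st.
    by rewrite /=; have /far_bP -> := fk.
  have XI : \int[mu]_(s in `[0, tau]) cst X s = X * tau.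
    rewrite Rintegral_cst; last exact: measurable_itv.
    have -> : fine (mu `[0, tau]) = tau by rewrite lebesgue_measure_itv/= lte_fin tau0 -EFinB subr0.
    by [].
  rewrite XI in int_ge.
  have w0 := weight_gt0 M k.
  rewrite -(ler_pM2r w0).
  have h1 := le_trans (ler_norm _) uA.
  have h2 : - f0 k <= d * weight M k.
    by apply: le_trans (ler_norm _) _; rewrite normrN; exact: hf0.
  by rewrite uE in h1; move: int_ge h1 h2; rewrite /X; lra.
(* tau c K exceeds A + d by tau c, and L is such that <k>^gam >= K on [box]: this contradicts
   [bound]. *)
pose K := (A + d) / (tau * c) + 1.
have tc0 : 0 < tau * c by rewrite mulr_gt0.
have K0 : 0 < K by rewrite ltr_wpDl// divr_ge0 ?addr_ge0 ?(ltW A0) ?(ltW tc0).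
pose L := Num.max 20 (K `^ gam^-1).
pose box : set (vec3 R) := [set` `[L, L + 1]] `*` [set` `[-1, 0]] `*` [set` `[0, 1]].
have L20 : 20 <= L by rewrite le_max lexx.
have : leb3 box = 0%E.
  apply: ae_not_null; first by do 2?apply: measurableX.
  apply: filterS bound => k hk [[]]; rewrite /= !in_itv/= => /andP[kL _] k2 k3.
  have fk : far_region k by split => //; exact: le_trans kL.
  have := hk fk; apply/negP; rewrite -ltNge.
  have /andP[kB _] := far_bracket fk.
  have KB : K <= bracket k `^ gam.
    have -> : K = (K `^ gam^-1) `^ gam by rewrite -powRrM mulVf ?gt_eqF// powRr1 ?ltW.
    rewrite ge0_ler_powR ?nnegrE ?powR_ge0 ?bracket_ge0 ?(ltW gam0)//.
    by apply: le_trans kB; apply: le_trans kL; rewrite le_max lexx orbT.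
  apply: lt_le_trans (ler_wpM2l (ltW tc0) KB).
  by rewrite /K mulrDr mulrCA divff ?gt_eqF// !mulr1 ltrDl.
rewrite leb3_box; [|lra|lra|lra] => -[] /eqP; apply/negP; rewrite gt_eqF//; lra.
Qed.

End NormInflation.

(** * Well-posedness and ill-posedness *)

Section Main.
Context {R : realType}.
Notation lebY := (@leb3 R \x @leb2 R)%E.
Implicit Types (k l : vec3 R) (f g : vec3 R -> R).

Lemma cubic_op_well_posed (beta M : R) P : 0 <= beta -> beta <= 4^-1 -> 6 < M ->
  cubic_form P -> locally_well_posed (cubic_op P beta) M.
Proof.
move=> b0 b4 M6 cP f0 hf0.
have M4 : 4 <= M - 2 * beta by lra.
have M2 : 2 < M - 2 * (2 * beta) by lra.
have q4 : 4 < M - 2 * (2 * beta) by lra.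
have [C C0 hC] := op_const_le q4.
have op_C k : op_const beta M k <= C * weight M k.
  apply: le_trans (hC k) _; apply: ler_wpM2l; first exact: ltW.
  rewrite ler_piMl ?weight_ge0// -[leRHS](powRr0 (bracket k)) ler_powR ?bracket_ge1//.
  lra.
have [A A0 hA] := wLinfty_bound hf0.
have [g0 [mg0 bg0 g0f0]] := ae_bounded_repr (ltW A0) hf0.1 hA.
(* The time for which the Picard map contracts on the ball of radius 2 A. *)
exists (24 * A ^+ 2 * C)^-1; split.
- by rewrite invr_gt0 !mulr_gt0.
- apply: (picard_strong_solution b0 M4 M2 cP C0 op_C mg0 A0 bg0).
  by apply: filterS g0f0 => k h /h.
- by move=> u v su sv; exact: (strong_solution_unique b0 M4 M2 cP C0 op_C su sv).
Qed.

Definition far_const (beta M : R) : R := 2^-1 `^ (2 * beta) * 8^-1 * cap_const beta M.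

Lemma far_const_gt0 beta M : 0 < far_const beta M.
Proof. by rewrite !mulr_gt0 ?powR_gt0 ?invr_gt0// cap_const_gt0. Qed.

(** Powers of <k>: 2 beta from the prefactor, 1 + 2 beta from the kernel over the cap, and -2 from
    the area of the cap, in total 4 beta - 1. *)
Lemma cubic_op_far (beta M d : R) P f k : 0 <= beta -> 0 <= M -> 0 <= d ->
  far_region k ->
  lebY.-integrable (@resonant_dom R) (EFin \o kern P beta f k) ->
  (forall l, 0 < l.1.2 -> d * weight M l <= f l) ->
  (forall a2 a3 a4, 0 <= a2 -> 0 <= a3 -> 0 <= a4 ->
    a2 * a3 * a4 <= P (f k) a2 a3 a4) -> (forall l, 0 <= f l) ->
  far_const beta M * d ^+ 3 * (bracket k `^ (2 * (2 * beta) - 1) * weight M k) <=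
  cubic_op P beta f k.
Proof.
move=> b0 M0 d0 fk ik hf hP f0.
have B0 := bracket_gt0 k.
pose c := cap_const beta M * d ^+ 3 * (bracket k * bracket k `^ (2 * beta) * weight M k).
have c0 : 0 <= c.
  apply: mulr_ge0; first by apply: mulr_ge0; [exact: ltW (cap_const_gt0 _ _)|exact: exprn_ge0].
  by apply: mulr_ge0; [apply: mulr_ge0; [exact: ltW|exact: powR_ge0]|exact: weight_ge0].
have k0 x : resonant_dom x -> 0 <= kern P beta f k x.
  move=> [_ [ax _]]; rewrite /kern.
  apply: mulr_ge0; last by apply: sin_ge0_pi; move: ax; rewrite /= in_itv.
  apply: mulr_ge0; first exact: enorm_ge0.
  apply: mulr_ge0; first exact: powR_ge0.
  by apply: le_trans (hP _ _ _ _ _ _) => //; rewrite !mulr_ge0.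
have kc x : near_box x.1 -> cap k x.2 -> c <= kern P beta f k x.
  by move=> h1 h2; exact: (cap_lower b0 M0 d0 fk h1 h2 hf).
apply: le_trans (cubic_op_lower fk c0 ik k0 kc).
have /andP[_ kB] := far_bracket fk; have [ke _] := coord_le_enorm k.
have Be : bracket k * 2^-1 <= enorm k by lra.
have eB : bracket k `^ (2 * beta) * 2^-1 `^ (2 * beta) <= enorm k `^ (2 * beta).
  rewrite -powRM ?invr_ge0 ?(ltW B0)//.
  by rewrite ge0_ler_powR ?nnegrE ?mulr_ge0 ?invr_ge0 ?enorm_ge0 ?(ltW B0).
have p0 : 0 <= 8^-1 * (c * (bracket k)^-1 ^+ 2).
  by rewrite mulr_ge0 ?invr_ge0// mulr_ge0// sqr_ge0.
apply: le_trans (ler_wpM2r p0 eB).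
have -> : bracket k `^ (2 * (2 * beta) - 1) = bracket k `^ (2 * beta) * bracket k `^ (2 * beta)
    / bracket k.
  rewrite -powR_inv1 ?(ltW B0)// -!powRD ?(gt_eqF B0) ?implybT//.
  by congr (_ `^ _); ring.
rewrite /c /far_const le_eqVlt; apply/orP; left; apply/eqP.
by field; rewrite gt_eqF.
Qed.

Lemma far_enorm_gt0 (beta : R) k : far_region k -> 0 < enorm k `^ (2 * beta).
Proof.
move=> fk; have [ke _] := coord_le_enorm k; have [k20 _ _] := fk.
by rewrite powR_gt0//; lra.
Qed.

(** Every g within d / 2 of the datum is at least d / 2 times the weight, so the lower bound applies
    to g itself. All terms being nonnegative, convergence of the integral at each k is enough. *)
Lemma gain_ill_posed (beta M : R) : 0 <= beta <= 1 -> 4^-1 < beta -> 6 < M ->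
  ill_posed_any_size (cubic_op gain_form beta) M.
Proof.
move=> /andP[b0 b1] b4 M6 d d0.
have M4 : 4 <= M - 2 * beta by lra.
have M2 : 2 < M - 2 * (2 * beta) by lra.
pose f0 k := d * weight M k.
have mf0 : measurable_fun setT f0 by apply: measurable_funM => //; exact: measurable_weight.
have bf0 : bounded_by M d f0 by move=> k; rewrite ger0_norm// mulr_ge0 ?weight_ge0// ltW.
have dh : 0 < d / 2 by rewrite divr_gt0.
exists f0; split.
- exact: bounded_by_wLinfty bf0.
- exact: wnorm_eq.
have c0 : 0 < far_const beta M * (d / 2) ^+ 3.
  by rewrite mulr_gt0 ?far_const_gt0 ?exprn_gt0.
apply: (norm_inflation gain_form_cubic b4 mf0 bf0 dh c0) => g mg hg k fk.
have lg l : d / 2 * weight M l <= g l.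
  have := hg l; rewrite /= ler_norml => /andP[h _].
  by move: h; rewrite /f0; lra.
have g0 l : 0 <= g l by apply: le_trans (lg l); rewrite mulr_ge0 ?weight_ge0 ?(ltW dh).
have bg : bounded_by M (2 * d) g.
  move=> l; rewrite ger0_norm//.
  have := hg l; rewrite /= ler_norml => /andP[_ h].
  by have := weight_ge0 M l; move: h d0; rewrite /f0; nra.
apply: (cubic_op_far b0 _ (ltW dh) fk) => //.
- lra.
- apply: (kern_integrable b0 M4 gain_form_cubic _ (far_enorm_gt0 beta fk) mg bg).
  exact: integral_majorant_lty.
- by move=> a2 a3 a4 a20 a30 a40; rewrite /gain_form lerDl !mulr_ge0.
Qed.

(** A perturbed g may be nonzero at k and change sign, so positivity is lost; the lower bound is
    proved for [f0] and passed to g by the Lipschitz estimate, whose constant grows with the same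
    power of <k>. *)
Lemma collision_ill_posed (beta M : R) : 0 <= beta <= 1 -> 4^-1 < beta -> 10 < M ->
  ill_posed_any_size (cubic_op coll_form beta) M.
Proof.
move=> /andP[b0 b1] b4 M10 d d0.
have M4 : 4 <= M - 2 * beta by lra.
have M2 : 2 < M - 2 * (2 * beta) by lra.
have q4 : 4 < M - 2 * (2 * beta) by lra.
have [C C0 hC] := op_const_le q4.
pose f0 k := if 0 < k.1.2 then d * weight M k else 0.
have mf0 : measurable_fun setT f0.
  have [_ m2 _] := measurable_coord (@measurable_id _ (vec3 R) setT).
  apply: measurable_fun_ifT => //; first exact: measurable_fun_ltr.
  by apply: measurable_funM => //; exact: measurable_weight.
have f00 k : 0 <= f0 k by rewrite /f0; case: ifP => // _; rewrite mulr_ge0 ?weight_ge0// ltW.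
have bf0 : bounded_by M d f0.
  move=> k; rewrite ger0_norm// /f0; case: ifP => // _.
  by rewrite mulr_ge0 ?weight_ge0// ltW.
exists f0; split.
- exact: bounded_by_wLinfty bf0.
- apply: wnorm_eq => // k [[_ +] _]; rewrite /= in_itv/= => /andP[k5 _].
  by rewrite /f0 ifT//; lra.
pose c := far_const beta M * d ^+ 3.
have c0 : 0 < c by rewrite mulr_gt0 ?far_const_gt0 ?exprn_gt0.
have D0 : 0 < 24 * d ^+ 2 * C by rewrite !mulr_gt0// exprn_gt0.
(* The Lipschitz estimate with amplitude 2 d gives an error 12 d^2 e C X; this choice keeps it below
   c / 2 * X, half of the lower bound. *)
pose e := Num.min d (c / (24 * d ^+ 2 * C)).
have e0 : 0 < e by rewrite lt_min d0 divr_gt0.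
have ed : e <= d by rewrite ge_min lexx.
have ec : e * (24 * d ^+ 2 * C) <= c by rewrite -ler_pdivlMr// ge_min lexx orbT.
have ch : 0 < c / 2 by rewrite divr_gt0.
apply: (norm_inflation coll_form_cubic b4 mf0 bf0 e0 ch) => g mg hg k fk.
have wM x y l : x <= y -> x * weight M l <= y * weight M l.
  by move=> xy; rewrite ler_wpM2r// weight_ge0.
have bg : bounded_by M (2 * d) g.
  move=> l; rewrite -(subrK (f0 l) (g l)) (le_trans (ler_normD _ _))//.
  apply: le_trans (lerD (hg l) (bf0 l)) _; rewrite -mulrDl; apply: wM; lra.
have bf2 : bounded_by M (2 * d) f0.
  by move=> l; apply: le_trans (bf0 l) _; apply: wM; lra.
have fk0 : f0 k = 0.
  have [_ /andP[_ k0] _] := fk; by rewrite /f0 ltNge k0.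
set X := bracket k `^ (2 * (2 * beta) - 1) * weight M k.
have X0 : 0 <= X by rewrite mulr_ge0 ?powR_ge0 ?weight_ge0.
have low : c * X <= cubic_op coll_form beta f0 k.
  apply: (cubic_op_far b0 _ (ltW d0) fk) => //.
  - lra.
  - apply: (kern_integrable b0 M4 coll_form_cubic _ (far_enorm_gt0 beta fk) mf0 bf0).
    exact: integral_majorant_lty.
  - by move=> l l0; rewrite /f0 l0; exact: lexx.
    - by move=> a2 a3 a4 _ _ _; rewrite fk0 /coll_form !mul0r addr0 !subr0.
have lip := cubic_op_diff_le b0 M4 coll_form_cubic (integral_majorant_lty k M2) mg mf0 bg bf2 hg.
have h1 : 3 * (2 * d) ^+ 2 * e * op_const beta M k <= c / 2 * X.
  apply: (@le_trans _ _ (3 * (2 * d) ^+ 2 * e * (C * X))).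
    by apply: ler_wpM2l (hC k); rewrite !mulr_ge0 ?(ltW e0) ?(ltW d0).
  have := ler_wpM2r X0 ec; lra.
have := le_trans lip h1; rewrite ler_norml => /andP[h2 _].
by move: low h2; lra.
Qed.

End Main.

Theorem theorem1p1 (R : realType) (beta : R) (hbeta : 0 <= beta <= 1) :
  (beta <= 4^-1 ->
     forall M : R, 6 < M -> locally_well_posed (collision beta) M) /\
  (4^-1 < beta ->
     (forall M : R, 6 < M -> ill_posed_any_size (gain beta) M) /\
     (forall M : R, 10 < M -> ill_posed_any_size (collision beta) M)).
Proof.
split=> [b4 M M6|b4].
  have /andP[b0 _] := hbeta.
  by rewrite collisionE; exact: cubic_op_well_posed coll_form_cubic.
split=> M MM.
  by rewrite gainE; exact: gain_ill_posed.
by rewrite collisionE; exact: collision_ill_posed.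
Qed.
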